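(* Let $a,b,c\in\mathbb{R}$, $\alpha>-1$, $\beta>-1$, and suppose $1\le q<p\le\infty$. Then the following conditions are equivalent. (i) The operator $S_{a,b,c}$ is bounded from $L^p_\alpha$ to $L^q_\beta$. (ii) The operator $T_{a,b,c}$ is bounded from $L^p_\alpha$ to $L^q_\beta$. (iii) The parameters satisfy $$-qa<\beta+1,\qquad \alpha+1<p(b+1),\qquad c<n+1+a+b+\frac{1+\beta}{q}-\frac{1+\alpha}{p}.$$ When $p=\infty$, these conditions in (iii) are to be interpreted as $$-qa<\beta+1,\qquad b>-1,\qquad c<n+1+a+b+\frac{\beta+1}{q}.$$
   Context: Let $n\ge 1$ be an integer, $\mathbb{B}_n$ the open unit ball of $\mathbb{C}^n$, $\langle z,w\rangle=\sum_{j=1}^n z_j\overline{w_j}$, and $dv$ the normalized volume measure on $\mathbb{B}_n$, so $v(\mathbb{B}_n)=1$. For $\alpha>-1$ let $dv_\alpha(z)=c_\alpha(1-|z|^2)^\alpha\,dv(z)$ with $c_\alpha=\Gamma(n+\alpha+1)/[n!\,\Gamma(\alpha+1)]$, so that $v_\alpha(\mathbb{B}_n)=1$. For $1\le p<\infty$, $L^p_\alpha=L^p(\mathbb{B}_n,dv_\alpha)$ with norm $\|f\|_{p,\alpha}=\left(\int_{\mathbb{B}_n}|f|^p\,dv_\alpha\right)^{1/p}$; $L^\infty$ is the space of essentially bounded measurable functions on $\mathbb{B}_n$ with the essential supremum norm, and $L^\infty_\alpha=L^\infty$ for every $\alpha>-1$. For $a,b,c\in\mathbb{R}$ the Forelli-Rudin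 type operators are $$T_{a,b,c}f(z)=(1-|z|^2)^a\int_{\mathbb{B}_n}\frac{(1-|w|^2)^b}{(1-\langle z,w\rangle)^c}f(w)\,dv(w),\qquad S_{a,b,c}f(z)=(1-|z|^2)^a\int_{\mathbb{B}_n}\frac{(1-|w|^2)^b}{|1-\langle z,w\rangle|^c}f(w)\,dv(w),$$ where the power is the principal branch ($\operatorname{Re}(1-\langle z,w\rangle)>0$). Such an operator is bounded from $L^p_\alpha$ to $L^q_\beta$ if for every $f\in L^p_\alpha$ the defining integral converges (absolutely, for $z\in\mathbb{B}_n$) and there is a constant $C$, independent of $f$, with the $L^q_\beta$ norm of the image at most $C$ times the $L^p_\alpha$ norm of $f$. *)

(* Defs.v *)
From HB Require Import structures.
From mathcomp Require Import all_boot all_order all_algebra.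
From mathcomp Require Import complex.
From mathcomp Require Import all_classical all_reals all_analysis.
From mathcomp Require Import measurable_realfun.
Set Implicit Arguments.
Unset Strict Implicit.
Unset Printing Implicit Defensive.
Import Order.TTheory GRing.Theory Num.Theory.
Import numFieldNormedType.Exports.
Import Normc.

Local Open Scope classical_set_scope.
Local Open Scope ring_scope.
Local Open Scope complex_scope.

(* The Borel sigma-algebra of the complex plane, transported from R * R. *)
Definition complex_pair (R : Type) (z : R[i]) : R * R :=
  (complex.Re z, complex.Im z).
Definition pair_complex (R : Type) (p : R * R) : R[i] := p.1 +i* p.2.

HB.instance Definition _ (R : realType) := isPointed.Build R[i] 0.

Section complex_measurable.
Variable R : realType.

Let M : set (set R[i]) :=
  preimage_set_system setT (@complex_pair R)
    (measurable : set (set (measurableTypeR R * measurableTypeR R))).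

Let sM : sigma_algebra setT M.
Proof. exact/sigma_algebra_preimage/sigma_algebra_measurable. Qed.

Let M0 : M set0. Proof. by case: sM. Qed.
Let MC A : M A -> M (~` A).
Proof. by case: sM => _ + _ => /[apply]; rewrite setTD. Qed.
Let MU (F : (set R[i])^nat) : (forall i, M (F i)) -> M (\bigcup_i F i).
Proof. by case: sM => _ _; exact. Qed.

HB.instance Definition _ :=
  @isMeasurable.Build (preimage_display (@complex_pair R)) R[i] M M0 MC MU.

Lemma measurable_complex_pair : measurable_fun setT
  (@complex_pair R : R[i] -> measurableTypeR R * measurableTypeR R).
Proof. by move=> _ B mB; exists B. Qed.

Lemma measurable_pair_complex : measurable_fun setT
  (@pair_complex R : measurableTypeR R * measurableTypeR R -> R[i]).
Proof.
move=> _ _ [B mB <-]; rewrite !setTI.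
by rewrite (_ : _ @^-1` _ = B)//; apply/seteqP; split=> -[].
Qed.

Lemma measurable_Re : measurable_fun setT (@complex.Re R : R[i] -> measurableTypeR R).
Proof. exact: (measurableT_comp measurable_fst measurable_complex_pair). Qed.

Lemma measurable_Im : measurable_fun setT (@complex.Im R : R[i] -> measurableTypeR R).
Proof. exact: (measurableT_comp measurable_snd measurable_complex_pair). Qed.

End complex_measurable.

Section sigma_finite_helpers.
Context d1 d2 (T1 : measurableType d1) (T2 : measurableType d2) (R : realType).

Lemma product_measure_sigma_finite
    (m1 : {sigma_finite_measure set T1 -> \bar R})
    (m2 : {sigma_finite_measure set T2 -> \bar R}) :
  sigma_finite setT (m1 \x m2)%E.
Proof.
have /sigma_finiteP[F [TF ndF Foo]] := sigma_finiteT m1.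
have /sigma_finiteP[G [TG ndG Goo]] := sigma_finiteT m2.
exists (fun n => F n `*` G n).
  rewrite -setXTT TF TG predeqE => -[x y]; split.
    move=> [/= [n _ Fnx] [k _ Gky]]; exists (maxn n k) => //; split.
    - by move: x Fnx; exact/subsetPset/ndF/leq_maxl.
    - by move: y Gky; exact/subsetPset/ndG/leq_maxr.
  by move=> [n _ []/= ? ?]; split; exists n.
move=> k; have [? ?] := Foo k; have [? ?] := Goo k.
split; first exact: measurableX.
by rewrite product_measure1E// lte_mul_pinfty// ge0_fin_numE.
Qed.

End sigma_finite_helpers.

Section pushforward_sigma_finite.
Context d1 d2 (T1 : measurableType d1) (T2 : measurableType d2).
Context (R : realType) (m : {measure set T1 -> \bar R}).
Hypothesis sm : sigma_finite setT m.
Variables (f : T1 -> T2) (g : T2 -> T1).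
Hypotheses (mf : measurable_fun setT f) (mg : measurable_fun setT g).
Hypothesis fK : cancel f g.

Definition push : set T2 -> \bar R := pushforward m f.

Let push0 : push set0 = 0%E. Proof. exact: measure0. Qed.
Let push_ge0 A : (0 <= push A)%E. Proof. exact: measure_ge0. Qed.
Let push_sigma_additive : semi_sigma_additive push.
Proof. exact: measure_semi_sigma_additive. Qed.

HB.instance Definition _ := isMeasure.Build _ _ _ push
  push0 push_ge0 push_sigma_additive.

Let push_sigma_finite : sigma_finite setT push.
Proof.
have [F UF mF] := sm.
exists (fun k => g @^-1` F k).
  by rewrite -preimage_bigcup -UF preimage_setT.
move=> k; split.
  by rewrite -[X in measurable X]setTI; apply: mg => //; exact: (mF k).1.
rewrite /push /pushforward -comp_preimage (_ : g \o f = id).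
  exact: (mF k).2.
by apply/funext => x /=; rewrite fK.
Qed.

HB.instance Definition _ := Measure_isSigmaFinite.Build _ _ _ push
  push_sigma_finite.

Lemma pushforward_sigma_finite_measure :
  {m' : {sigma_finite_measure set T2 -> \bar R} |
    pushforward m f = m' :> (set T2 -> \bar R)}.
Proof. by exists push. Qed.

End pushforward_sigma_finite.

Section lebesgue.
Variable R : realType.
Local Open Scope ereal_scope.

Definition lebesgueC : set R[i] -> \bar R :=
  pushforward (lebesgue_measure \x lebesgue_measure) (@pair_complex R).

(* Lebesgue measure on C^n, by iterated integration over the coordinates;
   on C^0 it is the unit mass at the empty tuple. *)
Fixpoint lebesgueCn (n : nat) : set (n.-tuple R[i]) -> \bar R :=
  match n with
  | 0 => \d_[tuple]
  | m.+1 => fun A =>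
      \int[lebesgueC]_z lebesgueCn [set t : m.-tuple R[i] | A [tuple of z :: t]]
  end.

Lemma lebesgueC_measure :
  {m : {sigma_finite_measure set R[i] -> \bar R} | lebesgueC = m}.
Proof.
have cK : cancel (@pair_complex R) (@complex_pair R) by case.
exact: (pushforward_sigma_finite_measure
  (product_measure_sigma_finite lebesgue_measure lebesgue_measure)
  (@measurable_pair_complex R) (@measurable_complex_pair R) cK).
Qed.

Lemma lebesgueCn_measure n :
  {m : {sigma_finite_measure set (n.-tuple R[i]) -> \bar R} | @lebesgueCn n = m}.
Proof.
elim: n => [|n [m mE]]; first by exists (\d_[tuple]).
have [l lE] := lebesgueC_measure.
pose cons_pair (p : R[i] * n.-tuple R[i]) : n.+1.-tuple R[i] :=
  [tuple of p.1 :: p.2].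
pose uncons (t : n.+1.-tuple R[i]) : R[i] * n.-tuple R[i] :=
  (thead t, [tuple of behead t]).
have cK : cancel cons_pair uncons.
  by case=> z t; rewrite /uncons /cons_pair /= theadE; congr pair; exact/val_inj.
have [m' m'E] := pushforward_sigma_finite_measure
  (product_measure_sigma_finite l m)
  (measurable_cons measurable_fst measurable_snd)
  (measurable_fun_pair (measurable_tnth ord0) (@measurable_behead _ _ n)) cK.
exists m'; rewrite -m'E /= lE; apply/funext => A.
rewrite /pushforward /product_measure1 /=; apply: eq_integral => z _.
rewrite mE /=; congr (m _); apply/funext => t.
by rewrite /xsection /= in_setE.
Qed.

Section lebesgueC_instance.
Let leb0 : lebesgueC set0 = 0.
Proof. by have [m ->] := lebesgueC_measure. Qed.
Let leb_ge0 A : 0 <= lebesgueC A.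
Proof. by have [m ->] := lebesgueC_measure. Qed.
Let leb_sigma_additive : semi_sigma_additive lebesgueC.
Proof.
by have [m ->] := lebesgueC_measure; exact: measure_semi_sigma_additive.
Qed.
HB.instance Definition _ := isMeasure.Build _ _ _ lebesgueC
  leb0 leb_ge0 leb_sigma_additive.

Let leb_sigma_finite : sigma_finite setT lebesgueC.
Proof. by have [m ->] := lebesgueC_measure; exact: sigma_finiteT. Qed.
HB.instance Definition _ := Measure_isSigmaFinite.Build _ _ _ lebesgueC
  leb_sigma_finite.
End lebesgueC_instance.

Section lebesgueCn_instance.
Variable n : nat.
Let leb0 : @lebesgueCn n set0 = 0.
Proof. by have [m ->] := lebesgueCn_measure n. Qed.
Let leb_ge0 A : 0 <= @lebesgueCn n A.
Proof. by have [m ->] := lebesgueCn_measure n. Qed.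
Let leb_sigma_additive : semi_sigma_additive (@lebesgueCn n).
Proof.
by have [m ->] := lebesgueCn_measure n; exact: measure_semi_sigma_additive.
Qed.
HB.instance Definition _ := isMeasure.Build _ _ _ (@lebesgueCn n)
  leb0 leb_ge0 leb_sigma_additive.

Let leb_sigma_finite : sigma_finite setT (@lebesgueCn n).
Proof. by have [m ->] := lebesgueCn_measure n; exact: sigma_finiteT. Qed.
HB.instance Definition _ := Measure_isSigmaFinite.Build _ _ _ (@lebesgueCn n)
  leb_sigma_finite.
End lebesgueCn_instance.

End lebesgue.
Arguments lebesgueC {R}.
Arguments lebesgueCn {R n}.

Section ball.
Variables (R : realType) (n : nat).
Implicit Types z w : n.-tuple R[i].

Definition inner z w : R[i] := \sum_(i < n) tnth z i * (tnth w i)^*.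

Definition normsq z : R := \sum_(i < n) normc (tnth z i) ^+ 2.

Definition unit_ball : set (n.-tuple R[i]) := [set z | normsq z < 1].

Lemma measurable_normsq : measurable_fun setT normsq.
Proof.
apply: measurable_sum => i.
rewrite (_ : (fun x => _) = fun z : n.-tuple R[i] =>
  complex.Re (tnth z i) ^+ 2 + complex.Im (tnth z i) ^+ 2); last first.
  apply/funext => z; case: (tnth z i) => x y /=.
  by rewrite sqr_sqrtr// addr_ge0// sqr_ge0.
apply: measurable_funD; apply: measurable_funX.
- exact: (measurableT_comp (@measurable_Re R) (measurable_tnth i)).
- exact: (measurableT_comp (@measurable_Im R) (measurable_tnth i)).
Qed.

Lemma measurable_unit_ball : measurable unit_ball.
Proof.
rewrite (_ : unit_ball = normsq @^-1` `]-oo, 1[).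
  by rewrite -[X in measurable X]setTI; exact: measurable_normsq.
by apply/seteqP; split=> z; rewrite /unit_ball /= in_itv.
Qed.

Let inv_ball_ge0 : 0 <= (fine (lebesgueCn unit_ball))^-1.
Proof. by rewrite invr_ge0 fine_ge0. Qed.

(* Lebesgue measure restricted to the ball and divided by the volume of the
   ball; the ambient space outside the ball is a null set. *)
Definition vball : {measure set (n.-tuple R[i]) -> \bar R} :=
  mscale (NngNum inv_ball_ge0) (mrestr lebesgueCn measurable_unit_ball).

End ball.
Arguments unit_ball {R n}.
Arguments vball {R n}.

Definition Gamma (R : realType) (x : R) : R :=
  \int[lebesgue_measure]_(t in `]0, +oo[) (t `^ (x - 1) * expR (- t)).

Definition weight_cst (R : realType) (n : nat) (alpha : R) : R :=
  Gamma (n%:R + alpha + 1) / (n`!%:R * Gamma (alpha + 1)).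

Section weighted.
Variables (R : realType) (n : nat) (alpha : R).
Local Notation Cn := (n.-tuple R[i]).

Definition weight (z : Cn) : R :=
  weight_cst n alpha * (1 - normsq z) `^ alpha.

Definition vball_weighted : set Cn -> \bar R :=
  fun A => (\int[vball]_(z in A) (weight z)%:E)%E.

Let Gamma_ge0 (x : R) : 0 <= Gamma x.
Proof. by apply: Rintegral_ge0 => t _; rewrite mulr_ge0 ?powR_ge0 ?expR_ge0. Qed.

Let weight_ge0 z : 0 <= weight z.
Proof. by rewrite mulr_ge0 ?powR_ge0// divr_ge0 ?mulr_ge0 ?Gamma_ge0. Qed.

Lemma measurable_weight : measurable_fun setT weight.
Proof.
apply: measurable_funM => //.
apply: (measurableT_comp (measurable_powR _)).
by apply: measurable_funB => //; exact: measurable_normsq.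
Qed.

Let vw0 : vball_weighted set0 = 0%E.
Proof. exact: integral_set0. Qed.

Let vw_ge0 A : (0 <= vball_weighted A)%E.
Proof. by apply: integral_ge0 => z _; rewrite lee_fin weight_ge0. Qed.

Let vw_sigma_additive : semi_sigma_additive vball_weighted.
Proof.
move=> /= F mF tF mUF; rewrite /vball_weighted ge0_integral_bigcup//=.
- apply: is_cvg_ereal_nneg_natsum_cond => i _ _; exact: vw_ge0.
- by apply/measurable_EFinP/measurable_funTS; exact: measurable_weight.
- by move=> z _; rewrite lee_fin weight_ge0.
Qed.

HB.instance Definition _ := isMeasure.Build _ _ _ vball_weighted
  vw0 vw_ge0 vw_sigma_additive.

End weighted.

Section complex_functions.
Variable R : realType.

(* The principal argument, with values in ]-pi, pi]. *)
Definition carg (z : R[i]) : R :=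
  if 0 <= complex.Im z then acos (complex.Re z / normc z)
  else - acos (complex.Re z / normc z).

(* The principal branch of z ^ c for z != 0. *)
Definition cpow (z : R[i]) (c : R) : R[i] :=
  (normc z `^ c)%:C * (cos (c * carg z) +i* sin (c * carg z)).

Context d (T : measurableType d) (mu : {measure set T -> \bar R}).

Definition cintegrable (D : set T) (f : T -> R[i]) : Prop :=
  measurable_fun D f /\ (\int[mu]_(x in D) (normc (f x))%:E < +oo)%E.

Definition cintegral (D : set T) (f : T -> R[i]) : R[i] :=
  (\int[mu]_(x in D) complex.Re (f x)) +i* (\int[mu]_(x in D) complex.Im (f x)).

End complex_functions.

Section forelli_rudin.
Variables (R : realType) (n : nat).
Local Notation Cn := (n.-tuple R[i]).
Implicit Types (f : Cn -> R[i]) (K : Cn -> Cn -> R[i]) (a b c alpha : R).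

(* A function on the ball is represented by any extension to C^n: it is cut off
   to 0 outside the ball, where vball has no mass anyway.  For p = +oo the norm is taken with
   respect to the unweighted measure. *)
Definition Lpnorm (p : \bar R) alpha f : \bar R :=
  let g := (fun z => (normc (f z))%:E) \_ unit_ball in
  if p is +oo%E then 'N[vball]_+oo[g]%E else 'N[vball_weighted alpha]_p[g]%E.

Definition in_Lp (p : \bar R) alpha f : Prop :=
  measurable_fun unit_ball f /\ (Lpnorm p alpha f < +oo)%E.

Definition T_kernel b c (z w : Cn) : R[i] :=
  ((1 - normsq w) `^ b)%:C / cpow (1 - inner z w) c.

Definition S_kernel b c (z w : Cn) : R[i] :=
  ((1 - normsq w) `^ b / normc (1 - inner z w) `^ c)%:C.

(* The Forelli-Rudin operator T_{a,b,c}, resp. S_{a,b,c}, is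
   FR_op a (T_kernel b c), resp. FR_op a (S_kernel b c). *)
Definition FR_op a K f (z : Cn) : R[i] :=
  ((1 - normsq z) `^ a)%:C * cintegral vball unit_ball (fun w => K z w * f w).

(* The image being in L^q_beta includes its measurability, so that its norm is
   the norm of an element of the target space. *)
Definition FR_bounded a K (p : \bar R) alpha (q : \bar R) (beta : R) : Prop :=
  (forall f, in_Lp p alpha f -> forall z, unit_ball z ->
     cintegrable vball unit_ball (fun w => K z w * f w)) /\
  (exists C : R, forall f, in_Lp p alpha f ->
     in_Lp q beta (FR_op a K f) /\
     (Lpnorm q beta (FR_op a K f) <= C%:E * Lpnorm p alpha f)%E).

Definition T_bounded a b c := FR_bounded a (T_kernel b c).
Definition S_bounded a b c := FR_bounded a (S_kernel b c).

End forelli_rudin.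

(* The case p = -oo is excluded by 1 <= q < p. *)
Definition FR_condition (R : realType) (n : nat) (a b c alpha beta : R)
    (p : \bar R) (q : R) : Prop :=
  match p with
  | (r%:E)%E => [/\ - q * a < beta + 1, alpha + 1 < r * (b + 1) &
      c < n%:R + 1 + a + b + (1 + beta) / q - (1 + alpha) / r]
  | +oo%E => [/\ - q * a < beta + 1, -1 < b &
      c < n%:R + 1 + a + b + (beta + 1) / q]
  | -oo%E => False
  end.

(* Main.v *)
Require Import Defs.
From HB Require Import structures.
From mathcomp Require Import all_boot all_order all_algebra.
From mathcomp Require Import complex ring lra.
From mathcomp Require Import all_classical all_reals all_analysis.
From mathcomp Require Import measurable_realfun ess_sup_inf.
Set Implicit Arguments.
Unset Strict Implicit.
Unset Printing Implicit Defensive.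
Import Order.TTheory GRing.Theory Num.Theory.
Import numFieldNormedType.Exports.
Import Normc.

Local Open Scope classical_set_scope.
Local Open Scope ring_scope.
Local Open Scope complex_scope.

(* Both kernels have modulus rho(w)^b |1 - <z,w>|^(-c), where rho(w) = 1 - |w|^2, and
   only this modulus and a lower bound of the real part near the diagonal matter.

   Sufficiency.  The part of the Koranyi ball {|1 - <z,w>| < t} where rho < s has volume
   O(s t^n); summing over dyadic values of s and t gives the Forelli-Rudin estimate
   int rho(w)^b |1 - <z,w>|^(-c) dv(w) <= M rho(z)^(n+1+b-c).  Condition (iii) leaves room
   for a weight gamma such that, after increasing c, the Schur test with a power of rho
   maps L^p_alpha to L^p_gamma, and L^p_gamma embeds in L^q_beta by Hoelder's inequality.
   For p = +oo one first passes to a large finite p.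

   Necessity.  In the shell of depth 4^(-k) there are about 4^(kn) disjoint boxes P_x of
   volume of order depth^(n+1), and 1 - <z,w> is within a small multiple of the depth
   of P_x for z and w in P_x.  The functions sum_x (+-) depth(P_x)^(-(1+alpha)/p) 1_(P_x)
   over N shells have norm O(N^(1/p)).  If one of the three inequalities fails, the q-th
   power of the norm of the image of one of them (of a bounded function in the case of the
   first inequality) grows at least like N, which contradicts q < p.  For the third
   inequality one averages over the signs, so that only the diagonal terms count and no
   positivity of the real part of the kernel is needed away from the diagonal. *)

(** For |c| > 1 the real part of (1 - <z,w>)^(-c) changes sign on the ball, so [T] has no lower
    bound by [S] on general positive functions. This is why the test functions live on sets where 1
    - <z,w> is close to a positive number d, within a tolerance [eta] that depends on c. Two values
    of d occur: d = 1 when one of the points is near the origin, and d the depth of a box when both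
    points lie in it.

    Geometric shells take the place of logarithmic integrals. The boxes of one shell have total
    volume comparable to its depth, so the chosen normalization gives each shell the same mass; when
    an inequality of (iii) fails, even with equality, each shell still adds a fixed amount to the
    image. Equality and strict failure are thus handled together.

    For sufficiency, 1 <= q < p gives p > 1, so the Schur test has a finite conjugate exponent. The
    test is run at the scale-invariant value of c for L^p_alpha to L^p_gamma; passing from c to this
    larger value is harmless because |1 - <z,w>| <= 2. The strictness of the third inequality is
    what leaves an interval of admissible gamma. *)

Section density.
Local Open Scope ereal_scope.
Context d (T : measurableType d) (R : realType).
Variables (m nu : {measure set T -> \bar R}) (w : T -> R).
Hypotheses (mw : measurable_fun setT w) (w0 : forall x, (0 <= w x)%R).
Hypothesis nuE : forall A, measurable A -> nu A = \int[m]_(x in A) (w x)%:E.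

Import HBNNSimple.

Let integral_density_nnsfun (h : {nnsfun T >-> R}) :
  \int[nu]_x (h x)%:E = \int[m]_x ((h x)%:E * (w x)%:E).
Proof.
have mwE : measurable_fun setT (EFin \o w) by exact/measurable_EFinP.
under eq_integral do rewrite fimfunE -fsumEFin//.
rewrite ge0_integral_fsum//; last 2 first.
  - by move=> r; exact/measurable_EFinP/measurableT_comp.
  - by move=> r x _; rewrite nnfun_muleindic_ge0.
under [RHS]eq_integral.
  move=> x xD; rewrite fimfunE -fsumEFin// muleC ge0_mule_fsumr; last first.
    by move=> r; rewrite nnfun_muleindic_ge0.
  over.
rewrite [RHS]ge0_integral_fsum//; last 2 first.
  - move=> r; apply: emeasurable_funM => //.
    by apply/measurable_EFinP; apply/measurableT_comp => //.
  - by move=> r x _; rewrite mule_ge0//; [rewrite lee_fin|rewrite nnfun_muleindic_ge0].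
apply: eq_fsbigr => r _.
rewrite integralZl_indic_nnsfun// integral_indic// setIT nuE//.
have [r0|r0] := ltP r 0%R.
  rewrite preimage_nnfun0// integral_set0 mule0 integral0_eq// => x _.
  by rewrite indic0 mulr0 mule0.
rewrite integral_mkcond -ge0_integralZl//; last 2 first.
  - by apply/(measurable_restrictT _ _).1 => //; exact: measurable_funTS.
  - by move=> x _; rewrite /patch; case: ifP => // _; rewrite lee_fin.
apply: eq_integral => x _; rewrite patchE indicE.
by case: ifP => _; rewrite ?(mulr1, mulr0, mule0) // muleC.
Qed.

(** Turns integrals against [vball_weighted] into integrals against [vball], so that a single
    measure carries all later estimates. Simple functions come first, then monotone convergence. *)
Lemma integral_density (g : T -> \bar R) : measurable_fun setT g ->
  (forall x, 0 <= g x) -> \int[nu]_x g x = \int[m]_x (g x * (w x)%:E).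
Proof.
move=> mg g0; pose g_ := nnsfun_approx measurableT mg.
have mwE : measurable_fun setT (EFin \o w) by exact/measurable_EFinP.
transitivity (limn (fun n => \int[nu]_x (g_ n x)%:E)).
  rewrite -monotone_convergence//=.
  - by apply: eq_integral => x _; apply/esym/cvg_lim => //=; exact: cvg_nnsfun_approx.
  - by move=> n; exact/measurable_EFinP/measurable_funTS.
  - by move=> n x _; rewrite lee_fin.
  - by move=> x _ a b ab; rewrite lee_fin//; exact/lefP/nd_nnsfun_approx.
rewrite [RHS](_ : _ = limn (fun n => \int[m]_x ((g_ n x)%:E * (w x)%:E))).
  by congr (limn _); apply/funext => n /=; rewrite integral_density_nnsfun.
rewrite -monotone_convergence//=.
- apply: eq_integral => x _; apply/esym/cvg_lim => //=.
  under eq_fun do rewrite muleC; rewrite muleC.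
  by apply: cvgeZl => //; exact: cvg_nnsfun_approx.
- by move=> n; apply: emeasurable_funM => //; exact/measurable_EFinP/measurable_funTS.
- by move=> n x _; rewrite mule_ge0 ?lee_fin.
- move=> x _ a b ab; apply: lee_wpmul2r; rewrite ?lee_fin//.
  exact/lefP/nd_nnsfun_approx.
Qed.

End density.

(** * Areas and slices *)

Lemma measurable_le_set d (T : measurableType d) (R : realType) (f g : T -> R) :
  measurable_fun setT f -> measurable_fun setT g ->
  measurable [set x | f x <= g x].
Proof.
move=> mf mg; rewrite (_ : mkset _ = setT `&` (fun x => f x <= g x) @^-1` [set true]).
  exact: (measurable_fun_ler mf mg).
by rewrite setTI; apply/seteqP; split => x.
Qed.

Lemma measurable_lt_set d (T : measurableType d) (R : realType) (f g : T -> R) :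
  measurable_fun setT f -> measurable_fun setT g ->
  measurable [set x | f x < g x].
Proof.
move=> mf mg; rewrite (_ : mkset _ = setT `&` (fun x => f x < g x) @^-1` [set true]).
  exact: (measurable_fun_ltr mf mg).
by rewrite setTI; apply/seteqP; split => x.
Qed.

Section product_slices.
Local Open Scope ereal_scope.
Context d1 d2 (T1 : measurableType d1) (T2 : measurableType d2) (R : realType).
Variables (m1 : {sigma_finite_measure set T1 -> \bar R})
          (m2 : {sigma_finite_measure set T2 -> \bar R}).

(** [\x] integrates the sections over the first factor; slicing along the second factor needs the
    other order of integration. *)
Lemma product_measure12 A : measurable A -> (m1 \x m2) A = (m1 \x^ m2) A.
Proof.
move=> mA; apply: (product_measure_unique (m' := m1 \x^ m2)) => // X Y mX mY.
exact: product_measure2E.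
Qed.

Lemma product_measure_le_xsection A (X : set T1) (M : R) : (0 <= M)%R ->
  measurable A -> measurable X -> (forall x y, A (x, y) -> X x) ->
  (forall x, X x -> m2 [set y | A (x, y)] <= M%:E) ->
  (m1 \x m2) A <= M%:E * m1 X.
Proof.
move=> M0 mA mX AX Am.
have xE x : xsection A x = [set y | A (x, y)].
  by apply/seteqP; split => y; rewrite /xsection/= inE.
have /integral_cst <- : measurable X by [].
rewrite /product_measure1 [leRHS]integral_mkcond; apply: ge0_le_integral => //.
- exact: measurable_fun_xsection.
- apply/(measurable_restrictT _ _).1 => //; exact: measurable_cst.
move=> x _ /=; rewrite patchE xE; case: ifPn => [|]; first by rewrite inE => /Am.
rewrite notin_setE => nXx.
rewrite (_ : [set y | _] = set0) ?measure0//.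
by apply/seteqP; split => y //= /AX.
Qed.

Lemma product_measure_le_ysection A (Y : set T2) (M : R) : (0 <= M)%R ->
  measurable A -> measurable Y -> (forall x y, A (x, y) -> Y y) ->
  (forall y, Y y -> m1 [set x | A (x, y)] <= M%:E) ->
  (m1 \x m2) A <= M%:E * m2 Y.
Proof.
move=> M0 mA mY AY Am; rewrite product_measure12//.
have yE y : ysection A y = [set x | A (x, y)].
  by apply/seteqP; split => x; rewrite /ysection/= inE.
have /integral_cst <- : measurable Y by [].
rewrite /product_measure2 [leRHS]integral_mkcond; apply: ge0_le_integral => //.
- by apply: measurable_fun_ysection; rewrite // inE.
- apply/(measurable_restrictT _ _).1 => //; exact: measurable_cst.
move=> y _ /=; rewrite patchE yE; case: ifPn => [|]; first by rewrite inE => /Am.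
rewrite notin_setE => nYy.
rewrite (_ : [set x | _] = set0) ?measure0//.
by apply/seteqP; split => x //= /AY.
Qed.

Lemma product_measure_eq_ysection A (Y : set T2) (M : R) :
  measurable A -> measurable Y -> (forall x y, A (x, y) -> Y y) ->
  (forall y, Y y -> m1 [set x | A (x, y)] = M%:E) ->
  (m1 \x m2) A = M%:E * m2 Y.
Proof.
move=> mA mY AY Am; rewrite product_measure12//.
have yE y : ysection A y = [set x | A (x, y)].
  by apply/seteqP; split => x; rewrite /ysection/= inE.
have /integral_cst <- : measurable Y by [].
rewrite /product_measure2 [RHS]integral_mkcond; apply: eq_integral => y _ /=.
rewrite patchE yE; case: ifPn => [|]; first by rewrite inE => /Am.
rewrite notin_setE => nYy.
rewrite (_ : [set x | _] = set0) ?measure0//.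
by apply/seteqP; split => x //= /AY.
Qed.

End product_slices.

Section plane.
Variable R : realType.
Local Notation leb := (@lebesgue_measure R).

(** The factor 2 comes from centering an interval of radius d at an arbitrary point of B, which
    avoids infima and suprema. *)
Lemma lebesgue_diam_le (B : set R) (d : R) : 0 <= d -> measurable B ->
  (forall x y, B x -> B y -> x - y <= d) -> (leb B <= (2 * d)%:E)%E.
Proof.
move=> d0 mB Bd; have [->|/set0P[x Bx]] := eqVneq B set0.
  by rewrite measure0 lee_fin mulr_ge0.
apply: (@le_trans _ _ (leb `[x - d, x + d])).
  apply: le_measure; rewrite ?inE// => y By /=; rewrite in_itv/=.
  by have := Bd _ _ Bx By; have := Bd _ _ By Bx; lra.
rewrite lebesgue_measure_itv/= lte_fin; case: ifP => _; rewrite -?EFinD lee_fin; lra.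
Qed.

Definition square (c : R[i]) (r : R) : set R[i] :=
  [set z | `|complex.Re z - complex.Re c| <= r /\
           `|complex.Im z - complex.Im c| <= r].

Lemma measurable_square c r : measurable (square c r).
Proof.
apply: measurableI; apply: measurable_le_set => //;
  apply: measurableT_comp => //; apply: measurable_funB => //.
- exact: measurable_Re.
- exact: measurable_Im.
Qed.

Lemma lebesgueCE (A : set R[i]) :
  lebesgueC A = (leb \x leb)%E [set p | A (pair_complex p)].
Proof. by []. Qed.

Lemma measurable_pair_preimage (A : set R[i]) : measurable A ->
  measurable ([set p | A (pair_complex p)] : set (measurableTypeR R * measurableTypeR R)).
Proof.
by move=> mA; rewrite -[X in measurable X]setTI; exact: measurable_pair_complex.
Qed.

Lemma itv_norm_le (c r : R) : [set x | `|x - c| <= r] = `[c - r, c + r]%classic.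
Proof.
by apply/seteqP; split => x /=; rewrite in_itv/= ler_distl.
Qed.

Lemma lebesgue_itv_norm (c r : R) : 0 <= r ->
  leb [set x | `|x - c| <= r] = (2 * r)%:E.
Proof.
move=> r0; rewrite itv_norm_le lebesgue_measure_itv/= lte_fin.
case: ltP => H; rewrite -?EFinD; congr EFin; lra.
Qed.

Lemma lebesgueC_square c r : 0 <= r ->
  lebesgueC (square c r) = ((2 * r) ^+ 2)%:E.
Proof.
move=> r0; rewrite lebesgueCE.
transitivity (leb [set x | `|x - complex.Re c| <= r]%R
  * leb [set x | `|x - complex.Im c| <= r]%R)%E.
  by apply: product_measure1E; rewrite itv_norm_le.
by rewrite !lebesgue_itv_norm// -EFinM expr2.
Qed.

(** On the half line of sign e, which is [P e], two points satisfy (u - v)(u + v) <= s with u + v of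
    modulus at least 2 c0. Each half of the slice therefore has diameter at most s / (2 c0). *)
Lemma annulus_slice (c0 L s y : R) : 0 < c0 -> 0 <= s ->
  (leb [set x | c0 <= `|x| /\ L < x ^+ 2 + y /\ (x ^+ 2 + y <= L + s)]%R
     <= (2 * s / c0)%:E)%E.
Proof.
move=> c0p s0.
pose P e := [set x : R | c0 <= e * x /\ L < x ^+ 2 + y /\ (x ^+ 2 + y <= L + s)%R].
have mP e : measurable (P e).
  apply: measurableI; last apply: measurableI.
  - apply: (measurable_le_set (f := cst c0)) => //; exact: measurable_funM.
  - by apply: (measurable_lt_set (f := cst L)) => //; apply: measurable_funD => //; apply: exprn_measurable.
  - by apply: (measurable_le_set (g := cst (L + s))) => //; apply: measurable_funD => //; apply: exprn_measurable.
have dP e : e = 1 \/ e = -1 -> (leb (P e) <= (s / c0)%:E)%E.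
  move=> e1; rewrite (_ : s / c0 = 2 * (s / (2 * c0))); last by field; rewrite gt_eqF.
  apply: lebesgue_diam_le => //; first by rewrite divr_ge0// mulr_ge0// ltW.
  move=> u v [u1 [u2 u3]] [v1 [v2 v3]].
  rewrite ler_pdivlMr ?mulr_gt0//.
  have [uv|uv] := leP (u - v) 0.
    by apply: le_trans s0; apply: mulr_le0_ge0; lra.
  have h : (u - v) * (u + v) <= s by lra.
  have h' : (u - v) * (e * u + e * v) <= s.
    by case: e1 => e1; rewrite e1; lra.
  by apply: le_trans h'; apply: ler_wpM2l; lra.
apply: (@le_trans _ _ (leb (P 1 `|` P (-1)))).
  apply: le_measure; rewrite ?inE.
  - apply: measurableI; last apply: measurableI.
    + apply: (measurable_le_set (f := cst c0)) => //; exact: measurableT_comp.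
    + by apply: (measurable_lt_set (f := cst L)) => //; apply: measurable_funD => //; apply: exprn_measurable.
    + by apply: (measurable_le_set (g := cst (L + s))) => //; apply: measurable_funD => //; apply: exprn_measurable.
  - by apply: measurableU; exact: mP.
  move=> x [x1 x2]; have [x0|x0] := leP 0 x.
    by left; split => //; rewrite mul1r -(ger0_norm x0).
  by right; split => //; rewrite mulN1r -(ltr0_norm x0).
apply: (@le_trans _ _ (leb (P 1%R) + leb (P (-1)%R))%E).
  by apply: measureU2; exact: mP.
apply: (le_trans (leeD (dP _ (or_introl erefl)) (dP _ (or_intror erefl)))).
by rewrite -EFinD lee_fin; lra.
Qed.

Lemma sqr_normc (z : R[i]) : normc z ^+ 2 = complex.Re z ^+ 2 + complex.Im z ^+ 2.
Proof. by case: z => x y /=; rewrite sqr_sqrtr// addr_ge0// sqr_ge0. Qed.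

Lemma measurable_sqr_normc : measurable_fun setT (fun z : R[i] => normc z ^+ 2).
Proof.
under eq_fun do rewrite sqr_normc.
apply: measurable_funD; apply: measurable_funX; [exact: measurable_Re|exact: measurable_Im].
Qed.

Lemma measurable_normc : measurable_fun setT (@normc R : R[i] -> R).
Proof.
rewrite (_ : @normc R = fun z => Num.sqrt (normc z ^+ 2)).
  apply: measurableT_comp; last exact: measurable_sqr_normc.
  exact: (continuous_measurable_fun (@sqrt_continuous R)).
apply/funext => z; rewrite sqrtr_sqr ger0_norm//.
by case: z => x y /=; rewrite sqrtr_ge0.
Qed.

(** If |z| >= 2 c0 then the real or the imaginary part has modulus at least c0. The annulus is
    sliced along that coordinate while the other one ranges over a side of the square. *)
Lemma annulus_area (c : R[i]) (r c0 L s : R) : 0 <= r -> 0 < c0 -> 0 <= s ->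
  (lebesgueC [set z | square c r z /\ 2 * c0 <= normc z /\
      L < normc z ^+ 2 /\ (normc z ^+ 2 <= L + s)]%R
     <= (8 * r * s / c0)%:E)%E.
Proof.
move=> r0 c0p s0.
have mnc := measurable_sqr_normc.
pose P (g : R[i] -> R) := [set z | square c r z /\ c0 <= `|g z| /\
      L < normc z ^+ 2 /\ (normc z ^+ 2 <= L + s)%R].
have mP g : measurable_fun setT g -> measurable (P g).
  move=> mg; apply: measurableI; first exact: measurable_square.
  apply: measurableI.
    by apply: (measurable_le_set (f := cst c0)) => //; exact: measurableT_comp.
  apply: measurableI.
    exact: (measurable_lt_set (f := cst L)).
  exact: (measurable_le_set (g := cst (L + s))).
have mRe := @measurable_Re R; have mIm := @measurable_Im R.
have PR : (lebesgueC (P (@complex.Re R)) <= (4 * r * s / c0)%:E)%E.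
  rewrite lebesgueCE.
  have -> : (4 * r * s / c0)%:E = ((2 * s / c0)%:E * leb [set y | `|y - complex.Im c| <= r]%R)%E.
    by rewrite lebesgue_itv_norm// -EFinM; congr EFin; field; rewrite gt_eqF.
  apply: product_measure_le_ysection.
  - by rewrite divr_ge0 ?mulr_ge0// ltW.
  - by apply: measurable_pair_preimage; exact: mP.
  - by rewrite itv_norm_le.
  - by move=> x y [[? ?] ?].
  move=> y _; apply: le_trans (annulus_slice L (y ^+ 2) c0p s0).
  apply: le_measure; rewrite ?inE.
  - rewrite (_ : [set x | _] = xsection [set p : measurableTypeR R * measurableTypeR R | P (@complex.Re R) (pair_complex (p.2, p.1))] y); last first.
      by apply/seteqP; split => x; rewrite /xsection/= inE.
    apply: measurable_xsection.
    rewrite -[X in measurable X]setTI; apply: (measurableT_comp (@measurable_pair_complex R) (measurable_fun_pair measurable_snd measurable_fst)) => //.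
    exact: mP.
  - apply: measurableI; last apply: measurableI.
    + apply: (measurable_le_set (f := cst c0)) => //; exact: measurableT_comp.
    + by apply: (measurable_lt_set (f := cst L)) => //; apply: measurable_funD => //; apply: exprn_measurable.
    + by apply: (measurable_le_set (g := cst (L + s))) => //; apply: measurable_funD => //; apply: exprn_measurable.
  by move=> x [_]; rewrite sqr_normc.
have PI : (lebesgueC (P (@complex.Im R)) <= (4 * r * s / c0)%:E)%E.
  rewrite lebesgueCE.
  have -> : (4 * r * s / c0)%:E = ((2 * s / c0)%:E * leb [set y | `|y - complex.Re c| <= r]%R)%E.
    by rewrite lebesgue_itv_norm// -EFinM; congr EFin; field; rewrite gt_eqF.
  apply: product_measure_le_xsection.
  - by rewrite divr_ge0 ?mulr_ge0// ltW.
  - by apply: measurable_pair_preimage; exact: mP.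
  - by rewrite itv_norm_le.
  - by move=> x y [[? ?] ?].
  move=> y _; apply: le_trans (annulus_slice L (y ^+ 2) c0p s0).
  apply: le_measure; rewrite ?inE.
  - rewrite (_ : [set x | _] = xsection [set p : measurableTypeR R * measurableTypeR R | P (@complex.Im R) (pair_complex p)] y); last first.
      by apply/seteqP; split => x; rewrite /xsection/= inE.
    apply: measurable_xsection.
    by apply: measurable_pair_preimage; exact: mP.
  - apply: measurableI; last apply: measurableI.
    + apply: (measurable_le_set (f := cst c0)) => //; exact: measurableT_comp.
    + by apply: (measurable_lt_set (f := cst L)) => //; apply: measurable_funD => //; apply: exprn_measurable.
    + by apply: (measurable_le_set (g := cst (L + s))) => //; apply: measurable_funD => //; apply: exprn_measurable.
  by move=> x [_]; rewrite sqr_normc /= addrC.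
apply: (@le_trans _ _ (lebesgueC (P (@complex.Re R) `|` P (@complex.Im R)))).
  apply: le_measure; rewrite ?inE.
  - apply: measurableI; first exact: measurable_square.
    apply: measurableI.
      by apply: (measurable_le_set (f := cst (2 * c0))) => //; exact: measurable_normc.
    apply: measurableI.
      exact: (measurable_lt_set (f := cst L)).
    exact: (measurable_le_set (g := cst (L + s))).
  - by apply: measurableU; exact: mP.
  move=> z [z1 [z2 z3]].
  have [h|h] := leP c0 `|complex.Re z|; first by left.
  have [h'|h'] := leP c0 `|complex.Im z|; first by right.
  exfalso; have := sqr_normc z.
  rewrite -[complex.Re z ^+ 2]real_normK ?num_real// -[complex.Im z ^+ 2]real_normK ?num_real//.
  have := normr_ge0 (complex.Re z); have := normr_ge0 (complex.Im z); nra.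
apply: (@le_trans _ _ (lebesgueC (P (@complex.Re R)) + lebesgueC (P (@complex.Im R)))%E).
  by apply: measureU2; exact: mP.
apply: (le_trans (leeD PR PI)).
rewrite -EFinD lee_fin le_eqVlt; apply/orP; left; apply/eqP; field.
by rewrite gt_eqF.
Qed.

End plane.

Section slices.
Variable R : realType.
Local Notation C := R[i].

Definition tuple_update n (w : n.-tuple C) (j : 'I_n) (x : C) : n.-tuple C :=
  [tuple (if i == j then x else tnth w i) | i < n].

Definition polysquare n (c : 'I_n -> C) (r : R) : set (n.-tuple C) :=
  [set t | forall i, square (c i) r (tnth t i)].

Lemma measurable_polysquare n (c : 'I_n -> C) r : measurable (polysquare c r).
Proof.
rewrite (_ : polysquare c r = \bigcap_(i in [set: 'I_n])
   ((fun t => tnth t i) @^-1` square (c i) r)).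
  apply: fin_bigcap_measurable => // i _; rewrite -[X in measurable X]setTI.
  by apply: measurable_tnth => //; exact: measurable_square.
by apply/seteqP; split => t Pt i; [move=> _; exact: Pt|exact: (Pt i I)].
Qed.

Lemma measurable_cons_set m (A : set (m.+1.-tuple C)) : measurable A ->
  measurable [set p : C * m.-tuple C | A [tuple of p.1 :: p.2]].
Proof.
move=> mA; rewrite -[X in measurable X]setTI.
exact: (measurable_cons measurable_fst measurable_snd).
Qed.

Lemma measurable_cons_slice m (A : set (m.+1.-tuple C)) z : measurable A ->
  measurable [set t : m.-tuple C | A [tuple of z :: t]].
Proof.
move=> mA; rewrite -[X in measurable X]setTI.
exact: (measurable_cons (measurable_cst _) (@measurable_id _ _ _)).
Qed.

Lemma lebesgueCn_cons m (A : set (m.+1.-tuple C)) :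
  lebesgueCn A = (lebesgueC \x lebesgueCn)%E
    [set p : C * m.-tuple C | A [tuple of p.1 :: p.2]].
Proof.
rewrite /product_measure1 /=; apply: eq_integral => z _ /=.
by congr (lebesgueCn _); apply/seteqP; split => t; rewrite /xsection /= inE.
Qed.

Lemma lebesgueCn_polysquare n (c : 'I_n -> C) r : 0 <= r ->
  lebesgueCn (polysquare c r) = (((2 * r) ^+ 2) ^+ n)%:E.
Proof.
move=> r0; elim: n c => [|n IH] c.
  rewrite /= (_ : polysquare c r = setT); last by apply/seteqP; split => // t _ [].
  by rewrite diracE in_setT.
rewrite lebesgueCn_cons.
transitivity (lebesgueC (square (c ord0) r) * lebesgueCn (polysquare (fun i => c (lift ord0 i)) r))%E.
  rewrite -product_measure1E; last 2 first.
    - exact: measurable_square.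
    - exact: measurable_polysquare.
  congr ((_ \x _)%E _); apply/seteqP; split => [[z t]|[z t]] /=.
    move=> H; split; first by have := H ord0; rewrite (tnth_nth 0).
    by move=> i; have := H (lift ord0 i); rewrite tnthS.
  move=> [H0 H1] i; case: (unliftP ord0 i) => [j|] ->; first by rewrite tnthS.
  by rewrite (tnth_nth 0).
by rewrite IH lebesgueC_square// -EFinM [in RHS]exprS.
Qed.

(** Fubini in the coordinate j. The recursive definition of [lebesgueCn] exposes only the first
    coordinate, hence the induction on n; when j is itself the first coordinate, the product is cut
    along the remaining ones. *)
Lemma lebesgueCn_slice_le n (j : 'I_n) (E : set (n.-tuple C)) (c : 'I_n -> C)
    (r M : R) : 0 <= r -> 0 <= M -> measurable E ->
  (forall w i, E w -> i != j -> square (c i) r (tnth w i)) ->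
  (forall w, (lebesgueC [set x | E (tuple_update w j x)] <= M%:E)%E) ->
  (lebesgueCn E <= (M * ((2 * r) ^+ 2) ^+ n.-1)%:E)%E.
Proof.
move=> r0 M0; elim: n j E c => [[]//|n IH] j E c mE Ec Em.
rewrite lebesgueCn_cons EFinM.
case: (unliftP ord0 j) Ec Em => [j'|] -> {j} Ec Em /=.
  apply: (@le_trans _ _ ((M * ((2 * r) ^+ 2) ^+ n.-1)%:E * lebesgueC (square (c ord0) r))%E); last first.
    rewrite lebesgueC_square// -!EFinM lee_fin -mulrA ler_wpM2l//.
    by case: n j' {IH c mE Ec Em E} => [[]//|n] _ /=; rewrite -exprSr.
  apply: product_measure_le_xsection.
  - by rewrite mulr_ge0// exprn_ge0// exprn_ge0// mulr_ge0.
  - exact: measurable_cons_set.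
  - exact: measurable_square.
  - by move=> x y /= /Ec /(_ (neq_lift ord0 j')); rewrite (tnth_nth 0).
  move=> z _ /=; apply: (IH j' _ (fun i => c (lift ord0 i))).
  - exact: measurable_cons_slice.
  - move=> w i Ew ij; have := Ec _ (lift ord0 i) Ew.
    by rewrite tnthS; apply; rewrite (inj_eq lift_inj).
  move=> w; apply: le_trans (Em [tuple of z :: w]).
  rewrite le_eqVlt; apply/orP; left; apply/eqP; congr (lebesgueC _).
  apply/funext => x /=; congr (E _); apply: eq_from_tnth => i.
  rewrite /tuple_update tnth_mktuple.
  case: (unliftP ord0 i) => [k|] ->.
    by rewrite !tnthS tnth_mktuple (inj_eq lift_inj).
  by rewrite (negPf (neq_lift _ _)) !(tnth_nth 0).
apply: (@le_trans _ _ (M%:E * lebesgueCn (polysquare (fun i => c (lift ord0 i)) r))%E).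
  apply: product_measure_le_ysection => //.
  - exact: measurable_cons_set.
  - exact: measurable_polysquare.
  - move=> x y Exy i; have := Ec _ (lift ord0 i) Exy.
    by rewrite /= tnthS; exact.
  (* The entry 0 is a dummy: [tuple_update] overwrites it. *)
  move=> t _; apply: le_trans (Em [tuple of 0 :: t]).
  rewrite le_eqVlt; apply/orP; left; apply/eqP; congr (lebesgueC _).
  apply/funext => x /=; congr (E _); apply: eq_from_tnth => i.
  rewrite /tuple_update tnth_mktuple.
  case: (unliftP ord0 i) => [k|] ->.
    by rewrite !tnthS /=.
  by rewrite eqxx !(tnth_nth 0).
by rewrite lebesgueCn_polysquare.
Qed.

End slices.

(** * Measurability of complex-valued functions *)

Section complex_measurability.
Context d (T : measurableType d) (R : realType).
Implicit Types (D : set T) (f g : T -> R[i]).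

Lemma measurable_complexP D f : measurable D ->
  measurable_fun D (fun x => complex.Re (f x)) ->
  measurable_fun D (fun x => complex.Im (f x)) -> measurable_fun D f.
Proof.
move=> mD /(measurable_restrictT _ mD) mr /(measurable_restrictT _ mD) mi.
have mp : measurable_fun setT (@pair_complex R \o (fun x =>
    ((fun y => complex.Re (f y)) \_ D x, (fun y => complex.Im (f y)) \_ D x))).
  apply: measurableT_comp; first exact: measurable_pair_complex.
  exact: measurable_fun_pair.
apply: eq_measurable_fun (measurable_funTS mp) => x xD /=.
by rewrite !patchE xD /=; case: (f x).
Qed.

Lemma measurable_fun_Re D f : measurable_fun D f ->
  measurable_fun D (fun x => complex.Re (f x)).
Proof. by move=> mf; apply: measurableT_comp mf; exact: measurable_Re. Qed.

Lemma measurable_fun_Im D f : measurable_fun D f ->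
  measurable_fun D (fun x => complex.Im (f x)).
Proof. by move=> mf; apply: measurableT_comp mf; exact: measurable_Im. Qed.

Lemma measurable_fun_normc D f : measurable_fun D f ->
  measurable_fun D (fun x => normc (f x)).
Proof. by move=> mf; apply: measurableT_comp mf; exact: measurable_normc. Qed.

Lemma measurable_cmul D f g : measurable D -> measurable_fun D f -> measurable_fun D g ->
  measurable_fun D (fun x => f x * g x).
Proof.
move=> mD mf mg; apply: measurable_complexP => //.
- rewrite (_ : (fun x => _) = fun x => complex.Re (f x) * complex.Re (g x) - complex.Im (f x) * complex.Im (g x)).
    by apply: measurable_funB; apply: measurable_funM; (exact: measurable_fun_Re || exact: measurable_fun_Im).
  by apply/funext => x; case: (f x) => ? ?; case: (g x).
- rewrite (_ : (fun x => _) = fun x => complex.Re (f x) * complex.Im (g x) + complex.Im (f x) * complex.Re (g x)).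
    by apply: measurable_funD; apply: measurable_funM; (exact: measurable_fun_Re || exact: measurable_fun_Im).
  by apply/funext => x; case: (f x) => ? ?; case: (g x).
Qed.

Lemma measurable_csub D f g : measurable D -> measurable_fun D f -> measurable_fun D g ->
  measurable_fun D (fun x => f x - g x).
Proof.
move=> mD mf mg; apply: measurable_complexP => //.
- rewrite (_ : (fun x => _) = fun x => complex.Re (f x) - complex.Re (g x)).
    by apply: measurable_funB; exact: measurable_fun_Re.
  by apply/funext => x; case: (f x) => ? ?; case: (g x).
- rewrite (_ : (fun x => _) = fun x => complex.Im (f x) - complex.Im (g x)).
    by apply: measurable_funB; exact: measurable_fun_Im.
  by apply/funext => x; case: (f x) => ? ?; case: (g x).
Qed.

Lemma measurable_cconj D f : measurable D -> measurable_fun D f ->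
  measurable_fun D (fun x => (f x)^*).
Proof.
move=> mD mf; apply: measurable_complexP => //.
- rewrite (_ : (fun x => _) = fun x => complex.Re (f x)); first exact: measurable_fun_Re.
  by apply/funext => x; case: (f x) => ? ?.
- rewrite (_ : (fun x => _) = fun x => - complex.Im (f x)).
    by apply: measurable_funN; exact: measurable_fun_Im.
  by apply/funext => x; case: (f x) => ? ?.
Qed.

Lemma measurable_csum D (I : Type) (s : seq I) (h : I -> T -> R[i]) : measurable D ->
  (forall i, measurable_fun D (h i)) ->
  measurable_fun D (fun x => \sum_(i <- s) h i x).
Proof.
move=> mD mh; elim: s => [|i s IH].
  by under eq_fun do rewrite big_nil; exact: measurable_cst.
under eq_fun do rewrite big_cons.
apply: measurable_complexP => //.
- rewrite (_ : (fun x => _) = fun x => complex.Re (h i x) + complex.Re (\sum_(i <- s) h i x)).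
    by apply: measurable_funD; exact: measurable_fun_Re.
  by apply/funext => x; case: (h i x) => ? ?; case: (\sum_(i <- s) _).
- rewrite (_ : (fun x => _) = fun x => complex.Im (h i x) + complex.Im (\sum_(i <- s) h i x)).
    by apply: measurable_funD; exact: measurable_fun_Im.
  by apply/funext => x; case: (h i x) => ? ?; case: (\sum_(i <- s) _).
Qed.

Lemma measurable_inner n D (f g : T -> n.-tuple R[i]) : measurable D ->
  measurable_fun D f -> measurable_fun D g ->
  measurable_fun D (fun x => inner (f x) (g x)).
Proof.
move=> mD mf mg; apply: measurable_csum => // i; apply: measurable_cmul => //.
  by apply: (measurableT_comp (measurable_tnth i)).
apply: measurable_cconj => //.
by apply: (measurableT_comp (measurable_tnth i)).
Qed.

End complex_measurability.

(** * The Hermitian form on the unit ball *)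

Section inner_product.
Variables (R : realType) (n : nat).
Local Notation C := R[i].
Implicit Types (x y : C) (z w : n.-tuple C).

Lemma normc_ge0 x : 0 <= normc x.
Proof. by case: x => a b /=; rewrite sqrtr_ge0. Qed.

Lemma normcB x y : normc (x - y) = normc (y - x).
Proof. by rewrite -[LHS]normcN opprB. Qed.

Lemma Re_le_normc x : complex.Re x <= normc x.
Proof.
case: x => a b /=; apply: le_trans (ler_norm _) _.
by rewrite -sqrtr_sqr ler_wsqrtr// lerDl sqr_ge0.
Qed.

Lemma normr_Re_le_normc x : `|complex.Re x| <= normc x.
Proof.
case: x => a b /=.
by rewrite -sqrtr_sqr ler_wsqrtr// lerDl sqr_ge0.
Qed.

Lemma normr_Im_le_normc x : `|complex.Im x| <= normc x.
Proof.
case: x => a b /=.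
by rewrite -sqrtr_sqr ler_wsqrtr// lerDr sqr_ge0.
Qed.

Lemma normc_le_ReIm x : normc x <= `|complex.Re x| + `|complex.Im x|.
Proof.
rewrite -[leRHS]ger0_norm ?addr_ge0// -sqrtr_sqr; case: x => a b /=.
rewrite ler_wsqrtr// sqrrD !real_normK ?num_real//.
by rewrite addrAC lerDl mulrn_wge0// mulr_ge0.
Qed.

Lemma normc_conj x : normc x^* = normc x.
Proof. by case: x => a b /=; rewrite sqrrN. Qed.

Lemma normcR (a : R) : normc a%:C = `|a|.
Proof. by rewrite /= expr0n addr0 sqrtr_sqr. Qed.

Lemma normc_square x y (r : R) : normc (x - y) <= r -> square y r x.
Proof.
move=> h; split; apply: le_trans h.
- by apply: le_trans (normr_Re_le_normc _); case: x y => ? ? [].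
- by apply: le_trans (normr_Im_le_normc _); case: x y => ? ? [].
Qed.

Lemma square_normc x y (r : R) : square y r x -> normc (x - y) <= 2 * r.
Proof.
move=> [h1 h2]; apply: le_trans (normc_le_ReIm _) _.
by case: x y h1 h2 => ? ? [? ?] /=; lra.
Qed.

Lemma ReD x y : complex.Re (x + y) = complex.Re x + complex.Re y.
Proof. by case: x y => ? ? []. Qed.

Lemma ReB x y : complex.Re (x - y) = complex.Re x - complex.Re y.
Proof. by case: x y => ? ? []. Qed.

Lemma Re_sum (I : Type) (s : seq I) (h : I -> C) :
  complex.Re (\sum_(i <- s) h i) = \sum_(i <- s) complex.Re (h i).
Proof. by elim: s => [|i s IH]; rewrite ?big_nil// !big_cons ReD IH. Qed.

Lemma normc_sum (I : Type) (s : seq I) (h : I -> C) :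
  normc (\sum_(i <- s) h i) <= \sum_(i <- s) normc (h i).
Proof.
elim: s => [|i s IH]; first by rewrite !big_nil normc0.
by rewrite !big_cons; apply: le_trans (le_normcD _ _) _; rewrite lerD2l.
Qed.

Lemma normsq_ge0 z : 0 <= normsq z.
Proof. by apply: sumr_ge0 => i _; exact: sqr_ge0. Qed.

(** The arithmetic mean in place of the Cauchy-Schwarz bound: subtracted from 1 it gives (rho z +
    rho w) / 2, the form needed below. *)
Lemma normc_inner_le z w : normc (inner z w) <= (normsq z + normsq w) / 2.
Proof.
apply: le_trans (normc_sum _ _) _; rewrite mulrDl !mulr_suml -big_split /=.
apply: ler_sum => i _; rewrite normcM normc_conj.
have := sqr_ge0 (normc (tnth z i) - normc (tnth w i)); lra.
Qed.

Lemma normsq_dist z w :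
  \sum_(i < n) normc (tnth z i - tnth w i) ^+ 2 =
  normsq z + normsq w - 2 * complex.Re (inner z w).
Proof.
rewrite /normsq /inner Re_sum mulr_sumr -big_split/= -sumrB.
apply: eq_bigr => i _; rewrite !sqr_normc.
by case: (tnth z i) (tnth w i) => ? ? [? ?] /=; lra.
Qed.

Lemma normc_coord_le z i : normc (tnth z i) ^+ 2 <= normsq z.
Proof.
by rewrite /normsq (bigD1 i)//= lerDl sumr_ge0// => j _; exact: sqr_ge0.
Qed.

Lemma normc_coord_lt1 z i : unit_ball z -> normc (tnth z i) < 1.
Proof.
rewrite /unit_ball /= => zB; have := le_lt_trans (normc_coord_le z i) zB.
by rewrite expr_lt1// normc_ge0.
Qed.

Lemma Re1inner z w : complex.Re (1 - inner z w) = 1 - complex.Re (inner z w).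
Proof. by rewrite ReB. Qed.

Lemma inner_conj z w : inner w z = (inner z w)^*.
Proof.
rewrite /inner raddf_sum; apply: eq_bigr => i _.
by case: (tnth z i) (tnth w i) => ? ? [? ?]; simpc; congr Complex; lra.
Qed.

Lemma normc_1inner_sym z w : normc (1 - inner z w) = normc (1 - inner w z).
Proof.
rewrite (inner_conj z w); case: (inner z w) => x y /=.
by congr Num.sqrt; lra.
Qed.

Section in_ball.
Variables (z w : n.-tuple C).
Hypotheses (zB : unit_ball z) (wB : unit_ball w).

Lemma Re_1inner_ge : ((1 - normsq z) + (1 - normsq w)) / 2 <= complex.Re (1 - inner z w).
Proof.
have := le_trans (Re_le_normc _) (normc_inner_le z w).
by rewrite Re1inner; lra.
Qed.

Lemma Re_1inner_gt0 : 0 < complex.Re (1 - inner z w).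
Proof.
apply: lt_le_trans Re_1inner_ge; move: zB wB; rewrite /unit_ball/=; lra.
Qed.

Lemma normc_1inner_gt0 : 0 < normc (1 - inner z w).
Proof. exact: lt_le_trans Re_1inner_gt0 (Re_le_normc _). Qed.

Lemma normc_1inner_ge : (1 - normsq z) / 2 <= normc (1 - inner z w).
Proof.
apply: le_trans (Re_le_normc _); apply: le_trans Re_1inner_ge.
by move: wB; rewrite /unit_ball/=; lra.
Qed.

Lemma normc_1inner_le2 : normc (1 - inner z w) <= 2.
Proof.
apply: le_trans (le_normcD _ _) _; rewrite normcN.
have := normc_inner_le z w; rewrite normc1.
by move: zB wB; rewrite /unit_ball/=; lra.
Qed.

(** Inside the ball |z - w|^2 <= 2 Re (1 - <z,w>), so a Koranyi ball of size t lies in a Euclidean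
    ball of radius sqrt (2 t) about the same center. *)
Lemma normc_coord_dist_le i :
  normc (tnth z i - tnth w i) ^+ 2 <= 2 * normc (1 - inner z w).
Proof.
apply: (@le_trans _ _ (\sum_(i < n) normc (tnth z i - tnth w i) ^+ 2)).
  by rewrite (bigD1 i)//= lerDl sumr_ge0// => j _; exact: sqr_ge0.
rewrite normsq_dist; have := Re_le_normc (1 - inner z w); rewrite Re1inner.
by move: zB wB; rewrite /unit_ball/=; lra.
Qed.

End in_ball.

(** A bound of order 1/n instead of the sharp n^(-1/2) avoids square roots: for numbers below 1, the
    square is at most the number itself. *)
Lemma exists_large_coord z : 2^-1 <= normsq z ->
  exists j, (2 * n%:R)^-1 <= normc (tnth z j).
Proof.
move=> zh; apply: contrapT => /forallNP h.
have n0 : (0 < n)%N.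
  case: n z zh h => // z0; rewrite /normsq big_ord0; lra.
have n1 : 1 <= n%:R :> R by rewrite ler1n.
have k0 : 0 < (2 * n%:R)^-1 :> R by rewrite invr_gt0; lra.
have : normsq z < \sum_(i < n) (2 * n%:R)^-1.
  apply: (@le_lt_trans _ _ (\sum_(i < n) (2 * n%:R)^-1 * (2 * n%:R)^-1)).
    apply: ler_sum => i _; rewrite expr2; have /negP := h i; rewrite -ltNge => /ltW hi.
    by apply: ler_pM; rewrite ?normc_ge0.
  rewrite !sumr_const card_ord ltr_pMn2r//.
  rewrite -[ltRHS]mulr1 ltr_pM2l//.
  by rewrite invf_lt1; lra.
rewrite sumr_const card_ord -mulr_natr ltNge => /negP; apply.
apply: le_trans zh; rewrite le_eqVlt; apply/orP; left; apply/eqP.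
field. by rewrite pnatr_eq0 -lt0n.
Qed.

End inner_product.

(** * Volumes of nonisotropic balls *)

Lemma measure_bigsetU_le d (T : measurableType d) (R : realType)
    (mu : {measure set T -> \bar R}) (I : Type) (s : seq I) (F : I -> set T) :
  (forall i, measurable (F i)) ->
  (mu (\big[setU/set0]_(i <- s) F i) <= \sum_(i <- s) mu (F i))%E.
Proof.
move=> mF; elim: s => [|i s IH]; first by rewrite !big_nil measure0.
rewrite !big_cons; apply: le_trans (leeD2l _ IH).
by apply: measureU2 => //; exact: bigsetU_measurable.
Qed.

Section volume.
Variables (R : realType) (n : nat).
Local Notation C := R[i].
Implicit Types (z w : n.-tuple C).

Definition qball z (t : R) : set (n.-tuple C) := [set w | normc (1 - inner z w) < t].
Definition shell (s : R) : set (n.-tuple C) := [set w | unit_ball w /\ 1 - normsq w < s].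

Lemma measurable_qball z t : measurable (qball z t).
Proof.
apply: (measurable_lt_set (g := cst t)) => //; apply: measurable_fun_normc.
by apply: measurable_csub => //; apply: measurable_inner.
Qed.

Lemma measurable_shell s : measurable (shell s).
Proof.
apply: measurableI; first exact: measurable_unit_ball.
apply: (measurable_lt_set (g := cst s)) => //; apply: measurable_funB => //.
exact: measurable_normsq.
Qed.

Lemma normsq_update w j x :
  normsq (tuple_update w j x) = normc x ^+ 2 + \sum_(i < n | i != j) normc (tnth w i) ^+ 2.
Proof.
rewrite /normsq (bigD1 j)//= tnth_mktuple eqxx; congr (_ + _).
by apply: eq_bigr => i /negPf ij; rewrite tnth_mktuple ij.
Qed.

Lemma inner_updateB z w j x y : inner z (tuple_update w j x) - inner z (tuple_update w j y) =
  tnth z j * (x - y)^*.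
Proof.
rewrite /inner (bigD1 j)//= [X in _ - X](bigD1 j)//= !tnth_mktuple eqxx.
rewrite (eq_bigr (fun i => tnth z i * (tnth w i)^*)); last first.
  by move=> i /negPf ij; rewrite tnth_mktuple ij.
rewrite [X in _ - (_ + X)](eq_bigr (fun i => tnth z i * (tnth w i)^*)); last first.
  by move=> i /negPf ij; rewrite tnth_mktuple ij.
by rewrite opprD addrACA subrr addr0 -mulrBr raddfB.
Qed.

(** With the other coordinates frozen, the shell condition on w confines |w_j|^2 to an interval of
    length s, so the slice in w_j is part of an annulus. Keeping the diameter [r2] in that
    coordinate apart from the size [r] in the others is what yields a nonisotropic bound. *)
Lemma volume_large_coord (j : 'I_n) (E : set (n.-tuple C)) (c : 'I_n -> C) (c0 r r2 s : R) :
  0 < c0 -> 0 <= r -> 0 <= r2 -> 0 <= s -> measurable E ->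
  (forall w, E w -> shell s w) ->
  (forall w, E w -> 2 * c0 <= normc (tnth w j)) ->
  (forall w i, E w -> i != j -> square (c i) r (tnth w i)) ->
  (forall w x y, E (tuple_update w j x) -> E (tuple_update w j y) -> normc (x - y) <= r2) ->
  (lebesgueCn E <= (8 * r2 * s / c0 * ((2 * r) ^+ 2) ^+ n.-1)%:E)%E.
Proof.
move=> c0p r0 r20 s0 mE Es Ec Er Er2.
apply: (lebesgueCn_slice_le (j := j) (c := c)) => //.
  by rewrite divr_ge0 ?mulr_ge0// ltW.
move=> w; set F := [set x | _].
have mF : measurable F.
  rewrite /F -[X in measurable X]setTI.
  suff : measurable_fun setT (fun x => tuple_update w j x) by apply.
  apply/measurable_fun_tnthP => i /=.
  rewrite (_ : _ \o _ = fun x => if i == j then x else tnth w i).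
    by case: (i == j).
  by apply/funext => x; rewrite /= tnth_mktuple.
have [F0|/set0P[x Fx]] := eqVneq F set0.
  by rewrite F0 measure0 lee_fin divr_ge0 ?mulr_ge0// ltW.
pose S := \sum_(i < n | i != j) normc (tnth w i) ^+ 2.
apply: (le_trans _ (@annulus_area R x r2 c0 (1 - s - S) s r20 c0p s0)).
apply: le_measure; rewrite ?inE//.
  apply: measurableI; first exact: measurable_square.
  apply: measurableI.
    by apply: (measurable_le_set (f := cst (2 * c0))) => //; exact: measurable_normc.
  apply: measurableI.
    by apply: (measurable_lt_set (f := cst _)) => //; exact: measurable_sqr_normc.
  by apply: (measurable_le_set (g := cst _)) => //; exact: measurable_sqr_normc.
move=> y Fy; split; first by apply: normc_square; exact: Er2 Fy Fx.
split; first by have := Ec _ Fy; rewrite tnth_mktuple eqxx.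
by have [] := Es _ Fy; rewrite /unit_ball /= normsq_update -/S; lra.
Qed.

(** For s < 1/2 every point of the shell has a coordinate of modulus at least [k], so n sets with a
    large coordinate cover it. For s >= 1/2 the volume of a polysquare around the ball is enough;
    this is [M2], with its factor 2. *)
Lemma volume_shell : (0 < n)%N -> exists2 M : R, 0 <= M &
  forall s, 0 < s -> (lebesgueCn (shell s) <= (M * s)%:E)%E.
Proof.
move=> n0; pose k : R := (2 * n%:R)^-1.
pose M1 : R := (8 * 2 / (k / 2) * ((2 * 1) ^+ 2) ^+ n.-1).
pose M2 : R := 2 * ((2 * 1) ^+ 2) ^+ n.
have k0 : 0 < k by rewrite invr_gt0 mulr_gt0// ltr0n.
have M10 : 0 <= M1.
  by rewrite mulr_ge0 ?exprn_ge0// divr_ge0// divr_ge0// ltW.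
have M20 : 0 <= M2 by rewrite mulr_ge0// !exprn_ge0//.
exists (M1 *+ n + M2); first by rewrite addr_ge0// mulrn_wge0.
move=> s s0; have [s1|s1] := ltP s (2^-1); last first.
  apply: (@le_trans _ _ (lebesgueCn (polysquare (fun _ : 'I_n => 0) 1))).
    apply: le_measure; rewrite ?inE; [exact: measurable_shell|exact: measurable_polysquare|].
    move=> w [wB _] i; apply: normc_square; rewrite subr0 ltW//.
    exact: normc_coord_lt1.
  rewrite lebesgueCn_polysquare// lee_fin.
  have : 0 <= M1 *+ n * s by rewrite mulr_ge0 ?mulrn_wge0// ltW.
  have X0 := exprn_ge0 n (sqr_ge0 (2 * 1 : R)).
  move=> aX; rewrite [leRHS]mulrDl /M2; apply: (@le_trans _ _ (2 * ((2 * 1) ^+ 2) ^+ n * s)); last by rewrite lerDr.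
  by rewrite mulrAC ler_peMl//; lra.
pose E (j : 'I_n) := shell s `&` [set w | k <= normc (tnth w j)].
have mE j : measurable (E j).
  apply: measurableI; first exact: measurable_shell.
  apply: (measurable_le_set (f := cst _)) => //; apply: measurable_fun_normc.
  exact: measurable_tnth.
have Ej j : (lebesgueCn (E j) <= (M1 * s)%:E)%E.
  have := @volume_large_coord j (E j) (fun=> 0) (k / 2) 1 2 s.
  have -> : 8 * 2 * s / (k / 2) * ((2 * 1) ^+ 2) ^+ n.-1 = M1 * s by rewrite /M1; ring.
  move=> h; apply: h => //; rewrite ?divr_gt0// ?(ltW s0)//.
  - by move=> w [].
  - by move=> w [_] /=; rewrite mulrC divfK.
  - move=> w i [[wB _] _] _; apply: normc_square; rewrite subr0 ltW//.
    exact: normc_coord_lt1.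
  - move=> w x y [[xB _] _] [[yB _] _]; apply: le_trans (le_normcD _ _) _.
    have := normc_coord_lt1 j xB; have := normc_coord_lt1 j yB.
    by rewrite normcN !tnth_mktuple eqxx; lra.
apply: (@le_trans _ _ (lebesgueCn (\big[setU/set0]_(j < n) E j))).
  apply: le_measure; rewrite ?inE; [exact: measurable_shell|exact: bigsetU_measurable|].
  move=> w ws; have [_ h] := ws.
  have /exists_large_coord[j hj] : 2^-1 <= normsq w by lra.
  by rewrite -bigcup_seq; exists j => //=; rewrite mem_index_enum.
apply: (@le_trans _ _ (\sum_(j < n) lebesgueCn (E j))%E).
  exact: measure_bigsetU_le.
apply: (@le_trans _ _ (\sum_(j < n) (M1 * s)%:E)%E).
  by apply: lee_sum.
rewrite sumEFin lee_fin sumr_const card_ord mulrDl -mulrnAl lerDl.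
by rewrite mulr_ge0// ltW.
Qed.

(** For small t a nonempty intersection forces z towards the sphere, so some |z_j| >= k. Two points
    that differ only in the coordinate j then satisfy |z_j| |x - y| <= 2 t, while the other
    coordinates vary by sqrt (2 t): this gives t s from the direction j and t^(n-1) from the rest.
    For t >= t0 the shell estimate suffices, as t^n is bounded below. *)
Lemma volume_qball_shell : (0 < n)%N -> exists2 M : R, 0 <= M &
  forall z s t, unit_ball z -> 0 < s -> 0 < t ->
    (lebesgueCn (qball z t `&` shell s) <= (M * (t ^+ n * s))%:E)%E.
Proof.
move=> n0; have [M M0 MP] := volume_shell n0.
(* With t < t0 = k^2/8 one has sqrt (2 t) <= k/2, so |z_j| >= k gives |w_j| >= k/2 throughout the
   Koranyi ball. *)
pose k : R := (2 * n%:R)^-1; pose t0 : R := k ^+ 2 / 8.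
have n1 : 1 <= n%:R :> R by rewrite ler1n.
have k0 : 0 < k by rewrite invr_gt0 mulr_gt0// ltr0n.
have k1 : k <= 2^-1 by rewrite lef_pV2 ?posrE//; lra.
have t00 : 0 < t0 by rewrite divr_gt0// exprn_gt0.
pose M1 : R := 8 * (2 / k) / (k / 4) * 8 ^+ n.-1.
have kge := ltW k0; have t0ge := ltW t00.
have M10 : 0 <= M1.
  rewrite /M1; apply: mulr_ge0; last exact: exprn_ge0.
  by apply: divr_ge0; [apply: mulr_ge0 => //|]; apply: divr_ge0.
exists (M1 + M / t0 ^+ n).
  by rewrite addr_ge0// divr_ge0// exprn_ge0// ltW.
move=> z s t zB s0 tp; have [tt0|tt0] := leP t0 t.
  apply: (@le_trans _ _ (lebesgueCn (shell s))).
    apply: le_measure; rewrite ?inE; [|exact: measurable_shell|exact: subIsetr].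
    by apply: measurableI; [exact: measurable_qball|exact: measurable_shell].
  apply: le_trans (MP _ s0) _; rewrite lee_fin mulrA ler_wpM2r ?(ltW s0)//.
  rewrite mulrDl -[leLHS]add0r lerD//; first by rewrite mulr_ge0// exprn_ge0// ltW.
  rewrite -mulrA ler_peMr// mulrC ler_pdivlMr ?exprn_gt0// mul1r.
  by apply: lerXn2r; rewrite ?nnegrE// ltW.
have Mt0 : 0 <= M / t0 ^+ n by rewrite divr_ge0// exprn_ge0.
have [->|/set0P[w0 [w0q [w0B _]]]] := eqVneq (qball z t `&` shell s) set0.
  by rewrite measure0 lee_fin mulr_ge0 ?addr_ge0// mulr_ge0 ?exprn_ge0// ltW.
have [j kj] : exists j, k <= normc (tnth z j).
  apply: exists_large_coord.
  have := Re_1inner_ge z w0; have := Re_le_normc (1 - inner z w0).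
  move: w0q w0B; rewrite /qball /unit_ball /=.
  have : t0 <= 8^-1 by rewrite /t0; nra.
  lra.
have := @volume_large_coord j (qball z t `&` shell s) (fun i => tnth z i) (k / 4)
  (Num.sqrt (2 * t)) (2 * t / k) s.
have -> : (2 * Num.sqrt (2 * t)) ^+ 2 = 8 * t.
  by rewrite exprMn sqr_sqrtr; lra.
have -> : 8 * (2 * t / k) * s / (k / 4) * (8 * t) ^+ n.-1 = M1 * (t ^+ n * s).
  rewrite exprMn -[in RHS](prednK n0) exprS /M1; ring.
move=> h; apply: le_trans (h _ _ _ _ _ _ _ _ _) _ => //.
- by rewrite divr_gt0.
- by rewrite divr_ge0 ?mulr_ge0// ltW.
- exact: ltW.
- by apply: measurableI; [exact: measurable_qball|exact: measurable_shell].
- by move=> w [].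
- move=> w [wq [wB _]].
  have d : normc (tnth z j - tnth w j) <= k / 2.
    rewrite -ler_sqr ?nnegrE ?normc_ge0 ?divr_ge0//.
    apply: le_trans (normc_coord_dist_le zB wB j) _.
    move: wq tt0; rewrite /qball/= /t0; lra.
  have := le_normcD (tnth w j) (tnth z j - tnth w j).
  by rewrite addrC subrK; lra.
- move=> w i [wq [wB _]] _; apply: normc_square; rewrite normcB.
  rewrite -[leLHS]ger0_norm ?normc_ge0// -sqrtr_sqr ler_wsqrtr//.
  apply: le_trans (normc_coord_dist_le zB wB i) _.
  by rewrite ler_pM2l// ltW.
- move=> w x y [xq _] [yq _].
  rewrite ler_pdivlMr//.
  apply: (@le_trans _ _ (normc (tnth z j * (x - y)^*))).
    by rewrite normcM normc_conj mulrC ler_wpM2r// normc_ge0.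
  rewrite -(inner_updateB z w) (_ : _ - _ = (1 - inner z (tuple_update w j y)) - (1 - inner z (tuple_update w j x))).
    apply: le_trans (le_normcD _ _) _; rewrite normcN.
    by move: xq yq; rewrite /qball/=; lra.
  by ring.
- rewrite lee_fin ler_wpM2r//; first by rewrite mulr_ge0 ?exprn_ge0// ltW.
  by rewrite lerDl divr_ge0// exprn_ge0// ltW.
Qed.

End volume.

(** * Dyadic summation *)

Section dyadic.
Variable R : realType.

Lemma powRXn (x : R) (k : nat) (e : R) : 0 <= x -> (x ^+ k) `^ e = (x `^ e) ^+ k.
Proof.
move=> x0; elim: k => [|k IH]; first by rewrite !expr0 powR1.
by rewrite !exprS powRM ?exprn_ge0// IH.
Qed.

Lemma exists_pow2_gt (x : R) : exists k, x < 2 ^+ k.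
Proof.
exists (Num.bound `|x|); apply: (@le_lt_trans _ _ `|x|); first exact: ler_norm.
apply: lt_le_trans (archi_boundP (normr_ge0 x)) _.
by rewrite -natrX ler_nat; exact/ltnW/ltn_expl.
Qed.

Lemma dyadic_up (s x : R) : 0 < s -> s / 2 <= x ->
  exists k : nat, s * 2 ^+ k / 2 <= x < s * 2 ^+ k.
Proof.
move=> s0 sx; have [k0 hk0] := exists_pow2_gt (x / s).
have ex : exists k, (x < s * 2 ^+ k) by exists k0; rewrite mulrC -ltr_pdivrMr.
case: (ex_minnP ex) => [[|k]] xk kmin; first by exists 0%N; rewrite xk expr0 mulr1 sx.
exists k.+1; rewrite xk andbT exprS leNgt; apply/negP => h.
suff /kmin : x < s * 2 ^+ k by rewrite ltnn.
by apply: lt_le_trans h _; rewrite le_eqVlt; apply/orP; left; apply/eqP; field.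
Qed.

Lemma dyadic_down (s x : R) : 0 < x -> x < s ->
  exists k : nat, s * 2^-1 ^+ k / 2 <= x < s * 2^-1 ^+ k.
Proof.
move=> x0 xs; have [k0 hk0] := exists_pow2_gt (s / x).
have ex : exists k, (s * 2^-1 ^+ k / 2 <= x).
  exists k0; rewrite exprVn; apply: (@le_trans _ _ (s / 2 ^+ k0)).
    rewrite ler_pdivrMr// ler_peMr ?divr_ge0 ?exprn_ge0 ?(ltW (lt_trans x0 xs))//.
    by rewrite ler1n.
  by rewrite ler_pdivrMr ?exprn_gt0// mulrC -ler_pdivrMr// ltW.
case: (ex_minnP ex) => [[|k]] xk kmin; first by exists 0%N; rewrite xk expr0 mulr1 xs.
exists k.+1; rewrite xk /= ltNge; apply/negP => h.
suff /kmin : s * 2^-1 ^+ k / 2 <= x by rewrite ltnn.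
apply: le_trans h.
by rewrite exprS le_eqVlt; apply/orP; left; apply/eqP; field.
Qed.

Lemma geometric_nneseries_le (C q : R) : 0 <= C -> 0 <= q < 1 ->
  (\sum_(k <oo) (C * q ^+ k)%:E <= (C / (1 - q))%:E)%E.
Proof.
move=> C0 /andP[q0 q1]; apply: lime_le.
  by apply: is_cvg_nneseries => k _ _; rewrite lee_fin mulr_ge0// exprn_ge0.
apply: nearW => m; rewrite sumEFin lee_fin -mulr_sumr ler_wpM2l//.
rewrite -[leRHS]mul1r ler_pdivlMr ?subr_gt0//.
elim: m => [|m IH]; first by rewrite big_nil mul0r ler01.
suff -> : (\sum_(0 <= i < m.+1) q ^+ i) * (1 - q) = 1 - q ^+ m.+1.
  by rewrite lerBlDr lerDl exprn_ge0.
elim: m {IH} => [|m IH]; first by rewrite big_nat1 expr0 expr1 mul1r.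
by rewrite big_nat_recr//= mulrDl IH !exprS; ring.
Qed.

Lemma powR_dyadic_le (s x e : R) : 0 < s -> s / 2 <= x < s ->
  x `^ e <= 2 `^ `|e| * s `^ e.
Proof.
move=> s0 /andP[sx xs]; have x0 : 0 < x by apply: lt_le_trans sx; rewrite divr_gt0.
have [e0|e0] := leP 0 e.
  rewrite -[leLHS]mul1r ler_pM ?powR_ge0//.
    by have := @ler_powR R 2 (ler1n R 2) 0 `|e| (normr_ge0 e); rewrite powRr0.
  by apply: ge0_ler_powR; rewrite ?nnegrE// ltW.
rewrite ltr0_norm//; have -> : 2 `^ (- e) * s `^ e = (s / 2) `^ e.
  rewrite powRM ?invr_ge0// ?ltW// mulrC; congr (_ * _).
  by rewrite -powR_inv1// -powRrM mulN1r.
rewrite -(opprK e) (powRN x (- e)) (powRN (s / 2) (- e)) lef_pV2 ?posrE ?powR_gt0 ?divr_gt0//.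
by apply: ge0_ler_powR; rewrite ?nnegrE ?oppr_ge0 ?divr_ge0 ?(ltW s0) ?(ltW x0) ?(ltW e0).
Qed.

Section integral.
Context d (T : measurableType d) (mu : {measure set T -> \bar R}).
Variables (D : set T) (f g : T -> R) (s A a e th : R).
Hypotheses (mD : measurable D) (mf : measurable_fun setT f) (mg : measurable_fun setT g).
Hypotheses (f0 : forall x, 0 <= f x).
Hypotheses (s0 : 0 < s) (th0 : 0 < th) (the : th `^ (a + e) < 1) (A0 : 0 <= A).
Hypothesis Dg : forall x, D x -> exists k : nat, s * th ^+ k / 2 <= g x < s * th ^+ k.
Hypothesis IA : forall k : nat,
  (\int[mu]_(x in D `&` [set x | (g x < s * th ^+ k)%R]) (f x)%:E <= (A * (s * th ^+ k) `^ a)%:E)%E.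

(** The layers g ~ s th^k contribute at most a geometric series of ratio th^(a+e). The base [th] is
    1/2 when g has an upper bound and small values matter, and 2 when g is bounded below and large
    values matter, so one lemma serves both directions of summation. *)
Lemma dyadic_integral_le :
  (\int[mu]_(x in D) (f x * g x `^ e)%:E
    <= (2 `^ `|e| * A / (1 - th `^ (a + e)) * s `^ (a + e))%:E)%E.
Proof.
pose t k := s * th ^+ k.
have t0 k : 0 < t k by rewrite mulr_gt0// exprn_gt0.
pose G k := [set x | g x < t k].
have mG k : measurable (G k) by exact: (measurable_lt_set (g := cst _)).
pose h (k : nat) x := (2 `^ `|e| * t k `^ e * (f x * \1_(G k) x))%:E.
have h0 k x : (0 <= h k x)%E by rewrite lee_fin !mulr_ge0 ?powR_ge0.
have mh k : measurable_fun D (h k).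
  apply/measurable_EFinP; apply: measurable_funM => //; apply: measurable_funTS.
  by apply: measurable_funM => //.
apply: (@le_trans _ _ (\int[mu]_(x in D) \sum_(k <oo) h k x)%E).
  apply: ge0_le_integral => //.
  - by move=> x _; rewrite lee_fin mulr_ge0// powR_ge0.
  - apply/measurable_EFinP; apply: measurable_funTS; apply: measurable_funM => //.
    by apply: (measurableT_comp (measurable_powR _)).
  - by apply: ge0_emeasurable_sum.
  move=> x Dx; have [k gk] := Dg Dx.
  apply: (@le_trans _ _ (h k x)).
    rewrite /h indicE mem_set ?mulr1; last by have /andP[] := gk.
    by rewrite lee_fin [leRHS]mulrC ler_wpM2l//; exact: powR_dyadic_le.
  apply: (@le_trans _ _ (\sum_(0 <= i < k.+1) h i x)%E).
    by rewrite big_nat_recr//= leeDr// sume_ge0.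
  by apply: nneseries_lim_ge.
rewrite integral_nneseries//.
apply: (@le_trans _ _ (\sum_(k <oo) (2 `^ `|e| * A * s `^ (a + e) * (th `^ (a + e)) ^+ k)%:E)%E); last first.
  apply: le_trans (geometric_nneseries_le _ _) _.
  - by rewrite !mulr_ge0 ?powR_ge0.
  - by rewrite powR_ge0.
  - by rewrite lee_fin mulrAC.
apply: lee_nneseries; first by move=> k _ _; apply: integral_ge0 => x _; exact: h0.
move=> k _; rewrite /h.
under eq_integral do rewrite EFinM.
rewrite ge0_integralZl//; last 3 first.
- apply/measurable_EFinP; apply: measurable_funTS; exact: measurable_funM.
- by move=> x _; rewrite lee_fin mulr_ge0.
- by rewrite lee_fin mulr_ge0 ?powR_ge0.
rewrite (_ : \int[mu]_(x in D) _ = \int[mu]_(x in D `&` G k) (f x)%:E)%E; last first.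
  rewrite [RHS]integral_mkcondr; apply: eq_integral => x _.
  by rewrite /restrict indicE; case: ifP => _; rewrite ?mulr1 ?mulr0.
apply: (@le_trans _ _ ((2 `^ `|e| * t k `^ e)%:E * (A * t k `^ a)%:E)%E).
  by apply: lee_wpmul2l; [rewrite lee_fin mulr_ge0 ?powR_ge0|exact: IA].
rewrite -EFinM lee_fin le_eqVlt; apply/orP; left; apply/eqP.
have -> : 2 `^ `|e| * A * s `^ (a + e) * (th `^ (a + e)) ^+ k = 2 `^ `|e| * A * (t k) `^ (a + e).
  by rewrite /t powRM ?exprn_ge0 ?(ltW s0) ?(ltW th0)// powRXn ?(ltW th0)// mulrA.
rewrite powRD; first by ring.
by rewrite (gt_eqF (t0 k)) implybT.
Qed.

End integral.
End dyadic.

(** * The Forelli-Rudin estimate *)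

Section vball.
Variables (R : realType) (n : nat).
Local Notation C := R[i].
Local Notation Cn := (n.-tuple C).

Definition vol : R := fine (@lebesgueCn R n unit_ball).

Lemma vballE (A : set Cn) : vball A = (vol^-1%:E * lebesgueCn (A `&` unit_ball))%E.
Proof. by []. Qed.

Lemma lebesgueCn_ball_lty : (@lebesgueCn R n unit_ball < +oo)%E.
Proof.
apply: (@le_lt_trans _ _ (lebesgueCn (polysquare (fun _ : 'I_n => 0 : C) 1))).
  apply: le_measure; rewrite ?inE; [exact: measurable_unit_ball|exact: measurable_polysquare|].
  move=> w wB i; apply: normc_square; rewrite subr0 ltW//.
  exact: normc_coord_lt1.
by rewrite lebesgueCn_polysquare// ltry.
Qed.

Lemma volE : (@lebesgueCn R n unit_ball = vol%:E)%E.
Proof. by rewrite /vol fineK// ge0_fin_numE ?lebesgueCn_ball_lty. Qed.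

Lemma vol_ge0 : 0 <= vol.
Proof. by rewrite /vol fine_ge0. Qed.

Lemma vball_lty (A : set Cn) : measurable A -> (vball A < +oo)%E.
Proof.
move=> mA; rewrite vballE; apply: lte_mul_pinfty; rewrite ?lee_fin ?invr_ge0 ?vol_ge0//.
apply: le_lt_trans lebesgueCn_ball_lty; apply: le_measure; rewrite ?inE//.
- by apply: measurableI => //; exact: measurable_unit_ball.
- exact: measurable_unit_ball.
Qed.

Lemma vball_le (A : set Cn) (M : R) : measurable A -> A `<=` unit_ball ->
  (lebesgueCn A <= M%:E)%E -> (vball A <= (vol^-1 * M)%:E)%E.
Proof.
move=> mA AB AM; rewrite vballE setIidl// EFinM; apply: lee_wpmul2l => //.
by rewrite lee_fin invr_ge0 vol_ge0.
Qed.

(* A copy of [vball] to carry the finiteness instance that Tonelli's theorem requires. *)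
Definition fvball : set Cn -> \bar R := @vball R n.
HB.instance Definition _ := Measure.on fvball.

Let fvball_fin : fin_num_fun fvball.
Proof.
by move=> A mA; rewrite ge0_fin_numE ?vball_lty//; exact: measure_ge0.
Qed.
HB.instance Definition _ := @Measure_isFinite.Build _ _ _ fvball fvball_fin.

Definition rho (w : Cn) : R := 1 - normsq w.

Lemma measurable_rho : measurable_fun setT rho.
Proof. by apply: measurable_funB => //; exact: measurable_normsq. Qed.

Lemma measurable_rho_powR (b : R) : measurable_fun setT (fun w => rho w `^ b).
Proof. exact: (measurableT_comp (measurable_powR _) measurable_rho). Qed.

Lemma rho_gt0 w : unit_ball w -> 0 < rho w.
Proof. by rewrite /unit_ball/= subr_gt0. Qed.

Lemma rho_le1 w : rho w <= 1.
Proof. by rewrite /rho gerBl normsq_ge0. Qed.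

Lemma measurable_normc_1inner (z : Cn) :
  measurable_fun setT (fun w => normc (1 - inner z w)).
Proof.
by apply: measurable_fun_normc; apply: measurable_csub => //; apply: measurable_inner.
Qed.

(** On a Koranyi ball of size t one has rho < 2 t. Its part of depth below s = 2 t 2^(-k) has volume
    O(t^n s), and b > -1 makes the sum over k converge. *)
Lemma integral_rho_qball (b : R) : (0 < n)%N -> -1 < b -> exists2 M : R, 0 <= M &
  forall z t, unit_ball z -> 0 < t ->
  (\int[vball]_(w in unit_ball `&` qball z t) (rho w `^ b)%:E
     <= (M * t `^ (n%:R + 1 + b))%:E)%E.
Proof.
move=> n0 b1; have [M M0 MP] := volume_qball_shell R n0.
pose q : R := 2^-1 `^ (1 + b).
have q0 : 0 <= q by exact: powR_ge0.
have q1 : q < 1.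
  rewrite /q -(powR_inv1 (ler0n _ 2)) -powRrM mulN1r powRN invf_lt1 ?powR_gt0//.
  rewrite -[ltLHS](powRr0 2); apply: lt_le_trans (_ : 2 `^ 0 < 2 `^ (1 + b)) _ => //.
  rewrite /powR (negPf (_ : 2 != 0)) ?pnatr_eq0//.
  rewrite ltr_expR; rewrite ltr_pM2r ?ln_gt0 ?ltr1n//; lra.
have V0 := vol_ge0.
exists (2 `^ `|b| * (vol^-1 * M) / (1 - q) * 2 `^ (1 + b)).
  by rewrite !mulr_ge0 ?invr_ge0 ?powR_ge0// subr_ge0 ltW.
move=> z t zB t0.
have mD : measurable (unit_ball `&` qball z t).
  by apply: measurableI; [exact: measurable_unit_ball|exact: measurable_qball].
have H := @dyadic_integral_le R _ _ (@vball R n) (unit_ball `&` qball z t) (cst 1) rho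
  (2 * t) (vol^-1 * (M * t ^+ n)) 1 b 2^-1 mD (measurable_cst _) measurable_rho.
apply: le_trans (le_trans _ (H _ _ _ _ _ _ _)) _ => //.
- by under [leRHS]eq_integral do rewrite /= mul1r.
- by rewrite mulr_gt0.
- by rewrite !mulr_ge0 ?invr_ge0 ?exprn_ge0// ltW.
- move=> w [wB wq]; apply: dyadic_down; first exact: rho_gt0.
  move: wq (normc_1inner_ge w zB); rewrite /qball /= normc_1inner_sym /rho.
  by lra.
- move=> k; rewrite (eq_integral (cst 1%E))// integral_cst/=; last first.
    by apply: measurableI => //; apply: (measurable_lt_set (g := cst _)) => //; exact: measurable_rho.
  set s := 2 * t * 2^-1 ^+ k; have s0 : 0 < s by rewrite !mulr_gt0// exprn_gt0.
  rewrite mul1e powRr1 ?(ltW s0)// -!mulrA mulrA.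
  apply: (@le_trans _ _ (vball (qball z t `&` shell s))).
    apply: le_measure; rewrite ?inE.
    + by apply: measurableI => //; apply: (measurable_lt_set (g := cst _)) => //; exact: measurable_rho.
    + by apply: measurableI; [exact: measurable_qball|exact: measurable_shell].
    + by move=> w [[? ?] ?].
  rewrite -mulrA; apply: vball_le.
  + by apply: measurableI; [exact: measurable_qball|exact: measurable_shell].
  + by move=> w [_ []].
  + exact: MP.
rewrite lee_fin le_eqVlt; apply/orP; left; apply/eqP.
have -> : t `^ (n%:R + 1 + b) = t ^+ n * t `^ (1 + b).
  rewrite -addrA powRD ?(gt_eqF t0) ?implybT//.
  by rewrite powR_mulrn// ltW.
rewrite powRM ?(ltW t0)// -/q; ring.
Qed.

(** Since |1 - <z,w>| >= rho(z)/2, the dyadic sizes start at rho(z) and double; the condition on c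
    makes the smallest scale dominate, hence the power of rho(z). *)
Lemma forelli_rudin_estimate (b c : R) : (0 < n)%N -> -1 < b -> n%:R + 1 + b < c ->
  exists2 M : R, 0 <= M & forall z, unit_ball z ->
  (\int[vball]_(w in unit_ball) (rho w `^ b * normc (1 - inner z w) `^ (- c))%:E
     <= (M * rho z `^ (n%:R + 1 + b - c))%:E)%E.
Proof.
move=> n0 b1 bc; have [M M0 MP] := integral_rho_qball n0 b1.
pose q : R := 2 `^ (n%:R + 1 + b - c).
have q0 : 0 <= q by exact: powR_ge0.
have q1 : q < 1.
  rewrite -[ltRHS](powRr0 2) /q /powR (negPf (_ : 2 != 0)) ?pnatr_eq0//.
  rewrite ltr_expR; rewrite ltr_pM2r ?ln_gt0 ?ltr1n//; lra.
exists (2 `^ `|- c| * M / (1 - q)).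
  by rewrite !mulr_ge0 ?invr_ge0 ?powR_ge0// subr_ge0 ltW.
move=> z zB.
apply: (@dyadic_integral_le R _ _ (@vball R n) unit_ball (fun w => rho w `^ b)
   (fun w => normc (1 - inner z w)) (rho z) M (n%:R + 1 + b) (- c) 2) => //.
- exact: measurable_unit_ball.
- exact: measurable_rho_powR.
- exact: measurable_normc_1inner.
- by move=> w; exact: powR_ge0.
- exact: rho_gt0.
- by move=> w wB; apply: dyadic_up; [exact: rho_gt0|exact: normc_1inner_ge].
- by move=> k; apply: MP => //; rewrite mulr_gt0 ?rho_gt0// exprn_gt0.
Qed.

End vball.

(** * The Gamma function and the weight constants *)

Section gamma.
Variable R : realType.
Local Notation leb := (@lebesgue_measure R).

(** For an integer m >= y, t^m = m^m (t/m)^m, and t/m <= exp (t/m) gives the bound with M = m^m. *)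
Lemma powR_le_expR (y : R) : exists2 M : R, 0 <= M & forall t, 1 <= t -> t `^ y <= M * expR t.
Proof.
pose m := (Num.bound `|y|).+1.
have ym : y <= m%:R.
  apply: (le_trans (ler_norm _)); apply/ltW/(lt_le_trans (archi_boundP (normr_ge0 y))).
  by rewrite ler_nat.
have m0 : 0 < m%:R :> R by rewrite ltr0n.
exists (m%:R ^+ m); first by rewrite exprn_ge0// ltW.
move=> t t1; have t0 : 0 <= t by apply: le_trans t1.
apply: (@le_trans _ _ (t ^+ m)).
  by rewrite -powR_mulrn//; exact: ler_powR.
have -> : t ^+ m = m%:R ^+ m * (t / m%:R) ^+ m.
  by rewrite -exprMn mulrC divfK// gt_eqF.
rewrite ler_wpM2l ?exprn_ge0 ?(ltW m0)//.
have -> : expR t = expR (t / m%:R) ^+ m.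
  by rewrite -expRM_natl mulrC divfK// gt_eqF.
apply: lerXn2r; rewrite ?nnegrE ?divr_ge0 ?expR_ge0 ?(ltW m0)//.
by apply: le_trans (expR_ge1Dx _); rewrite lerDr.
Qed.

Lemma integral_powR_lt1_lty (e : R) : -1 < e ->
  (\int[leb]_(t in `]0%R, 1%R[) (1 * t `^ e)%:E < +oo)%E.
Proof.
move=> e1; apply: le_lt_trans (@dyadic_integral_le R _ _ leb `]0, 1[%classic (cst 1) id 1 1 1 e 2^-1 _ _ _ _ _ _ _ _ _ _) _ => //.
- rewrite -(powR_inv1 (ler0n _ 2)) -powRrM mulN1r powRN invf_lt1 ?powR_gt0//.
  rewrite -[ltLHS](powRr0 2) /powR (negPf (_ : 2 != 0)) ?pnatr_eq0//.
  rewrite ltr_expR; rewrite ltr_pM2r ?ln_gt0 ?ltr1n//; lra.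
- by move=> x /=; rewrite in_itv/= => /andP[x0 x1]; apply: dyadic_down.
- move=> k; rewrite (eq_integral (cst 1%E))// integral_cst/=; last first.
    by apply: measurableI => //; exact: (measurable_lt_set (g := cst _)).
  rewrite mul1e; apply: (@le_trans _ _ (leb `[0, 1 * 2^-1 ^+ k])).
    apply: le_measure; rewrite ?inE//.
      by apply: measurableI => //; exact: (measurable_lt_set (g := cst _)).
    by move=> x [/=]; rewrite !in_itv/= => /andP[/ltW -> _] /ltW ->.
  rewrite lebesgue_measure_itv/= lte_fin mul1r powRr1 ?exprn_ge0//.
  by case: ifP => _; rewrite -?EFinD lee_fin ?subr0 ?mul1r// exprn_ge0.
- by rewrite ltry.
Qed.

Lemma integral_powR_ge1_lty :
  (\int[leb]_(t in `[1%R, +oo[) (1 * t `^ (-2))%:E < +oo)%E.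
Proof.
apply: le_lt_trans (@dyadic_integral_le R _ _ leb `[1, +oo[%classic (cst 1) id 2 1 1 (-2) 2 _ _ _ _ _ _ _ _ _ _) _ => //.
- by rewrite (_ : 1 - 2 = -1); [rewrite powR_inv1//; lra|lra].
- by move=> x /=; rewrite in_itv/= andbT => x1; apply: dyadic_up => //; lra.
- move=> k; rewrite (eq_integral (cst 1%E))// integral_cst/=; last first.
    by apply: measurableI => //; exact: (measurable_lt_set (g := cst _)).
  have k0 : 0 <= 2 * 2 ^+ k :> R by rewrite mulr_ge0// exprn_ge0.
  rewrite mul1e; apply: (@le_trans _ _ (leb `[0, 2 * 2 ^+ k])).
    apply: le_measure; rewrite ?inE//.
      by apply: measurableI => //; exact: (measurable_lt_set (g := cst _)).
    move=> x [/=]; rewrite !in_itv/= andbT => x1 /ltW ->; rewrite andbT; lra.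
  rewrite lebesgue_measure_itv/= lte_fin mul1r powRr1//.
  by case: ifP => _; rewrite -?EFinD lee_fin ?subr0.
- by rewrite ltry.
Qed.

(** [Gamma] is the finite part of an extended integral, which would be 0 for an infinite one;
    positivity thus requires convergence too. The integrand is compared with t^(x-1) on ]0, 1[ and
    with a multiple of t^(-2) beyond, and it is bounded below on [1, 2]. *)
Lemma Gamma_gt0 (x : R) : 0 < x -> 0 < Gamma x.
Proof.
move=> x0; pose g t : R := t `^ (x - 1) * expR (- t).
have g0 t : 0 <= g t by rewrite mulr_ge0 ?powR_ge0 ?expR_ge0.
have mg D : measurable_fun D g.
  apply: measurable_funTS; apply: measurable_funM; first exact: measurable_powR.
  by apply: measurableT_comp => //.
have mgE D : measurable_fun D (EFin \o g) by exact/measurable_EFinP.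
have mle D (e : R) : measurable_fun D (fun t : R => (1 * t `^ e)%:E).
  apply/measurable_EFinP/measurable_funTS; apply: measurable_funM => //; exact: measurable_powR.
have gE0 t : (0 <= (g t)%:E)%E by rewrite lee_fin.
have fin : (\int[leb]_(t in `]0%R, +oo[) (g t)%:E < +oo)%E.
  have -> : `]0, +oo[%classic = `]0, 1[%classic `|` `[1, +oo[%classic :> set R.
    apply/seteqP; split => t /=; rewrite !in_itv/= !andbT.
      by move=> t0; have [t1|t1] := ltP t 1; [left; rewrite t0|right].
    by move=> [/andP[]//|t1]; lra.
  apply: le_lt_trans (_ : (_ <= \int[leb]_(t in `]0%R, 1%R[) (g t)%:E + \int[leb]_(t in `[1%R, +oo[) (g t)%:E)%E) _.
    rewrite ge0_integral_setU//; first exact: mgE.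
    apply/disj_set2P/seteqP; split => t //= []; rewrite !in_itv/= andbT => /andP[_ t1] t2; lra.
  apply: lte_add_pinfty.
    apply: le_lt_trans (@integral_powR_lt1_lty (x - 1) _); last lra.
    apply: ge0_le_integral => //; [exact: mgE|exact: mle|].
    move=> t /=; rewrite in_itv/= => /andP[t0 t1]; rewrite lee_fin mul1r /g ler_piMr ?powR_ge0//.
    by rewrite -expR0 ler_expR; lra.
  have [M M0 MP] := powR_le_expR (x + 1).
  apply: (@le_lt_trans _ _ (\int[leb]_(t in `[1%R, +oo[) (M%:E * (1 * t `^ (-2))%:E))%E).
    apply: ge0_le_integral => //; [exact: mgE|by apply: emeasurable_funM => //; exact: mle|].
    move=> t /=; rewrite in_itv/= andbT => t1; rewrite -EFinM lee_fin mul1r /g.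
    have t0 : 0 < t by lra.
    rewrite expRN ler_pdivrMr ?expR_gt0// mulrAC -ler_pdivrMr ?powR_gt0//.
    rewrite powRN invrK -powRD ?(gt_eqF t0) ?implybT//.
    by rewrite (_ : x - 1 + 2 = x + 1); [exact: MP|lra].
  rewrite ge0_integralZl//; last 2 first.
  - exact: mle.
  - by move=> t _; rewrite lee_fin mul1r powR_ge0.
  by apply: lte_mul_pinfty => //; exact: integral_powR_ge1_lty.
rewrite /Gamma; apply: fine_gt0; apply/andP; split; last exact: fin.
pose m : R := 2^-1 `^ `|x - 1| * expR (- 2).
have m0 : 0 < m by rewrite mulr_gt0 ?powR_gt0 ?expR_gt0.
apply: (@lt_le_trans _ _ (\int[leb]_(t in `[1%R, 2%R]) m%:E)%E).
  rewrite integral_cst//= lebesgue_measure_itv/= lte_fin ltr1n -EFinB -EFinM lte_fin.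
  by rewrite mulr_gt0//; lra.
apply: (@le_trans _ _ (\int[leb]_(t in `[1%R, 2%R]) (g t)%:E)%E); last first.
  apply: ge0_subset_integral => //; first exact: mgE.
  by move=> t /=; rewrite !in_itv/= andbT => /andP[t1 _]; lra.
apply: ge0_le_integral => //.
- by move=> t _; rewrite lee_fin ltW.
- exact: mgE.
move=> t /=; rewrite in_itv/= => /andP[t1 t2]; rewrite lee_fin /m /g.
apply: ler_pM; rewrite ?powR_ge0 ?expR_ge0//; last by rewrite ler_expR; lra.
have t0 : 0 < t by lra.
have [e0|e0] := leP 0 (x - 1).
  rewrite ger0_norm//; apply: ge0_ler_powR; rewrite ?nnegrE ?(ltW t0)//; lra.
rewrite ltr0_norm//.
have -> : t `^ (x - 1) = t^-1 `^ (- (x - 1)).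
  by rewrite -(powR_inv1 (ltW t0)) -powRrM mulN1r opprK.
apply: ge0_ler_powR; rewrite ?nnegrE ?invr_ge0 ?(ltW t0)//; first lra.
by rewrite lef_pV2 ?posrE.
Qed.

Lemma weight_cst_gt0 (n : nat) (alpha : R) : -1 < alpha -> 0 < weight_cst n alpha.
Proof.
move=> a1; rewrite /weight_cst divr_gt0 ?mulr_gt0 ?Gamma_gt0 ?ltr0n ?fact_gt0//; last lra.
by have := ler0n R n; lra.
Qed.

End gamma.

(** * Weighted Lebesgue norms *)

Lemma lee_poweR (R : realType) (x y : \bar R) (r : R) : 0 <= r -> (0 <= x)%E -> (x <= y)%E ->
  (x `^ r <= y `^ r)%E.
Proof.
move=> r0 x0 xy; apply: gt0_ler_poweR => //; rewrite in_itv/= leey andbT//.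
exact: le_trans xy.
Qed.

Section hoelder_on.
Local Open Scope ereal_scope.
Context d (T : measurableType d) (R : realType) (mu : {measure set T -> \bar R}).

Lemma ge0_hoelder (D : set T) (u v : T -> R) (p q : R) : measurable D ->
  measurable_fun D u -> measurable_fun D v ->
  (forall x, 0 <= u x)%R -> (forall x, 0 <= v x)%R ->
  (0 < p)%R -> (0 < q)%R -> (p^-1 + q^-1 = 1)%R ->
  \int[mu]_(x in D) (u x * v x)%:E <=
  (\int[mu]_(x in D) (u x `^ p)%:E) `^ p^-1 *
  (\int[mu]_(x in D) (v x `^ q)%:E) `^ q^-1.
Proof.
move=> mD mu_ mv u0 v0 p0 q0 pq.
have mU : measurable_fun setT (u \_ D) by apply/(measurable_restrictT _ _).1.
have mV : measurable_fun setT (v \_ D) by apply/(measurable_restrictT _ _).1.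
have := hoelder mu mU mV p0 q0 pq.
have E (w : T -> R) (r : R) : (0 < r)%R -> (forall x, 0 <= w x)%R ->
    'N[mu]_r%:E[(EFin \o (w \_ D))] = (\int[mu]_(x in D) (w x `^ r)%:E) `^ r^-1.
  move=> r0 w0; rewrite unlock [in RHS]integral_mkcond; congr (poweR _ _).
  apply: eq_integral => x _ /=; rewrite !patchE; case: ifP => _.
    by rewrite ger0_norm.
  by rewrite normr0 powR0// gt_eqF.
rewrite Lnorm1 !E//; congr (_ <= _); rewrite [RHS]integral_mkcond.
apply: eq_integral => x _ /=; rewrite !patchE; case: ifP => _.
  by rewrite ger0_norm// mulr_ge0.
by rewrite mulr0 normr0.
Qed.

End hoelder_on.

Section Lp.
Variables (R : realType) (n : nat).
Local Notation C := R[i].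
Local Notation Cn := (n.-tuple C).
Local Notation B := (@unit_ball R n).
Implicit Types (f g : Cn -> C).

Let mB : measurable B := @measurable_unit_ball R n.

(** The r-th power of the norm of L^r_alpha, without the factor [weight_cst n alpha]. *)
Definition mass (r alpha : R) f : \bar R :=
  (\int[vball]_(w in B) (normc (f w) `^ r * rho w `^ alpha)%:E)%E.

Lemma mass_ge0 r alpha f : (0 <= mass r alpha f)%E.
Proof. by apply: integral_ge0 => w _; rewrite lee_fin mulr_ge0 ?powR_ge0. Qed.

Lemma measurable_normc_powR f r : measurable_fun B f ->
  measurable_fun B (fun w => normc (f w) `^ r).
Proof.
by move=> mf; apply: (measurableT_comp (measurable_powR _)); exact: measurable_fun_normc.
Qed.

Lemma measurable_mass_fun f r alpha : measurable_fun B f ->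
  measurable_fun B (fun w => normc (f w) `^ r * rho w `^ alpha).
Proof.
move=> mf; apply: measurable_funM; first exact: measurable_normc_powR.
by apply: measurable_funTS; exact: measurable_rho_powR.
Qed.

Lemma Lpnorm_mass (r alpha : R) f : 0 < r -> -1 < alpha -> measurable_fun B f ->
  (Lpnorm r%:E alpha f = ((weight_cst n alpha)%:E * mass r alpha f) `^ r^-1)%E.
Proof.
move=> r0 a1 mf; rewrite /Lpnorm unlock; congr (_ `^ _)%E.
have W0 := ltW (weight_cst_gt0 n a1).
rewrite (integral_density (m := @vball R n) (w := @weight R n alpha)).
- rewrite /mass -ge0_integralZl//; last 2 first.
  + by apply/measurable_EFinP; exact: measurable_mass_fun.
  + by move=> w _; rewrite lee_fin mulr_ge0 ?powR_ge0.
  rewrite [RHS]integral_mkcond; apply: eq_integral => w _ /=.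
  rewrite !patchE; case: ifP => _ /=.
    by rewrite -EFinM ger0_norm ?normc_ge0// -EFinM /weight -/(rho w); congr EFin; ring.
  by rewrite normr0 powR0 ?gt_eqF// mul0e.
- exact: measurable_weight.
- by move=> w; rewrite /weight mulr_ge0// powR_ge0.
- by [].
- apply: (measurableT_comp (measurable_poweR _)).
  apply: measurableT_comp => //.
  apply/(measurable_restrictT _ _).1 => //; apply/measurable_EFinP.
  exact: measurable_fun_normc.
- by move=> w; exact: poweR_ge0.
Qed.

Lemma in_LpP (r alpha : R) f : 0 < r -> -1 < alpha ->
  in_Lp r%:E alpha f <-> measurable_fun B f /\ (mass r alpha f < +oo)%E.
Proof.
move=> r0 a1; have W0 := weight_cst_gt0 n a1.
split => -[mf]; last first.
  move=> h; split => //; rewrite Lpnorm_mass//.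
  by rewrite poweR_lty// lte_mul_pinfty// lee_fin ltW.
rewrite Lpnorm_mass// => h; split => //.
have /lty_poweRy := h; rewrite invr_neq0 ?gt_eqF// => /(_ isT).
by apply: contraTT; rewrite -!leNgt !leye_eq => /eqP ->; rewrite gt0_muley.
Qed.

Lemma Lpnorm_le (q beta p alpha M : R) f g : 0 < q -> -1 < beta -> 0 < p -> -1 < alpha ->
  measurable_fun B f -> measurable_fun B g -> 0 <= M ->
  (mass q beta g <= M%:E * mass p alpha f `^ (q / p))%E ->
  (Lpnorm q%:E beta g <= ((weight_cst n beta * M) `^ q^-1 / weight_cst n alpha `^ p^-1)%:E * Lpnorm p%:E alpha f)%E.
Proof.
move=> q0 b1 p0 a1 mf mg M0 h.
rewrite !Lpnorm_mass//; have := weight_cst_gt0 n a1; have := weight_cst_gt0 n b1.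
move: (weight_cst n alpha) (weight_cst n beta) => Wa Wb Wb0 Wa0.
have WM : 0 <= Wb * M by rewrite mulr_ge0// ltW.
have e : (((Wb * M)%:E * mass p alpha f `^ (q / p)) `^ q^-1)%E =
  (((Wb * M) `^ q^-1)%:E * mass p alpha f `^ p^-1)%E.
  rewrite poweRM ?poweR_ge0 ?lee_fin//.
  rewrite poweR_EFin -poweRrM; congr (_ * _ `^ _)%E.
  by field; rewrite !gt_eqF.
apply: (@le_trans _ _ ((((Wb * M)%:E * mass p alpha f `^ (q / p)) `^ q^-1)%E)).
  apply: gt0_ler_poweR; rewrite ?in_itv/= ?leey ?andbT ?invr_ge0 ?(ltW q0)//.
  - by rewrite mule_ge0 ?mass_ge0// lee_fin ltW.
  - by rewrite mule_ge0 ?poweR_ge0// lee_fin.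
  - by rewrite EFinM -muleA; apply: lee_wpmul2l => //; rewrite lee_fin ltW.
rewrite e poweRM ?mass_ge0 ?lee_fin ?(ltW Wa0)// poweR_EFin muleA -EFinM.
by rewrite divfK// gt_eqF// powR_gt0.
Qed.

Lemma integral_rho_lty (b : R) : (0 < n)%N -> -1 < b ->
  exists2 M : R, 0 <= M & (\int[vball]_(w in B) (rho w `^ b)%:E <= M%:E)%E.
Proof.
move=> n0 b1; have [M M0 MP] := integral_rho_qball n0 b1.
exists (M * 2 `^ (n%:R + 1 + b)); first by rewrite mulr_ge0 ?powR_ge0.
(* At the origin 1 - <0,w> = 1, so the Koranyi ball of size 2 about 0 contains the whole unit
   ball. *)
pose z0 : Cn := [tuple 0 | i < n].
have z0B : B z0.
  by rewrite /unit_ball/= /normsq big1// => i _; rewrite tnth_mktuple normc0 expr0n.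
apply: le_trans (MP z0 2 z0B _) => //.
rewrite (_ : B `&` qball z0 2 = B)//.
apply/setIidl => w _; rewrite /qball/= /inner big1 ?subr0 ?normc1 ?ltr1n//.
by move=> i _; rewrite tnth_mktuple mul0r.
Qed.

(* Hoelder with exponents p/q and p/(p-q). *)
Lemma mass_inclusion (q beta p gamma : R) : (0 < n)%N -> 0 < q -> q < p ->
  (gamma + 1) / p < (beta + 1) / q ->
  exists2 M : R, 0 <= M & forall g, measurable_fun B g ->
    (mass q beta g <= M%:E * mass p gamma g `^ (q / p))%E.
Proof.
move=> n0 q0 qp gb; have p0 : 0 < p by lra.
pose s := p / q; pose s' := p / (p - q).
have s0 : 0 < s by rewrite divr_gt0.
have s'0 : 0 < s' by rewrite divr_gt0// subr_gt0.
have pq0 : p - q != 0 by rewrite gt_eqF// subr_gt0.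
have ss' : s^-1 + s'^-1 = 1 by rewrite /s /s'; field; rewrite pq0 !gt_eqF.
(* The second Hoelder factor is a pure power of rho, and its exponent exceeds -1 exactly when (gamma
   + 1)/p < (beta + 1)/q. *)
have [M M0 MP] : exists2 M : R, 0 <= M & (\int[vball]_(w in B) (rho w `^ ((beta - gamma * q / p) * s'))%:E <= M%:E)%E.
  apply: integral_rho_lty => //.
  rewrite /s' mulrA ltr_pdivlMr ?subr_gt0//.
  have : q * (gamma + 1) < p * (beta + 1).
    by move: gb; rewrite ltr_pdivrMr// mulrAC ltr_pdivlMr//; lra.
  rewrite mulrBl divfK ?gt_eqF//; lra.
exists (M `^ s'^-1); first exact: powR_ge0.
move=> g mg.
have := @ge0_hoelder _ _ R (@vball R n) B (fun w => normc (g w) `^ q * rho w `^ (gamma * q / p))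
  (fun w => rho w `^ (beta - gamma * q / p)) s s' mB.
move=> /(_ (measurable_mass_fun q (gamma * q / p) mg) (measurable_funTS (measurable_rho_powR _))).
move=> /(_ (fun=> mulr_ge0 (powR_ge0 _ _) (powR_ge0 _ _)) (fun=> powR_ge0 _ _) s0 s'0 ss').
have -> : (\int[vball]_(x in B) ((normc (g x) `^ q * rho x `^ (gamma * q / p)) * rho x `^ (beta - gamma * q / p))%:E = mass q beta g)%E.
  apply: eq_integral => w; rewrite inE => wB; rewrite -mulrA -powRD; last first.
    by rewrite (gt_eqF (rho_gt0 wB)) implybT.
  by rewrite addrC subrK.
have -> : (\int[vball]_(x in B) ((normc (g x) `^ q * rho x `^ (gamma * q / p)) `^ s)%:E = mass p gamma g)%E.
  apply: eq_integral => w wB; rewrite powRM ?powR_ge0// -!powRrM /s.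
  by congr ((_ `^ _ * _ `^ _)%:E); field; rewrite !gt_eqF.
move=> h; apply: (le_trans h); rewrite muleC (_ : s^-1 = q / p); last by rewrite /s invf_div.
apply: lee_wpmul2r; first exact: poweR_ge0.
rewrite -poweR_EFin; apply: lee_poweR; first by rewrite invr_ge0 ltW.
- by apply: integral_ge0 => w _; rewrite lee_fin powR_ge0.
- by under eq_integral do rewrite -powRrM.
Qed.

End Lp.

(** * The Schur test *)

Section schur_exponents.
Variable R : realType.

Lemma exists_between4 (L1 L2 U1 U2 : R) : L1 < U1 -> L1 < U2 -> L2 < U1 -> L2 < U2 ->
  exists u, [/\ L1 < u, L2 < u, u < U1 & u < U2].
Proof.
move=> h1 h2 h3 h4; exists ((Num.max L1 L2 + Num.min U1 U2) / 2).
by have [?|?] := leP L1 L2; have [?|?] := leP U1 U2; split; lra.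
Qed.

(* The test weight is [rho ^ u]; [v] and [e] are the exponents at which the Forelli-Rudin
   estimate is applied, in [w] after Hoelder's inequality and in [z] after Tonelli. *)
Lemma schur_exponents (n : nat) (p alpha gamma a b c : R) : 1 < p ->
  - p * a < gamma + 1 -> alpha + 1 < p * (b + 1) ->
  c = n%:R + 1 + a + b + (gamma - alpha) / p ->
  exists v e u t : R, [/\ [/\ -1 < v, n%:R + 1 + v < c, -1 < e & n%:R + 1 + e < c],
    [/\ u = v * (1 - p^-1), e = p * a + gamma + (n%:R + 1 + v - c) * (p - 1) & t = (b - u) * p],
    t + (n%:R + 1 + e - c) = alpha, alpha <= t & 0 <= c].
Proof.
move=> p1 h1 h2 cE; have p0 : 0 < p by lra.
pose P := p^-1; have PE : p * P = 1 by rewrite mulfV// gt_eqF.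
have P0 : 0 < P by rewrite invr_gt0.
have P1 : P < 1 by rewrite invf_lt1.
(* [X] and [Y] are the two input inequalities divided by p, so both are positive, and the relation
   on c becomes c = n + X + Y. *)
pose X := a + (gamma + 1) * P; pose Y := b + 1 - (alpha + 1) * P.
have X0 : 0 < X.
  have : 0 < P * (p * a + gamma + 1) by rewrite mulr_gt0//; lra.
  by rewrite /X !mulrDr mulrA (mulrC P) PE; lra.
have Y0 : 0 < Y.
  have : 0 < P * (p * (b + 1) - (alpha + 1)) by rewrite mulr_gt0//; lra.
  by rewrite /Y mulrBr mulrA (mulrC P) PE; lra.
have cXY : c = n%:R + X + Y by rewrite cE /X /Y -/P; ring.
(* In this order the four bounds on u say -1 < v, -1 < e, n + 1 + v < c and n + 1 + e < c. Every
   lower bound is below every upper bound because X, Y and 1 - P are positive. *)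
have [u [u1 u2 u3 u4]] : exists u, [/\ - (1 - P) < u, (X + Y - 1) * (1 - P) - X < u,
    u < (X + Y - 1) * (1 - P) & u < Y - 1 + P].
  apply: exists_between4.
  - by have : 0 < (1 - P) * (X + Y) by [rewrite mulr_gt0// ?subr_gt0// addr_gt0]; lra.
  - lra.
  - lra.
  - have : 0 < P * (X + Y) by rewrite mulr_gt0// addr_gt0.
    by lra.
have P1' : 1 - P != 0 by rewrite gt_eqF// subr_gt0.
pose v := u / (1 - P).
have uv : u = v * (1 - P) by rewrite /v divfK.
have v1 : -1 < v by rewrite -(ltr_pM2r (_ : 0 < 1 - P)) -?uv; lra.
have v2 : n%:R + 1 + v < c.
  have : v < X + Y - 1 by rewrite -(ltr_pM2r (_ : 0 < 1 - P)) -?uv; lra.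
  by rewrite cXY; lra.
pose e := p * a + gamma + (n%:R + 1 + v - c) * (p - 1).
have eE : e = p * (X + u - (X + Y - 1) * (1 - P)) - 1.
  have vp : v * (p - 1) = p * u.
    have -> : p - 1 = p * (1 - P) by rewrite mulrBr PE mulr1.
    by rewrite mulrCA -uv.
  have e1 : (X + Y - 1) * (1 - P) * p = (X + Y - 1) * (p - 1).
    by rewrite -mulrA (mulrC _ p) mulrBr PE mulr1.
  have e2 : p * X = p * a + gamma + 1.
    by rewrite /X mulrDr (mulrC _ P) mulrA PE mul1r addrA.
  have -> : p * (X + u - (X + Y - 1) * (1 - P)) = p * X + p * u - (X + Y - 1) * (1 - P) * p by ring.
  rewrite e1 e2 -vp /e.
  have -> : n%:R + 1 + v - c = v - (X + Y - 1) by rewrite cXY; ring.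
  by ring.
have e1 : -1 < e.
  have : 0 < p * (X + u - (X + Y - 1) * (1 - P)) by rewrite mulr_gt0//; lra.
  by rewrite eE; lra.
have e2 : n%:R + 1 + e < c.
  have : 0 < p * (Y - 1 + P - u) by rewrite mulr_gt0//; lra.
  rewrite eE cXY.
  have -> : X + u - (X + Y - 1) * (1 - P) = (X + Y) * P + (u - (Y - 1 + P)) by ring.
  have -> : p * ((X + Y) * P + (u - (Y - 1 + P))) = (X + Y) * (p * P) - p * (Y - 1 + P - u) by ring.
  by rewrite PE; lra.
pose t := (b - u) * p.
(* The parameter u cancels: the value of c makes the two applications of the Forelli-Rudin estimate
   return exactly the weight alpha. *)
have tE : t + (n%:R + 1 + e - c) = alpha.
  rewrite /t eE cXY.
  have -> : X + u - (X + Y - 1) * (1 - P) = u + 1 - P - Y + (X + Y) * P by ring.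
  have -> : b = Y - 1 + (alpha + 1) * P by rewrite /Y; ring.
  transitivity (alpha * (p * P) + (X + Y) * (p * P - 1) + (p * P - 1) - (p * P - 1)); last by rewrite PE; ring.
  by ring.
have t_alpha : alpha <= t by move: tE e2; lra.
have c0 : 0 <= c by have := ler0n R n; rewrite cXY; lra.
by exists v, e, u, t.
Qed.

End schur_exponents.

(** * Tonelli's theorem and parametric integrals on the ball *)

Section tonelli.
Variables (R : realType) (n : nat).
Local Notation C := R[i].
Local Notation Cn := (n.-tuple C).
Local Notation B := (@unit_ball R n).

Let mB : measurable B := @measurable_unit_ball R n.

Let cut (h : Cn * Cn -> \bar R) : Cn * Cn -> \bar R := h \_ (B `*` B).

Let cut_measurable h : measurable_fun setT h -> measurable_fun setT (cut h).
Proof.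
move=> mh; apply/(measurable_restrictT _ _).1; first exact: measurableX.
exact: measurable_funTS.
Qed.

Let cut_ge0 h : (forall p, 0 <= h p)%E -> forall p, (0 <= cut h p)%E.
Proof. by move=> h0 p; rewrite /cut patchE; case: ifP. Qed.

Let cutE1 h : (fun z => \int[@fvball R n]_w cut h (z, w))%E =
  (fun z => \int[vball]_(w in B) h (z, w))%E \_ B.
Proof.
apply/funext => z; rewrite patchE; case: ifPn => zB.
  rewrite [RHS]integral_mkcond; apply: eq_integral => w _.
  by rewrite /cut !patchE in_setX zB.
rewrite integral0_eq// => w _.
by rewrite /cut patchE in_setX (negPf zB).
Qed.

Let cutE2 h : (fun w => \int[@fvball R n]_z cut h (z, w))%E =
  (fun w => \int[vball]_(z in B) h (z, w))%E \_ B.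
Proof.
apply/funext => w; rewrite patchE; case: ifPn => wB.
  rewrite [RHS]integral_mkcond; apply: eq_integral => z _.
  by rewrite /cut !patchE in_setX wB andbT.
rewrite integral0_eq// => z _.
by rewrite /cut patchE in_setX (negPf wB) andbF.
Qed.

Lemma measurable_integral_ball (h : Cn * Cn -> \bar R) :
  measurable_fun setT h -> (forall p, 0 <= h p)%E ->
  measurable_fun B (fun z => \int[vball]_(w in B) h (z, w))%E.
Proof.
move=> mh h0; apply/(measurable_restrictT _ _).2 => //.
rewrite -cutE1; apply: (measurable_fun_fubini_tonelli_F (m2 := @fvball R n)).
- exact: cut_measurable.
- exact: cut_ge0.
Qed.

Lemma tonelli_ball (h : Cn * Cn -> \bar R) :
  measurable_fun setT h -> (forall p, 0 <= h p)%E ->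
  (\int[vball]_(z in B) \int[vball]_(w in B) h (z, w) =
   \int[vball]_(w in B) \int[vball]_(z in B) h (z, w))%E.
Proof.
move=> mh h0.
have := @fubini_tonelli _ _ Cn Cn R (@fvball R n) (@fvball R n) (cut h)
  (cut_measurable mh) (cut_ge0 h0).
by rewrite cutE1 cutE2 -!integral_mkcond.
Qed.

(** The positive and negative parts are covered by Tonelli's theorem. As [fine] is measurable, its
    default value at infinity does no harm. *)
Lemma measurable_Rintegral_ball (h : Cn * Cn -> R) :
  measurable_fun setT h ->
  measurable_fun B (fun z => \int[vball]_(w in B) h (z, w))%R.
Proof.
move=> mh; apply: measurableT_comp; first exact: fine_measurable.
under eq_fun do rewrite integralE.
have mhE : measurable_fun setT (EFin \o h) by exact/measurable_EFinP.
apply: emeasurable_funB.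
- have := measurable_integral_ball (h := (EFin \o h)^\+%E)
    (measurable_funepos mhE) (funepos_ge0 _).
  by apply: eq_measurable_fun => z _; apply: eq_integral => w _; rewrite !funeposE.
- have := measurable_integral_ball (h := (EFin \o h)^\-%E)
    (measurable_funeneg mhE) (funeneg_ge0 _).
  by apply: eq_measurable_fun => z _; apply: eq_integral => w _; rewrite !funenegE.
Qed.

End tonelli.

Section cintegral_bound.
Context d (T : measurableType d) (R : realType) (mu : {measure set T -> \bar R}).

(** The constant 2 results from bounding the real and imaginary parts separately; the sharp constant
    1 would need a rotation of h. *)
Lemma normc_cintegral_le (D : set T) (h : T -> R[i]) : measurable D -> measurable_fun D h ->
  ((normc (cintegral mu D h))%:E <= 2%:E * \int[mu]_(x in D) (normc (h x))%:E)%E.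
Proof.
move=> mD mh; have mn := measurable_fun_normc mh.
have mnE : measurable_fun D (fun x => (normc (h x))%:E) by exact/measurable_EFinP.
set I := (\int[mu]_(x in D) _)%E.
have I0 : (0 <= I)%E by apply: integral_ge0 => x _; rewrite lee_fin normc_ge0.
have [Ioo|Ifin] := eqVneq I +oo%E; first by rewrite Ioo gt0_muley ?leey// lte_fin.
have Rb (r : T -> R) : measurable_fun D r -> (forall x, `|r x| <= normc (h x)) ->
    `|(\int[mu]_(x in D) r x)%R| <= fine I.
  move=> mr rh.
  have mrE : measurable_fun D (fun x => (r x)%:E) by exact/measurable_EFinP.
  have rI : (`|\int[mu]_(x in D) (r x)%:E| <= I)%E.
    apply: le_trans (le_abse_integral _ _ _) _ => //.
    apply: ge0_le_integral => //.
    - exact: measurableT_comp.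
    - by move=> x _; rewrite lee_fin.
  have If : I \is a fin_num by rewrite ge0_fin_numE// ltey.
  rewrite -lee_fin fineK// /Rintegral; apply: le_trans rI.
  rewrite -[leRHS]fineK; last first.
    rewrite ge0_fin_numE ?abse_ge0//; apply: le_lt_trans (_ : _ <= I)%E _; last by rewrite ltey.
    apply: le_trans (le_abse_integral _ _ _) _ => //.
    apply: ge0_le_integral => //.
    - exact: measurableT_comp.
    - by move=> x _; rewrite lee_fin.
  by rewrite lee_fin; case: (\int[mu]_(x in D) _)%E => //=; rewrite normr0.
rewrite -[I in leRHS]fineK ?ge0_fin_numE ?ltey// -EFinM lee_fin.
apply: le_trans (normc_le_ReIm _) _; rewrite /cintegral /=.
rewrite mulrDl mul1r; apply: lerD; apply: Rb.
- exact: measurable_fun_Re.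
- by move=> x; exact: normr_Re_le_normc.
- exact: measurable_fun_Im.
- by move=> x; exact: normr_Im_le_normc.
Qed.

End cintegral_bound.

Section schur.
Variables (R : realType) (n : nat).
Local Notation C := R[i].
Local Notation Cn := (n.-tuple C).
Local Notation B := (@unit_ball R n).

Let mB : measurable B := @measurable_unit_ball R n.

Lemma measurable_pair_1inner : measurable_fun setT
  (fun x : Cn * Cn => normc (1 - inner x.1 x.2)).
Proof.
apply: measurable_fun_normc; apply: measurable_csub => //.
by apply: measurable_inner.
Qed.

Lemma measurable_snd_comp (F : Cn -> R) : measurable_fun setT F ->
  measurable_fun setT (fun x : Cn * Cn => F x.2).
Proof. by move=> mF; apply: (measurableT_comp mF). Qed.

Lemma measurable_fst_comp (F : Cn -> R) : measurable_fun setT F ->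
  measurable_fun setT (fun x : Cn * Cn => F x.1).
Proof. by move=> mF; apply: (measurableT_comp mF). Qed.

(* The Schur test with the power weight rho^u. *)
Lemma schur_estimate (p alpha gamma a b c : R) : (0 < n)%N -> 1 < p ->
  - p * a < gamma + 1 -> alpha + 1 < p * (b + 1) ->
  c = n%:R + 1 + a + b + (gamma - alpha) / p ->
  exists2 M : R, 0 <= M & forall F : Cn -> R, measurable_fun setT F ->
    (forall w, 0 <= F w) ->
    (\int[vball]_(w in B) (F w `^ p * rho w `^ alpha)%:E < +oo)%E ->
    let I (z : Cn) := (\int[vball]_(w in B) (rho w `^ b * normc (1 - inner z w) `^ (- c) * F w)%:E)%E in
    (forall z, B z -> I z < +oo)%E /\
    (\int[vball]_(z in B) (((rho z `^ a)%:E * I z) `^ p * (rho z `^ gamma)%:E)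
      <= M%:E * \int[vball]_(w in B) (F w `^ p * rho w `^ alpha)%:E)%E.
Proof.
move=> n0 p1 h1 h2 cE; have p0 : 0 < p by lra.
have [v [e [u [t [[v1 v2 e1 e2] [uv eE tE'] tE t_alpha c0]]]]] := schur_exponents p1 h1 h2 cE.
move: cE => _; pose P := p^-1; have PE : p * P = 1 by rewrite mulfV// gt_eqF.
have P0 : 0 < P by rewrite invr_gt0.
have P1 : P < 1 by rewrite invf_lt1.
pose p' := (1 - P)^-1.
have p'0 : 0 < p' by rewrite invr_gt0; lra.
have p'E : p' * (1 - P) = 1 by rewrite mulVf// gt_eqF; lra.
have p'I : p'^-1 = 1 - P by rewrite invrK.
have pp' : p / p' = p - 1 by rewrite p'I mulrBr mulr1 PE.
have up' : u * p' = v by rewrite uv -mulrA (mulrC _ p') p'E mulr1.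
have [M1 M10 M1P] := forelli_rudin_estimate n0 v1 v2.
have [M2 M20 M2P] := forelli_rudin_estimate n0 e1 e2.
exists (M1 `^ (p - 1) * M2); first by rewrite mulr_ge0 ?powR_ge0.
move=> F mF F0 Foo I.
pose N (z w : Cn) : R := normc (1 - inner z w).
(* Hoelder's inequality is applied to N^(-c(1-P)) rho^u times N^(-cP) rho^(b-u) F. [A] is the first
   factor raised to p' and integrated, which does not involve F; [D] is the second one raised to
   p. *)
pose A (z : Cn) := (\int[vball]_(w in B) (rho w `^ v * N z w `^ (- c))%:E)%E.
pose D (z : Cn) := (\int[vball]_(w in B) (N z w `^ (- c) * (rho w `^ t * F w `^ p))%:E)%E.
have A0 z : (0 <= A z)%E by apply: integral_ge0 => w _; rewrite lee_fin mulr_ge0 ?powR_ge0.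
have D0 z : (0 <= D z)%E by apply: integral_ge0 => w _; rewrite lee_fin !mulr_ge0 ?powR_ge0.
have I0 z : (0 <= I z)%E by apply: integral_ge0 => w _; rewrite lee_fin !mulr_ge0 ?powR_ge0.
have mN (z : Cn) := measurable_normc_1inner z.
have mNc z e' : measurable_fun setT (fun w => N z w `^ e').
  exact: (measurableT_comp (measurable_powR _) (mN z)).
have mFp e' : measurable_fun setT (fun w => F w `^ e').
  exact: (measurableT_comp (measurable_powR _)).
have IAD z : B z -> (I z <= A z `^ p'^-1 * D z `^ P)%E.
  move=> zB.
  have H := @ge0_hoelder _ _ R (@vball R n) B
    (fun w => N z w `^ (- c * (1 - P)) * rho w `^ u)
    (fun w => N z w `^ (- c * P) * (rho w `^ (b - u) * F w)) p' p mB.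
  have /H {}H : measurable_fun B (fun w => N z w `^ (- c * (1 - P)) * rho w `^ u).
    by apply: measurable_funTS; apply: measurable_funM => //; exact: measurable_rho_powR.
  have /H {}H : measurable_fun B (fun w => N z w `^ (- c * P) * (rho w `^ (b - u) * F w)).
    apply: measurable_funTS; apply: measurable_funM => //; apply: measurable_funM => //.
    exact: measurable_rho_powR.
  have {}H := H (fun=> mulr_ge0 (powR_ge0 _ _) (powR_ge0 _ _)).
  have {}H := H (fun w => mulr_ge0 (powR_ge0 _ _) (mulr_ge0 (powR_ge0 _ _) (F0 w))) p'0 p0.
  have {}H := H (etrans (congr1 (fun x => x + _) p'I) (subrK _ _)).
  apply: (le_trans (le_trans _ H)).
  - rewrite le_eqVlt; apply/orP; left; apply/eqP; apply: eq_integral => w; rewrite inE => wB.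
    have N0 : N z w != 0 by rewrite gt_eqF// normc_1inner_gt0.
    have r0 : rho w != 0 by rewrite gt_eqF// rho_gt0.
    congr EFin; rewrite -/(N z w).
    have -> : N z w `^ (- c) = N z w `^ (- c * (1 - P)) * N z w `^ (- c * P).
      by rewrite -powRD ?N0 ?implybT//; congr (_ `^ _); ring.
    have -> : rho w `^ b = rho w `^ u * rho w `^ (b - u).
      by rewrite -powRD ?r0 ?implybT//; congr (_ `^ _); ring.
    by ring.
  rewrite le_eqVlt; apply/orP; left; apply/eqP; congr (_ `^ _ * _ `^ _)%E.
  - apply: eq_integral => w _; congr EFin; rewrite powRM ?powR_ge0// -!powRrM up'.
    have -> : - c * (1 - P) * p' = - c by rewrite -mulrA (mulrC _ p') p'E mulr1.
    by rewrite mulrC.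
  - apply: eq_integral => w _; congr EFin.
    rewrite powRM ?mulr_ge0 ?powR_ge0// powRM ?powR_ge0// -!powRrM -tE'.
    by have -> : - c * P * p = - c by rewrite -mulrA (mulrC P) PE mulr1.
have AM z : B z -> (A z <= (M1 * rho z `^ (n%:R + 1 + v - c))%:E)%E by exact: M1P.
(* Finiteness at every z, not only almost everywhere, is part of boundedness. For fixed z it follows
   from N >= rho(z)/2 with c >= 0, and from t >= alpha. *)
have Dfin z : B z -> (D z < +oo)%E.
  move=> zB; apply: (@le_lt_trans _ _ (\int[vball]_(w in B) (((rho z / 2) `^ (- c))%:E * (F w `^ p * rho w `^ alpha)%:E))%E).
    apply: ge0_le_integral => //.
    - by move=> w _; rewrite lee_fin !mulr_ge0 ?powR_ge0.
    - apply/measurable_EFinP/measurable_funTS; apply: measurable_funM => //.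
      by apply: measurable_funM => //; exact: measurable_rho_powR.
    - apply: emeasurable_funM => //; apply/measurable_EFinP/measurable_funTS.
      by apply: measurable_funM => //; exact: measurable_rho_powR.
    move=> w wB; rewrite -EFinM lee_fin mulrC [F w `^ p * _]mulrC mulrC.
    have rz := rho_gt0 zB; have rw := rho_gt0 wB.
    apply: ler_pM; rewrite ?mulr_ge0 ?powR_ge0//.
      rewrite !powRN lef_pV2 ?posrE ?powR_gt0 ?divr_gt0 ?normc_1inner_gt0//.
      apply: ge0_ler_powR; rewrite ?nnegrE ?divr_ge0 ?normc_ge0 ?(ltW rz)//.
      exact: normc_1inner_ge.
    rewrite ler_wpM2r ?powR_ge0//; apply: ger_powR => //.
    by rewrite rw rho_le1.
  rewrite ge0_integralZl//; last 3 first.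
  - apply/measurable_EFinP/measurable_funTS; apply: measurable_funM => //; exact: measurable_rho_powR.
  - by move=> w _; rewrite lee_fin !mulr_ge0 ?powR_ge0.
  - by rewrite lee_fin powR_ge0.
  by apply: lte_mul_pinfty => //; rewrite lee_fin powR_ge0.
(* The estimate of [A] is raised to p/p' = p - 1; together with the factors rho^(pa) and rho^gamma
   it produces the exponent e. *)
have IpD z : B z -> (((rho z `^ a)%:E * I z) `^ p * (rho z `^ gamma)%:E <=
    (M1 `^ (p - 1))%:E * ((rho z `^ e)%:E * D z))%E.
  move=> zB; have rz := rho_gt0 zB.
  have rz0 : rho z != 0 by rewrite gt_eqF.
  have Ip : (I z `^ p <= ((M1 * rho z `^ (n%:R + 1 + v - c)) `^ (p - 1))%:E * D z)%E.
    apply: (@le_trans _ _ ((A z `^ p'^-1 * D z `^ P) `^ p)%E).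
      apply: gt0_ler_poweR; rewrite ?in_itv/= ?leey ?andbT ?(ltW p0)//; last exact: IAD.
      by rewrite mule_ge0 ?poweR_ge0.
    rewrite poweRM ?poweR_ge0// -!poweRrM (mulrC _ p) pp' (mulrC P) PE poweRe1//.
    apply: lee_wpmul2r => //; rewrite -poweR_EFin.
    apply: gt0_ler_poweR; rewrite ?in_itv/= ?leey ?andbT ?subr_ge0 ?(ltW p1)//; last exact: AM.
    by rewrite lee_fin mulr_ge0 ?powR_ge0.
  rewrite poweRM ?lee_fin ?powR_ge0// poweR_EFin -powRrM muleAC -EFinM -powRD ?rz0 ?implybT//.
  apply: le_trans (lee_wpmul2l _ Ip) _; first by rewrite lee_fin powR_ge0.
  rewrite !muleA -!EFinM; apply: lee_wpmul2r => //; rewrite lee_fin.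
  rewrite powRM ?powR_ge0// -powRrM mulrCA -powRD ?rz0 ?implybT//.
  by rewrite (mulrC a) -eE.
have mh : measurable_fun setT (fun x : Cn * Cn => (N x.1 x.2 `^ (- c) * (rho x.2 `^ t * F x.2 `^ p))%:E).
  apply/measurable_EFinP; apply: measurable_funM.
    exact: (measurableT_comp (measurable_powR _) measurable_pair_1inner).
  apply: measurable_funM; first exact: (measurable_snd_comp (measurable_rho_powR t)).
  exact: (measurable_snd_comp (mFp p)).
have mD : measurable_fun B D.
  by apply: (measurable_integral_ball mh) => x; rewrite lee_fin !mulr_ge0 ?powR_ge0.
have mI : measurable_fun B I.
  apply: (measurable_integral_ball (h := fun x => (rho x.2 `^ b * N x.1 x.2 `^ (- c) * F x.2)%:E)).
    apply/measurable_EFinP; apply: measurable_funM; last exact: (measurable_snd_comp mF).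
    apply: measurable_funM; first exact: (measurable_snd_comp (measurable_rho_powR b)).
    exact: (measurableT_comp (measurable_powR _) measurable_pair_1inner).
  by move=> x; rewrite lee_fin !mulr_ge0 ?powR_ge0.
have mr e' : measurable_fun B (fun z : Cn => (rho z `^ e')%:E).
  by apply/measurable_EFinP/measurable_funTS; exact: measurable_rho_powR.
split.
  move=> z zB; apply: le_lt_trans (IAD z zB) _.
  have Az : (A z < +oo)%E by apply: le_lt_trans (AM z zB) (ltry _).
  apply: lte_mul_pinfty; first exact: poweR_ge0.
    by apply: fin_num_poweR; rewrite ge0_fin_numE.
  exact/poweR_lty/Dfin.
apply: (@le_trans _ _ (\int[vball]_(z in B) ((M1 `^ (p - 1))%:E * ((rho z `^ e)%:E * D z)))%E).
  apply: ge0_le_integral => //.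
  - by move=> z _; rewrite mule_ge0 ?poweR_ge0 ?lee_fin ?powR_ge0.
  - apply: emeasurable_funM => //; apply: (measurableT_comp (measurable_poweR _)).
    exact: emeasurable_funM.
  - by apply: emeasurable_funM => //; exact: emeasurable_funM.
rewrite ge0_integralZl//; last 3 first.
- exact: emeasurable_funM.
- by move=> z _; rewrite mule_ge0 ?lee_fin ?powR_ge0.
- by rewrite lee_fin powR_ge0.
rewrite EFinM -muleA; apply: lee_wpmul2l; first by rewrite lee_fin powR_ge0.
have -> : (\int[vball]_(z in B) ((rho z `^ e)%:E * D z) =
  \int[vball]_(z in B) \int[vball]_(w in B) (rho z `^ e * (N z w `^ (- c) * (rho w `^ t * F w `^ p)))%:E)%E.
  apply: eq_integral => z zB; rewrite -ge0_integralZl//.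
  - apply/measurable_EFinP/measurable_funTS; apply: measurable_funM; first exact: mNc.
    by apply: measurable_funM; [exact: measurable_rho_powR|exact: mFp].
  - by move=> w _; rewrite lee_fin !mulr_ge0 ?powR_ge0.
  - by rewrite lee_fin powR_ge0.
(* After the exchange the integral in z is again of Forelli-Rudin type, with exponent e; it yields
   rho(w)^(n+1+e-c), which combines with rho(w)^t to rho(w)^alpha. *)
rewrite (tonelli_ball (h := fun x => (rho x.1 `^ e * (N x.1 x.2 `^ (- c) * (rho x.2 `^ t * F x.2 `^ p)))%:E)); last 2 first.
- apply/measurable_EFinP; apply: measurable_funM; last by exact/measurable_EFinP.
  exact: (measurable_fst_comp (measurable_rho_powR e)).
- by move=> x; rewrite lee_fin !mulr_ge0 ?powR_ge0.
rewrite -ge0_integralZl//; last 2 first.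
- apply/measurable_EFinP/measurable_funTS; apply: measurable_funM => //; exact: measurable_rho_powR.
- by move=> w _; rewrite lee_fin !mulr_ge0 ?powR_ge0.
apply: ge0_le_integral => //.
- by move=> w _; apply: integral_ge0 => z _; rewrite lee_fin !mulr_ge0 ?powR_ge0.
- apply: (measurable_integral_ball (h := fun x => (rho x.2 `^ e * (N x.2 x.1 `^ (- c) * (rho x.1 `^ t * F x.1 `^ p)))%:E)).
    apply/measurable_EFinP; apply: measurable_funM.
      exact: (measurable_snd_comp (measurable_rho_powR e)).
    apply: measurable_funM.
      apply: (measurableT_comp (measurable_powR _)).
      by apply: measurable_fun_normc; apply: measurable_csub => //; apply: measurable_inner.
    apply: measurable_funM; first exact: (measurable_fst_comp (measurable_rho_powR t)).
    exact: (measurable_fst_comp (mFp p)).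
  by move=> x; rewrite lee_fin !mulr_ge0 ?powR_ge0.
- apply: emeasurable_funM => //; apply/measurable_EFinP/measurable_funTS.
  by apply: measurable_funM => //; exact: measurable_rho_powR.
move=> w wB; have rw := rho_gt0 wB.
have -> : (\int[vball]_(z in B) (rho z `^ e * (N z w `^ (- c) * (rho w `^ t * F w `^ p)))%:E =
  (rho w `^ t * F w `^ p)%:E * \int[vball]_(z in B) (rho z `^ e * N w z `^ (- c))%:E)%E.
  rewrite -ge0_integralZl//.
  - apply: eq_integral => z _; rewrite -EFinM /N (normc_1inner_sym z w); congr EFin; ring.
  - apply/measurable_EFinP/measurable_funTS; apply: measurable_funM => //.
    exact: measurable_rho_powR.
  - by move=> z _; rewrite lee_fin mulr_ge0 ?powR_ge0.
  - by rewrite lee_fin mulr_ge0 ?powR_ge0.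
apply: le_trans (lee_wpmul2l _ (M2P w wB)) _; first by rewrite lee_fin mulr_ge0 ?powR_ge0.
rewrite -!EFinM lee_fin -tE powRD; last by rewrite (gt_eqF rw) implybT.
rewrite le_eqVlt; apply/orP; left; apply/eqP; ring.
Qed.

End schur.

(** * Sufficiency *)

Section sufficiency.
Variables (R : realType) (n : nat).
Local Notation C := R[i].
Local Notation Cn := (n.-tuple C).
Local Notation B := (@unit_ball R n).

Let mB : measurable B := @measurable_unit_ball R n.

Lemma vol_gt0 : (0 < n)%N -> 0 < vol R n.
Proof.
move=> n0; have n1 : 0 < n%:R :> R by rewrite ltr0n.
pose r : R := (4 * n%:R)^-1; have r0 : 0 < r by rewrite invr_gt0 mulr_gt0.
rewrite -lte_fin -volE; apply: (@lt_le_trans _ _ (lebesgueCn (polysquare (fun _ : 'I_n => 0 : C) r))).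
  by rewrite lebesgueCn_polysquare ?ltW// lte_fin !exprn_gt0// mulr_gt0.
apply: le_measure; rewrite ?inE//; first exact: measurable_polysquare.
move=> w wr; rewrite /unit_ball /= /normsq.
apply: (@le_lt_trans _ _ (\sum_(i < n) (2 * r) ^+ 2)).
  apply: ler_sum => i _; apply: lerXn2r; rewrite ?nnegrE ?normc_ge0 ?mulr_ge0 ?(ltW r0)//.
  by have := square_normc (wr i); rewrite subr0.
rewrite sumr_const card_ord -[ltLHS]mulr_natr.
rewrite (_ : _ * n%:R = (4 * n%:R)^-1); last by rewrite /r; field; rewrite gt_eqF.
have : 1 <= n%:R :> R by rewrite ler1n.
by rewrite invf_lt1 ?mulr_gt0//; lra.
Qed.

(** The norm of exponent +oo unfolds to an essential supremum only for a measure of positive total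
    mass. *)
Lemma vball_setT_gt0 : (0 < n)%N -> (0 < @vball R n setT)%E.
Proof.
move=> /vol_gt0 v0; rewrite vballE setTI volE -EFinM lte_fin.
by rewrite mulr_gt0// invr_gt0.
Qed.

Section operator.
Variables (K : Cn -> Cn -> C) (b c : R).
Hypothesis mK : measurable_fun setT (fun x : Cn * Cn => K x.1 x.2).
Hypothesis nK : forall z w, B z -> B w ->
  normc (K z w) = rho w `^ b * normc (1 - inner z w) `^ (- c).

Lemma measurable_kernel_mul f z : measurable_fun B f ->
  measurable_fun B (fun w => K z w * f w).
Proof.
move=> mf; apply: measurable_cmul => //; apply: measurable_funTS.
exact: (measurableT_comp mK (pair1_measurable z)).
Qed.

Lemma measurable_FR_op a f : measurable_fun B f -> measurable_fun B (FR_op a K f).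
Proof.
move=> mf.
(* f is measurable on the ball only, whereas joint measurability is argued on the whole product
   space; hence the extension by 0. *)
pose f' w := ((fun w => complex.Re (f w)) \_ B w) +i* ((fun w => complex.Im (f w)) \_ B w).
have mf' : measurable_fun setT f'.
  apply: measurable_complexP => //=.
  - by apply/(measurable_restrictT _ _).1 => //; exact: measurable_fun_Re.
  - by apply/(measurable_restrictT _ _).1 => //; exact: measurable_fun_Im.
have ff' w : B w -> f w = f' w.
  by move=> wB; rewrite /f' !patchE mem_set//; case: (f w).
have mh : measurable_fun setT (fun x : Cn * Cn => K x.1 x.2 * f' x.2).
  by apply: measurable_cmul => //; exact: (measurableT_comp mf').
have mRe := measurable_Rintegral_ball (measurable_fun_Re mh).
have mIm := measurable_Rintegral_ball (measurable_fun_Im mh).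
have mI := measurable_complexP (f := fun z => _ +i* _) mB mRe mIm.
have mr : measurable_fun B (fun z : Cn => ((1 - normsq z) `^ a)%:C).
  apply: measurable_complexP => //=.
  by apply: measurable_funTS; exact: measurable_rho_powR.
apply: eq_measurable_fun (measurable_cmul mB mr mI) => z zB /=.
rewrite /FR_op /cintegral; congr (_ * (_ +i* _)); apply: eq_Rintegral => w wB /=;
  by rewrite ff'//; move: wB; rewrite inE.
Qed.

Lemma FR_op_le a f z : measurable_fun B f -> B z ->
  ((normc (FR_op a K f z))%:E <= (rho z `^ a)%:E *
     (2%:E * \int[vball]_(w in B) (normc (K z w * f w))%:E))%E.
Proof.
move=> mf zB; rewrite /FR_op normcM normcR ger0_norm ?powR_ge0// EFinM.
apply: lee_wpmul2l; first by rewrite lee_fin powR_ge0.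
by apply: normc_cintegral_le => //; exact: measurable_kernel_mul.
Qed.

Lemma exists_between3 (L1 L2 L3 U : R) : L1 < U -> L2 < U -> L3 < U ->
  exists s, [/\ L1 < s, L2 < s, L3 < s & s < U].
Proof.
move=> h1 h2 h3; exists ((Num.max (Num.max L1 L2) L3 + U) / 2).
by have [?|?] := leP L1 L2; [have [?|?] := leP L2 L3|have [?|?] := leP L1 L3]; split; lra.
Qed.

Lemma FR_bounded_fin a (p alpha q beta : R) : (0 < n)%N -> 1 <= q -> q < p ->
  -1 < alpha -> -1 < beta -> - q * a < beta + 1 -> alpha + 1 < p * (b + 1) ->
  c < n%:R + 1 + a + b + (1 + beta) / q - (1 + alpha) / p ->
  FR_bounded a K p%:E alpha q%:E beta.
Proof.
move=> n0 q1 qp a1 b1 h1 h2 h3.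
have q0 : 0 < q by lra.
have p0 : 0 < p by lra.
(* [s] is the future (gamma + 1)/p. The bound -a < s is the first condition of the Schur test, 0 < s
   means gamma > -1, the third bound gives c <= c', and s < (1 + beta)/q is the condition of the
   inclusion. *)
have [s [s1 s2 s3 s4]] : exists s, [/\ - a < s, 0 < s,
    c - (n%:R + 1 + a + b) + (1 + alpha) / p < s & s < (1 + beta) / q].
  apply: exists_between3; last lra; last by rewrite divr_gt0//; lra.
  by rewrite ltr_pdivlMr// mulNr mulrC; lra.
pose gamma := s * p - 1.
have gE : (gamma + 1) / p = s by rewrite /gamma subrK mulfK// gt_eqF.
pose c' := n%:R + 1 + a + b + (gamma - alpha) / p.
have cc' : c <= c'.
  have -> : c' = n%:R + 1 + a + b + s - (1 + alpha) / p.
    by rewrite /c' -gE; field; rewrite gt_eqF.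
  by lra.
have ga : - p * a < gamma + 1.
  by rewrite /gamma subrK mulNr mulrC -mulNr ltr_pM2r.
have gb : (gamma + 1) / p < (beta + 1) / q by rewrite gE [beta + 1]addrC.
have [M M0 MP] := schur_estimate n0 (le_lt_trans q1 qp) ga h2 (erefl c').
have [M' M'0 MP'] := mass_inclusion n0 q0 qp gb.
(* The price of replacing c by c' >= c, since |1 - <z,w>| <= 2. *)
pose k : R := 2 `^ (c' - c); have k0 : 0 <= k by exact: powR_ge0.
have Kle z w : B z -> B w ->
    normc (K z w) <= k * (rho w `^ b * normc (1 - inner z w) `^ (- c')).
  move=> zB wB; have N0 := normc_1inner_gt0 zB wB.
  rewrite nK// mulrCA ler_wpM2l ?powR_ge0//.
  have -> : - c = (c' - c) + - c' by ring.
  rewrite powRD; last by rewrite (gt_eqF N0) implybT.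
  rewrite ler_wpM2r ?powR_ge0//; apply: ge0_ler_powR; rewrite ?nnegrE ?subr_ge0 ?(ltW N0)//.
  exact: normc_1inner_le2.
pose F (f : Cn -> C) := (fun w => normc (f w)) \_ B.
have mF f : measurable_fun B f -> measurable_fun setT (F f).
  by move=> mf; apply/(measurable_restrictT _ _).1 => //; exact: measurable_fun_normc.
have F0 f w : 0 <= F f w by rewrite /F patchE; case: ifP => _; rewrite ?normc_ge0.
have FB f w : B w -> F f w = normc (f w) by move=> wB; rewrite /F patchE mem_set.
have FM f : (\int[vball]_(w in B) (F f w `^ p * rho w `^ alpha)%:E = mass p alpha f)%E.
  by apply: eq_integral => w; rewrite inE => wB; rewrite FB.
pose I f (z : Cn) := (\int[vball]_(w in B) (rho w `^ b * normc (1 - inner z w) `^ (- c') * F f w)%:E)%E.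
have mIf f z : measurable_fun B f -> measurable_fun B
    (fun w => (rho w `^ b * normc (1 - inner z w) `^ (- c') * F f w)%:E).
  move=> mf; apply/measurable_EFinP/measurable_funTS; apply: measurable_funM; last exact: mF.
  apply: measurable_funM; first exact: measurable_rho_powR.
  exact: (measurableT_comp (measurable_powR _) (measurable_normc_1inner z)).
have I0 f z : (0 <= I f z)%E.
  by apply: integral_ge0 => w _; rewrite lee_fin !mulr_ge0 ?powR_ge0.
have KI f z : measurable_fun B f -> B z ->
    (\int[vball]_(w in B) (normc (K z w * f w))%:E <= k%:E * I f z)%E.
  move=> mf zB; rewrite -ge0_integralZl//; last 2 first.
  - exact: mIf.
  - by move=> w _; rewrite lee_fin !mulr_ge0 ?powR_ge0.
  apply: ge0_le_integral => //.
  - by move=> w _; rewrite lee_fin normc_ge0.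
  - by apply/measurable_EFinP/measurable_fun_normc; exact: measurable_kernel_mul.
  - by apply: emeasurable_funM => //; exact: mIf.
  move=> w wB; rewrite -EFinM lee_fin normcM FB// mulrA ler_wpM2r ?normc_ge0//.
  exact: Kle.
split.
  move=> f /(in_LpP f p0 a1)[mf fM] z zB; split; first exact: measurable_kernel_mul.
  apply: le_lt_trans (KI _ _ mf zB) _; apply: lte_mul_pinfty => //.
  move: fM; rewrite -FM => fM.
  by have [+ _] := MP (F f) (mF f mf) (F0 f) fM; exact.
have massT f : measurable_fun B f -> (mass p alpha f < +oo)%E ->
    (mass p gamma (FR_op a K f) <= ((2 * k) `^ p * M)%:E * mass p alpha f)%E.
  move=> mf fM.
  move: fM; rewrite -FM => fM; have [_ H] := MP (F f) (mF f mf) (F0 f) fM.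
  rewrite EFinM -muleA; apply: le_trans (lee_wpmul2l _ H); last first.
    by rewrite lee_fin powR_ge0.
  have mr e' : measurable_fun B (fun z : Cn => (rho z `^ e')%:E).
    by apply/measurable_EFinP/measurable_funTS; exact: measurable_rho_powR.
  have mI : measurable_fun B (I f).
    apply: (measurable_integral_ball (h := fun x => (rho x.2 `^ b * normc (1 - inner x.1 x.2) `^ (- c') * F f x.2)%:E)).
      apply/measurable_EFinP; apply: measurable_funM; last exact: (measurable_snd_comp (mF f mf)).
      apply: measurable_funM; first exact: (measurable_snd_comp (measurable_rho_powR b)).
      exact: (measurableT_comp (measurable_powR _) (@measurable_pair_1inner R n)).
    by move=> x; rewrite lee_fin !mulr_ge0 ?powR_ge0.
  have mRHS : measurable_fun B (fun z => (((rho z `^ a)%:E * I f z) `^ p * (rho z `^ gamma)%:E)%E).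
    apply: emeasurable_funM => //; apply: (measurableT_comp (measurable_poweR _)).
    exact: emeasurable_funM.
  rewrite -ge0_integralZl//; last 2 first.
  - by move=> z _; rewrite mule_ge0 ?poweR_ge0 ?lee_fin ?powR_ge0.
  - by rewrite lee_fin powR_ge0.
  apply: ge0_le_integral => //.
  - by move=> z _; rewrite lee_fin mulr_ge0 ?powR_ge0.
  - by apply/measurable_EFinP; apply: measurable_mass_fun; exact: measurable_FR_op.
  - exact: emeasurable_funM.
  move=> z zB; rewrite EFinM muleA; apply: lee_wpmul2r; first by rewrite lee_fin powR_ge0.
  have rI0 : (0 <= (rho z `^ a)%:E * I f z)%E.
    by apply: mule_ge0; [rewrite lee_fin powR_ge0|exact: I0].
  rewrite -!poweR_EFin -poweRM ?lee_fin ?mulr_ge0//.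
  apply: gt0_ler_poweR; rewrite ?in_itv/= ?leey ?andbT ?(ltW p0) ?lee_fin ?normc_ge0//.
    by apply: mule_ge0 => //; rewrite lee_fin mulr_ge0.
  apply: le_trans (FR_op_le a mf zB) _.
  rewrite [leRHS]muleCA; apply: lee_wpmul2l; first by rewrite lee_fin powR_ge0.
  by rewrite EFinM -muleA; apply: lee_wpmul2l => //; exact: KI.
exists ((weight_cst n beta * (M' * ((2 * k) `^ p * M) `^ (q / p))) `^ q^-1 / weight_cst n alpha `^ p^-1).
move=> f fLp; have [mf fM] := (in_LpP f p0 a1).1 fLp.
have mT := measurable_FR_op a mf.
have L : (Lpnorm q%:E beta (FR_op a K f) <= ((weight_cst n beta * (M' * ((2 * k) `^ p * M) `^ (q / p))) `^ q^-1
    / weight_cst n alpha `^ p^-1)%:E * Lpnorm p%:E alpha f)%E.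
  apply: Lpnorm_le => //; first by rewrite mulr_ge0 ?powR_ge0.
  apply: le_trans (MP' _ mT) _; rewrite EFinM -muleA; apply: lee_wpmul2l => //.
  rewrite -poweR_EFin -poweRM ?mass_ge0 ?lee_fin ?mulr_ge0 ?powR_ge0//.
  apply: gt0_ler_poweR; rewrite ?in_itv/= ?leey ?andbT ?mass_ge0 ?divr_ge0 ?(ltW p0) ?(ltW q0)//.
    by rewrite mule_ge0 ?mass_ge0 ?lee_fin ?mulr_ge0 ?powR_ge0.
  exact: massT.
split => //; split => //; apply: (le_lt_trans L).
by apply: lte_mul_pinfty; rewrite ?lee_fin ?divr_ge0 ?powR_ge0//; exact: fLp.2.
Qed.

Lemma Lpnorm_oo_mass (P alpha : R) (f : Cn -> C) : (0 < n)%N -> 0 < P ->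
  in_Lp +oo%E alpha f ->
  (mass P 0 f <= vball B * (Lpnorm +oo%E alpha f) `^ P)%E.
Proof.
move=> n0 P0 [mf]; rewrite /Lpnorm unlock vball_setT_gt0//; set g := _ \_ _; set N := ess_sup _ _ => Noo.
have N0 : (0 <= N)%E.
  apply: ess_sup_gee; first exact: vball_setT_gt0.
  by apply: aeW => x; exact: abse_ge0.
have Nf : N = (fine N)%:E by rewrite fineK// ge0_fin_numE.
rewrite Nf poweR_EFin muleC -integral_cst//.
apply: ae_ge0_le_integral => //.
- by move=> w _; rewrite lee_fin mulr_ge0 ?powR_ge0.
- by apply/measurable_EFinP; exact: measurable_mass_fun.
- by move=> w _; rewrite lee_fin powR_ge0.
have := ess_sup_ge (@vball R n) (abse \o g); rewrite -/N.
apply: filterS => w /= gN wB; rewrite powRr0 mulr1 lee_fin.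
apply: ge0_ler_powR; rewrite ?nnegrE ?normc_ge0 ?fine_ge0 ?(ltW P0)//.
by move: gN; rewrite /g patchE mem_set// [X in (_ <= X)%E]Nf /= lee_fin ger0_norm ?normc_ge0.
Qed.

Lemma FR_bounded_oo a (alpha q beta : R) : (0 < n)%N -> 1 <= q ->
  -1 < alpha -> -1 < beta -> - q * a < beta + 1 -> -1 < b ->
  c < n%:R + 1 + a + b + (beta + 1) / q ->
  FR_bounded a K +oo%E alpha q%:E beta.
Proof.
move=> n0 q1 a1 b1 h1 h2 h3; have q0 : 0 < q by lra.
(* With s = -1/P, the bounds are the second condition of (iii) for exponent P and weight 0, then q <
   P, then the third condition. All hold for large P because the conditions at infinity are
   strict. *)
have [s [s1 s2 s3 s4]] : exists s : R, [/\ - (b + 1) < s, - q^-1 < s,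
   - (n%:R + 1 + a + b + (beta + 1) / q - c) < s & s < 0].
  by apply: exists_between3; rewrite ?oppr_lt0 ?invr_gt0//; lra.
pose P := (- s)^-1.
have P0 : 0 < P by rewrite invr_gt0; lra.
have PI : P^-1 = - s by rewrite invrK.
have qP : q < P by rewrite -ltf_pV2 ?posrE// PI; lra.
have [Kint [M MP]] : FR_bounded a K P%:E 0 q%:E beta.
  apply: FR_bounded_fin => //.
  - by rewrite add0r -ltr_pdivrMl// mulr1 PI; lra.
  - by rewrite addr0 mul1r PI [1 + beta]addrC; lra.
pose V := fine (@vball R n B).
have VE : (@vball R n B = V%:E)%E by rewrite fineK// ge0_fin_numE ?vball_lty.
have V0 : 0 <= V by rewrite fine_ge0.
have a0 : -1 < (0 : R) by lra.
pose k := (weight_cst n 0 * V) `^ P^-1.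
have W0 := ltW (weight_cst_gt0 n a0).
have incl (f : Cn -> C) : in_Lp +oo%E alpha f -> in_Lp P%:E 0 f /\
    (Lpnorm P%:E 0 f <= k%:E * Lpnorm +oo%E alpha f)%E.
  move=> fL; have [mf foo] := fL.
  have N0 : (0 <= Lpnorm +oo alpha f)%E by rewrite /Lpnorm Lnorm_ge0.
  have L : (Lpnorm P%:E 0 f <= k%:E * Lpnorm +oo%E alpha f)%E.
    rewrite Lpnorm_mass//.
    apply: (@le_trans _ _ (((weight_cst n 0 * V)%:E * Lpnorm +oo alpha f `^ P) `^ P^-1)%E).
      apply: lee_poweR; first by rewrite invr_ge0 ltW.
        by apply: mule_ge0; [rewrite lee_fin|exact: mass_ge0].
      rewrite (EFinM (weight_cst n 0)) -muleA; apply: lee_wpmul2l; first by rewrite lee_fin.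
      by rewrite -VE; exact: Lpnorm_oo_mass.
    rewrite poweRM ?poweR_ge0 ?lee_fin//; last exact: mulr_ge0.
    by rewrite -poweRrM mulfV ?gt_eqF// poweRe1// poweR_EFin.
  split => //; split => //; apply: le_lt_trans L _.
  by apply: lte_mul_pinfty; rewrite ?lee_fin ?powR_ge0.
split; first by move=> f /incl[/Kint].
exists (Num.max M 0 * k) => f fL; have [fP fk] := incl f fL.
have [gL gM] := MP f fP; split => //; apply: (le_trans gM).
have m0 : 0 <= Num.max M 0 by rewrite le_max lexx orbT.
have mM : M <= Num.max M 0 by rewrite le_max lexx.
apply: (@le_trans _ _ ((Num.max M 0)%:E * Lpnorm P%:E 0 f)%E).
  by apply: lee_wpmul2r; [rewrite /Lpnorm Lnorm_ge0|rewrite lee_fin].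
have -> : ((Num.max M 0 * k)%:E * Lpnorm +oo alpha f =
    (Num.max M 0)%:E * (k%:E * Lpnorm +oo alpha f))%E by rewrite muleA -EFinM.
by apply: lee_wpmul2l; first by rewrite lee_fin.
Qed.

Lemma FR_condition_bounded a (alpha beta : R) (p : \bar R) (q : R) : (0 < n)%N ->
  -1 < alpha -> -1 < beta -> 1 <= q -> (q%:E < p)%E ->
  FR_condition n a b c alpha beta p q -> FR_bounded a K p alpha q%:E beta.
Proof.
move=> n0 a1 b1 q1; case: p => [p| |]//=; last by move=> _ []; exact: FR_bounded_oo.
by rewrite lte_fin => qp [] *; exact: FR_bounded_fin.
Qed.

End operator.
End sufficiency.

(** * Nonisotropic boxes *)

Section boxes.
Variable R : realType.
Local Notation C := R[i].

Lemma inner_self n (w : n.-tuple C) : inner w w = (normsq w)%:C.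
Proof.
rewrite /inner /normsq raddf_sum; apply: eq_bigr => i _ /=.
by rewrite sqr_normc; case: (tnth w i) => a b; simpc; congr Complex => /=; ring.
Qed.

Definition tsub n (w z : n.-tuple C) : n.-tuple C := [tuple tnth w i - tnth z i | i < n].

Lemma inner_expand n (z u w : n.-tuple C) : inner u w =
  inner z z + inner (tsub u z) z + (inner (tsub w z) z)^* + inner (tsub u z) (tsub w z).
Proof.
rewrite /inner raddf_sum -!big_split /=; apply: eq_bigr => i _; rewrite !tnth_mktuple.
case: (tnth u i) (tnth w i) (tnth z i) => a b [a' b'] [a'' b'']; simpc.
by congr Complex; ring.
Qed.

(** Expanding about z leaves -(<u-z,z> + conj <w-z,z> + <u-z,w-z>). So u - z must be of order d
    along z, but only of order sqrt d in norm: this dictates the shape of the boxes. *)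
Lemma normc_near n (z u w : n.-tuple C) (d e1 e2 : R) :
  normsq z = 1 - d -> normc (inner (tsub u z) z) <= e1 -> normc (inner (tsub w z) z) <= e1 ->
  normsq (tsub u z) <= e2 -> normsq (tsub w z) <= e2 ->
  normc (1 - inner u w - d%:C) <= 2 * e1 + e2.
Proof.
move=> zd u1 w1 u2 w2; rewrite (inner_expand z) inner_self zd.
set x := inner _ z; set y := inner (tsub w z) z; set t := inner _ (tsub w z).
rewrite (_ : _ - _ - _ = - (x + y^* + t)); last by rewrite raddfB /= rmorph1; ring.
rewrite normcN; apply: le_trans (le_normcD _ _) _; apply: lerD.
  apply: le_trans (le_normcD _ _) _; rewrite normc_conj; move: u1 w1; rewrite -/x -/y; lra.
by apply: le_trans (normc_inner_le _ _) _; lra.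
Qed.

Variable m : nat.
Local Notation Cn := (m.+1.-tuple C).

(* A box is sheared in its first coordinate, so that on it <w - z, z> is of the
   order of (ep * d) although |w - z| is of the order of (ep * sqrt d). *)
Definition shear (z w : Cn) : C := tnth w ord0 - tnth z ord0 +
  (\sum_(i < m) (tnth w (lift ord0 i) - tnth z (lift ord0 i)) * (tnth z (lift ord0 i))^*)
    / (tnth z ord0)^*.

Definition box (z : Cn) (r ep : R) : set Cn :=
  [set w | (forall i, square (tnth z (lift ord0 i)) (ep * r) (tnth w (lift ord0 i))) /\
           square 0 (ep * r ^+ 2) (shear z w)].

Lemma measurable_shear z : measurable_fun setT (shear z).
Proof.
rewrite (_ : shear z = fun w => tnth w ord0 - (tnth z ord0 -
  (\sum_(i < m) (tnth w (lift ord0 i) - tnth z (lift ord0 i)) * (tnth z (lift ord0 i))^*)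
    / (tnth z ord0)^*)); last by apply/funext => w; rewrite /shear opprB addrA; ring.
apply: measurable_csub => //; first exact: measurable_tnth.
apply: measurable_csub => //; apply: measurable_cmul => //; apply: measurable_csum => // i.
apply: measurable_cmul => //; apply: measurable_csub => //; exact: measurable_tnth.
Qed.

Lemma measurable_box z r ep : measurable (box z r ep).
Proof.
rewrite (_ : box z r ep = \bigcap_(i in [set: 'I_m])
     ((fun t : Cn => tnth t (lift ord0 i)) @^-1` square (tnth z (lift ord0 i)) (ep * r))
   `&` (shear z @^-1` square 0 (ep * r ^+ 2))).
  apply: measurableI.
    apply: fin_bigcap_measurable => // i _; rewrite -[X in measurable X]setTI.
    by apply: measurable_tnth => //; exact: measurable_square.
  rewrite -[X in measurable X]setTI; apply: measurable_shear => //.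
  exact: measurable_square.
by apply/seteqP; split => t [Pt Qt]; split => // i; [move=> _; exact: Pt|exact: (Pt i I)].
Qed.

Lemma square_shift (x c : C) r : square 0 r (x - c) <-> square c r x.
Proof. by case: x c => a b [a' b']; rewrite /square /= !subr0. Qed.

(** Once the other coordinates are fixed, the shear is a translation of the first one, so the box
    has the volume of a product of squares. *)
Lemma lebesgueCn_box z r ep : 0 <= r -> 0 <= ep ->
  lebesgueCn (box z r ep) =
    ((2 * (ep * r ^+ 2)) ^+ 2 * ((2 * (ep * r)) ^+ 2) ^+ m)%:E.
Proof.
move=> r0 ep0; rewrite lebesgueCn_cons EFinM.
rewrite -(lebesgueCn_polysquare (fun i => tnth z (lift ord0 i))) ?mulr_ge0//.
apply: product_measure_eq_ysection.
- apply: measurable_cons_set; exact: measurable_box.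
- exact: measurable_polysquare.
- by move=> x y [/= h _] i; have := h i; rewrite tnthS; exact.
move=> t tY; rewrite -(lebesgueC_square (tnth z ord0 -
  (\sum_(i < m) (tnth t i - tnth z (lift ord0 i)) * (tnth z (lift ord0 i))^*)
    / (tnth z ord0)^*)); last by rewrite mulr_ge0// exprn_ge0.
have E x : shear z [tuple of x :: t] = x - (tnth z ord0 -
  (\sum_(i < m) (tnth t i - tnth z (lift ord0 i)) * (tnth z (lift ord0 i))^*)
    / (tnth z ord0)^*).
  rewrite /shear (tnth_nth 0)/= opprB addrA addrAC; congr (_ + _ / _).
  by apply: eq_bigr => i _; rewrite tnthS.
congr (lebesgueC _); apply/seteqP; split => x.
  by move=> [/= _]; rewrite E => /square_shift.
move=> h; split; last by rewrite /= E; exact/square_shift.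
by move=> i /=; rewrite tnthS; exact: tY.
Qed.

(* The numerical constraints which make the boxes at the points [z] lie close to the
   hyperplane through [z], at distance [d = r ^+ 2] from the sphere. *)
Section box_geometry.
Variables (r ep : R) (z : Cn).
Hypotheses (r0 : 0 < r) (r1 : r <= 1) (ep0 : 0 < ep) (ep1 : ep <= 1).
Hypotheses (zr : normsq z = 1 - r ^+ 2) (z0 : 2^-1 <= normc (tnth z ord0)).

Let zB : unit_ball z.
Proof. by rewrite /unit_ball /= zr gtrBl exprn_gt0. Qed.

Lemma box_coord w i : box z r ep w ->
  normc (tnth (tsub w z) (lift ord0 i)) <= 2 * ep * r.
Proof. by move=> [h _]; rewrite tnth_mktuple -mulrA; exact: square_normc. Qed.

(** [shear z w] is <w - z, z> divided by the conjugate of the first coordinate of z, which is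
    bounded by 1. *)
Lemma box_inner w : box z r ep w -> normc (inner (tsub w z) z) <= 2 * ep * r ^+ 2.
Proof.
move=> [_ h].
have z00 : (tnth z ord0)^* != 0.
  by apply/eqP => /(congr1 (@normc R)); rewrite normc_conj normc0 => z00; move: z0; rewrite z00; lra.
have -> : inner (tsub w z) z = shear z w * (tnth z ord0)^*.
  rewrite /inner big_ord_recl /shear mulrDl divfK//; congr (_ + _).
    by rewrite tnth_mktuple.
  by apply: eq_bigr => i _; rewrite tnth_mktuple.
rewrite normcM normc_conj.
have := square_normc h; rewrite subr0 => h2.
have := normc_coord_lt1 ord0 zB => z1.
have := normc_ge0 (shear z w); nra.
Qed.

Lemma box_tail w : box z r ep w ->
  normc (\sum_(i < m) (tnth w (lift ord0 i) - tnth z (lift ord0 i)) * (tnth z (lift ord0 i))^*)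
    <= m%:R * (2 * ep * r).
Proof.
move=> wb; have hi i := box_coord i wb.
apply: le_trans (normc_sum _ _) _.
apply: (@le_trans _ _ (\sum_(i < m) (2 * ep * r))); last by rewrite sumr_const card_ord -[leLHS]mulr_natl.
apply: ler_sum => i _; rewrite normcM normc_conj.
have := hi i; rewrite tnth_mktuple; have := normc_coord_lt1 (lift ord0 i) zB.
have := normc_ge0 (tnth w (lift ord0 i) - tnth z (lift ord0 i)); nra.
Qed.

(** The first coordinate of w - z is the shear minus a tail sum over the conjugate of z_0. As |z_0|
    >= 1/2, it is at most 2 ep r + 4 m ep r; the other m coordinates contribute m (2 ep r)^2. *)
Lemma box_normsq w : box z r ep w ->
  normsq (tsub w z) <= ((4 * m%:R + 2) ^+ 2 + 4 * m%:R) * ep ^+ 2 * r ^+ 2.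
Proof.
move=> wb; have z00 : 0 < normc (tnth z ord0) by apply: lt_le_trans z0; rewrite invr_gt0.
have hi i := box_coord i wb.
have er0 : 0 <= ep * r by rewrite mulr_ge0 ?ltW.
have S1 := box_tail wb.
have h0 : normc (tnth (tsub w z) ord0) <= (4 * m%:R + 2) * (ep * r).
  have -> : tnth (tsub w z) ord0 = shear z w - (\sum_(i < m) (tnth w (lift ord0 i) - tnth z (lift ord0 i)) * (tnth z (lift ord0 i))^*) / (tnth z ord0)^*.
    by rewrite /shear addrK tnth_mktuple.
  apply: le_trans (le_normcD _ _) _; rewrite normcN normcM normcV normc_conj.
  have [_ h] := wb; have := square_normc h; rewrite subr0 => h2.
  have h3 : normc (shear z w) <= 2 * (ep * r).
    have rr : r ^+ 2 <= r by rewrite expr2 -[leRHS]mul1r ler_wpM2r// ltW.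
    by apply: (le_trans h2); rewrite ler_wpM2l// ler_wpM2l// ltW.
  have : normc (\sum_(i < m) (tnth w (lift ord0 i) - tnth z (lift ord0 i)) * (tnth z (lift ord0 i))^*) / normc (tnth z ord0)
     <= m%:R * (2 * ep * r) * 2.
    apply: ler_pM; rewrite ?normc_ge0 ?invr_ge0 ?normc_ge0//.
    by rewrite -[leRHS]invrK lef_pV2 ?posrE ?invr_gt0.
  by lra.
rewrite /normsq big_ord_recl.
have : \sum_(i < m) normc (tnth (tsub w z) (lift ord0 i)) ^+ 2 <= m%:R * (2 * ep * r) ^+ 2.
  apply: (@le_trans _ _ (\sum_(i < m) (2 * ep * r) ^+ 2)); last by rewrite sumr_const card_ord -[leLHS]mulr_natl.
  apply: ler_sum => i _; apply: lerXn2r; rewrite ?nnegrE ?normc_ge0//.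
  by rewrite -mulrA mulr_ge0.
have : normc (tnth (tsub w z) ord0) ^+ 2 <= ((4 * m%:R + 2) * (ep * r)) ^+ 2.
  apply: lerXn2r; rewrite ?nnegrE ?normc_ge0//.
  by apply: mulr_ge0 => //; apply: addr_ge0 => //; apply: mulr_ge0 => //; exact: ler0n.
rewrite !exprMn; lra.
Qed.

Lemma box_near (eta : R) u w : (4 + ((4 * m%:R + 2) ^+ 2 + 4 * m%:R)) * ep <= eta ->
  box z r ep u -> box z r ep w -> normc (1 - inner u w - (r ^+ 2)%:C) <= eta * r ^+ 2.
Proof.
move=> epeta ub wb.
apply: le_trans (normc_near zr (box_inner ub) (box_inner wb) (box_normsq ub) (box_normsq wb)) _.
have r20 : 0 <= r ^+ 2 by rewrite exprn_ge0// ltW.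
set M := _ ^+ 2 + _ in epeta *.
have M0 : 0 <= M by rewrite addr_ge0 ?sqr_ge0// mulr_ge0// ler0n.
have : 2 * (2 * ep) + M * ep ^+ 2 <= eta.
  apply: le_trans epeta; rewrite expr2 mulrDl; have : M * (ep * ep) <= M * ep.
    by rewrite ler_wpM2l// ler_piMr// ltW.
  lra.
by move=> h; have := ler_wpM2r r20 h; lra.
Qed.

End box_geometry.

End boxes.

Section box_family.
Variables (R : realType) (m : nat).
Local Notation C := R[i].
Local Notation Cn := (m.+1.-tuple C).

Lemma natr_dist_ge1 (a b : nat) : a != b -> 1 <= `|a%:R - b%:R : R|.
Proof.
by case: ltngtP => // ab _; [rewrite distrC|]; rewrite -natrB ?(ltnW ab)// ger0_norm ?ler0n// ler1n subn_gt0.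
Qed.

(** At a common point w the tail sum S is the same for both centers, so a - a' is a difference of
    shears plus a multiple of S (1/a - 1/a'), up to conjugation. The latter is at most |a - a'|/2
    and the former at most r^2/4, which contradicts |a - a'| >= r^2. *)
Lemma box_disjoint_first (z z' w : Cn) (r ep : R) : 0 < r -> r <= 1 -> 0 < ep ->
  16 * (m%:R + 1) * ep <= 1 -> unit_ball z ->
  (forall i, tnth z (lift ord0 i) = tnth z' (lift ord0 i)) ->
  2^-1 <= normc (tnth z ord0) -> 2^-1 <= normc (tnth z' ord0) ->
  r ^+ 2 <= normc (tnth z ord0 - tnth z' ord0) ->
  box z r ep w -> box z' r ep w -> False.
Proof.
move=> r0 r1 ep0 epm zB zz z0 z'0 D wb w'b.
have m0 := ler0n R m.
set S := \sum_(i < m) (tnth w (lift ord0 i) - tnth z (lift ord0 i)) * (tnth z (lift ord0 i))^*.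
have S1 : normc S <= m%:R * (2 * ep * r).
  apply: le_trans (normc_sum _ _) _.
  apply: (@le_trans _ _ (\sum_(i < m) (2 * ep * r))); last by rewrite sumr_const card_ord -[leLHS]mulr_natl.
  apply: ler_sum => i _; rewrite normcM normc_conj.
  have := box_coord i wb; rewrite tnth_mktuple; have := normc_coord_lt1 (lift ord0 i) zB.
  have := normc_ge0 (tnth w (lift ord0 i) - tnth z (lift ord0 i)); nra.
have S' : \sum_(i < m) (tnth w (lift ord0 i) - tnth z' (lift ord0 i)) * (tnth z' (lift ord0 i))^* = S.
  by apply: eq_bigr => i _; rewrite zz.
have [_ /square_normc] := wb; rewrite subr0 => h1.
have [_ /square_normc] := w'b; rewrite subr0 => h2.
set a := tnth z ord0; set a' := tnth z' ord0; rewrite -/a -/a' in z0 z'0 D.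
have na (x : C) : 2^-1 <= normc x -> x^* != 0.
  move=> x0; apply/eqP => /(congr1 (@normc R)); rewrite normc_conj normc0 => e; move: x0; rewrite e; lra.
have E : a - a' = shear z' w - shear z w + S * ((a^* - a'^*) / (a^* * a'^*)) * -1.
  rewrite /shear S' -/S -/a -/a'.
  by field; apply/andP; split; exact: na.
have cN : normc (a^* - a'^*) = normc (a - a').
  by case: (a) (a') => ? ? [? ?] /=; congr Num.sqrt; ring.
have nS : normc (S * ((a^* - a'^*) / (a^* * a'^*)) * -1) <= m%:R * (2 * ep * r) * (normc (a - a') * 4).
  rewrite mulrN1 normcN normcM; apply: ler_pM; rewrite ?normc_ge0//.
  rewrite normcM cN; apply: ler_wpM2l; first exact: normc_ge0.
  rewrite normcV normcM !normc_conj -[leRHS]invrK lef_pV2 ?posrE ?invr_gt0//; first nra.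
  by apply: mulr_gt0; [move: z0|move: z'0]; lra.
have T : normc (a - a') <= 4 * (ep * r ^+ 2) + m%:R * (2 * ep * r) * (normc (a - a') * 4).
  rewrite {1}E; apply: le_trans (le_normcD _ _) _; apply: lerD => //.
  by apply: le_trans (le_normcD _ _) _; rewrite normcN; lra.
move: T D; set d := normc _ => T D.
have r20 : 0 < r ^+ 2 by rewrite exprn_gt0.
have d0 : 0 < d by apply: lt_le_trans D.
have u1 : m%:R * (2 * ep * r) * (d * 4) <= 2^-1 * d.
  have -> : m%:R * (2 * ep * r) * (d * 4) = 8 * (m%:R * ep) * r * d by ring.
  rewrite ler_pM2r//.
  have e1 : 0 <= m%:R * ep by rewrite mulr_ge0// ltW.
  apply: (@le_trans _ _ (8 * (m%:R * ep))); last by lra.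
  by rewrite ler_piMr// mulr_ge0.
have u2 : ep * r ^+ 2 <= 16^-1 * r ^+ 2.
  rewrite ler_pM2r//.
  have e1 : 0 <= m%:R * ep by rewrite mulr_ge0// ltW.
  by lra.
lra.
Qed.

(** Grid for the sphere |z|^2 = 1 - r^2, of real dimension 2 m + 1: spacing r, hence 2^K values, for
    the real and imaginary parts of the m tail coordinates, and spacing r^2, hence 4^K values, for
    the imaginary part of the first coordinate. *)
Definition box_index (K : nat) : finType :=
  ({ffun 'I_m -> 'I_(2 ^ K) * 'I_(2 ^ K)} * 'I_(4 ^ K))%type.

Lemma card_box_index K : #|box_index K| = (4 ^ (K * m.+1))%N.
Proof.
rewrite card_prod card_ffun card_prod !card_ord.
have -> : (2 ^ K * 2 ^ K = 4 ^ K)%N by rewrite -expnMn.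
by rewrite -expnM -expnD mulnS addnC.
Qed.

(* A box of radius [r] lies at depth [r ^+ 2]; the shift by [m.+2] keeps the grid of
   centers close to the first coordinate axis, where the first coordinate is at least 1/2. *)
Definition box_radius (K : nat) : R := 2^-1 ^+ (K + m.+2).

Definition box_tail_coord (K : nat) (i : box_index K) (j : 'I_m) : C :=
  (box_radius K * (i.1 j).1%:R) +i* (box_radius K * (i.1 j).2%:R).

(** The real part [x] is not on a grid: it is the value that puts the center at depth exactly
    [box_radius K ^+ 2]. *)
Definition box_center (K : nat) (i : box_index K) : Cn :=
  let y := box_radius K ^+ 2 * i.2%:R in
  let x := Num.sqrt (1 - box_radius K ^+ 2
     - \sum_(j < m) normc (box_tail_coord i j) ^+ 2 - y ^+ 2) in
  [tuple of (x +i* y) :: [tuple box_tail_coord i j | j < m]].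

(** The radius at K = 0 bounds the tail coordinates of all grids, and its square bounds [y]. By
    [kap_small] the radicand in [box_center] stays above 1/2. *)
Let kap : R := 2^-1 ^+ m.+2.

Let kap0 : 0 < kap. Proof. by rewrite exprn_gt0. Qed.

Let kap_small : kap ^+ 2 * (2 * m%:R + 2) <= 2^-1.
Proof.
rewrite /kap -exprM mulnC exprM.
have -> : (2^-1 : R) ^+ 2 = 4^-1 by field.
rewrite exprVn mulrC ler_pdivrMr ?exprn_gt0//.
have : m.+1%:R <= 4 ^+ m.+1 :> R.
  by rewrite -natrX ler_nat ltnW// ltn_expl.
rewrite [4 ^+ m.+2]exprS -natr1; lra.
Qed.

Let kap1 : kap <= 1.
Proof. by rewrite /kap exprn_ile1//; lra. Qed.

Lemma box_radius_gt0 K : 0 < box_radius K.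
Proof. by rewrite exprn_gt0. Qed.

Let radius_kap K : box_radius K * 2 ^+ K = kap.
Proof. by rewrite /box_radius exprD mulrAC -exprMn mulVf// expr1n mul1r. Qed.

Let radius_le K : box_radius K <= kap.
Proof.
rewrite -(radius_kap K) ler_peMr ?(ltW (box_radius_gt0 K))//.
by rewrite exprn_ege1// ler1n.
Qed.

Lemma box_radius_le1 K : box_radius K <= 1.
Proof. exact: le_trans (radius_le K) kap1. Qed.

Section center.
Variables (K : nat) (i : box_index K).
Let r := box_radius K.
Let y := r ^+ 2 * i.2%:R.
Let S := \sum_(j < m) normc (box_tail_coord i j) ^+ 2.

Let coord_le (a : 'I_(2 ^ K)) : 0 <= r * a%:R <= kap.
Proof.
apply/andP; split; first by rewrite mulr_ge0// ltW// box_radius_gt0.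
rewrite -(radius_kap K) ler_pM2l ?box_radius_gt0// -natrX ler_nat ltnW//.
Qed.

Let y_le : 0 <= y <= kap ^+ 2.
Proof.
apply/andP; split; first by rewrite mulr_ge0// exprn_ge0// ltW// box_radius_gt0.
rewrite -(radius_kap K) exprMn ler_pM2l ?exprn_gt0 ?box_radius_gt0//.
by rewrite -exprM mulnC exprM -!natrX ler_nat ltnW.
Qed.

Let S_le : 0 <= S <= m%:R * (2 * kap ^+ 2).
Proof.
apply/andP; split; first by apply: sumr_ge0 => j _; exact: sqr_ge0.
apply: (@le_trans _ _ (\sum_(j < m) (2 * kap ^+ 2))); last by rewrite sumr_const card_ord -[leLHS]mulr_natl.
apply: ler_sum => j _; rewrite sqr_normc /=.
have /andP[a0 a1] := coord_le (i.1 j).1; have /andP[b0 b1] := coord_le (i.1 j).2.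
have u1 : (r * (i.1 j).1%:R) ^+ 2 <= kap ^+ 2 by apply: lerXn2r; rewrite ?nnegrE// ltW.
have u2 : (r * (i.1 j).2%:R) ^+ 2 <= kap ^+ 2 by apply: lerXn2r; rewrite ?nnegrE// ltW.
by move: u1 u2; rewrite /r; lra.
Qed.

Let inside : 2^-1 <= 1 - r ^+ 2 - S - y ^+ 2.
Proof.
have /andP[y0 y1] := y_le; have /andP[S0 S1] := S_le.
have r2 : r ^+ 2 <= kap ^+ 2.
  by apply: lerXn2r; rewrite ?nnegrE ?(ltW (box_radius_gt0 K)) ?(ltW kap0)//; exact: radius_le.
have k2 : 0 <= kap ^+ 2 <= 1 by rewrite exprn_ge0 ?(ltW kap0)//= exprn_ile1// ltW.
have y2 : y ^+ 2 <= kap ^+ 2.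
  by case/andP: k2 => k20 k21; nra.
have := kap_small; lra.
Qed.

Lemma box_center_ord0 : tnth (box_center i) ord0 = Num.sqrt (1 - r ^+ 2 - S - y ^+ 2) +i* y.
Proof. by rewrite (tnth_nth 0). Qed.

Lemma box_center_lift j : tnth (box_center i) (lift ord0 j) = box_tail_coord i j.
Proof. by rewrite tnthS tnth_mktuple. Qed.

Lemma box_center_normsq : normsq (box_center i) = 1 - r ^+ 2.
Proof.
rewrite /normsq big_ord_recl box_center_ord0 sqr_normc /= sqr_sqrtr; last first.
  by apply: le_trans inside; lra.
under eq_bigr do rewrite box_center_lift.
rewrite -/S; ring.
Qed.

Lemma box_center_first : 2^-1 <= normc (tnth (box_center i) ord0).
Proof.
rewrite -ler_sqr ?nnegrE ?normc_ge0 ?invr_ge0//.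
rewrite box_center_ord0 sqr_normc /= sqr_sqrtr; last first.
  by apply: le_trans inside; lra.
by have := inside; have := sqr_ge0 y; lra.
Qed.

Lemma box_center_ball : unit_ball (box_center i).
Proof. by rewrite /unit_ball /= box_center_normsq gtrBl exprn_gt0// box_radius_gt0. Qed.

End center.

(** The tail coordinates are separated first: their spacing r exceeds the side 2 ep r. For equal
    tails, centers with different second index are r^2 apart in the first coordinate. *)
Lemma box_disjoint K (ep : R) (i j : box_index K) w : 0 < ep -> 16 * (m%:R + 1) * ep <= 1 ->
  box (box_center i) (box_radius K) ep w -> box (box_center j) (box_radius K) ep w -> i = j.
Proof.
move=> ep0 epm wi wj; have r0 := box_radius_gt0 K.
have m0 := ler0n R m.
have ep2 : 2 * ep < 1.
  have e1 : 0 <= m%:R * ep by rewrite mulr_ge0// ltW.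
  by lra.
have dist (x a b : R) : `|x - a| <= ep * box_radius K -> `|x - b| <= ep * box_radius K ->
    `|a - b| < box_radius K.
  move=> xa xb; apply: (@le_lt_trans _ _ (2 * ep * box_radius K)); last first.
    by rewrite gtr_pMl.
  have -> : a - b = (x - b) - (x - a) by ring.
  by apply: le_trans (ler_normB _ _) _; lra.
have natE (x : R) (a b : nat) : `|x - box_radius K * a%:R| <= ep * box_radius K ->
    `|x - box_radius K * b%:R| <= ep * box_radius K -> a = b.
  move=> xa xb; apply/eqP; apply: contraT => /natr_dist_ge1 ab.
  have := dist _ _ _ xa xb; rewrite -mulrBr normrM gtr0_norm//.
  by rewrite ltNge ler_peMr// ltW.
have ff : i.1 = j.1.
  apply/ffunP => k; have [h _] := wi; have [h' _] := wj.
  have [a1 a2] := h k; have [b1 b2] := h' k.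
  rewrite box_center_lift /= in a1 a2; rewrite box_center_lift /= in b1 b2.
  have := natE _ _ _ a1 b1; have := natE _ _ _ a2 b2.
  by case: (i.1 k) (j.1 k) => ? ? [? ?] /= e1 e2; congr pair; exact: val_inj.
suff l : i.2 = j.2 by case: i j ff l {wi wj} => ? ? [? ?] /= -> ->.
apply/val_inj/eqP; apply: contraT => /natr_dist_ge1 ij; exfalso.
apply: (@box_disjoint_first (box_center i) (box_center j) w (box_radius K) ep) => //.
- exact: box_radius_le1.
- exact: box_center_ball.
- by move=> k; rewrite !box_center_lift /box_tail_coord ff.
- exact: box_center_first.
- exact: box_center_first.
apply: le_trans (normr_Im_le_normc _); rewrite !box_center_ord0 /= -mulrBr normrM.
by rewrite ger0_norm ?exprn_ge0 ?(ltW r0)// ler_peMr// exprn_ge0// ltW.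
Qed.

End box_family.

(** * Test functions *)

Lemma Lpnorm_oo_le1 (R : realType) n alpha (f : n.-tuple R[i] -> R[i]) : (0 < n)%N ->
  (forall w, normc (f w) <= 1) -> (Lpnorm +oo%E alpha f <= 1%:E)%E.
Proof.
move=> n0 f1.
have f1' w : (`|((fun z => (normc (f z))%:E) \_ unit_ball) w| <= 1%:E)%E.
  rewrite patchE; case: ifP => _; last by rewrite abse0 lee_fin.
  by rewrite lee_fin ger0_norm ?normc_ge0.
by rewrite /Lpnorm unlock vball_setT_gt0//; apply/ess_supP; apply: aeW.
Qed.

Section test_functions.
Variables (R : realType) (m : nat) (ep eta : R).
Local Notation C := R[i].
Local Notation Cn := (m.+1.-tuple C).
Local Notation B := (@unit_ball R m.+1).
Hypotheses (ep0 : 0 < ep) (ep_m : 16 * (m%:R + 1) * ep <= 1)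
  (ep_eta : (4 + ((4 * m%:R + 2) ^+ 2 + 4 * m%:R)) * ep <= eta)
  (eta0 : 0 < eta) (eta_half : eta <= 2^-1).

Let mB : measurable B := @measurable_unit_ball R m.+1.

Lemma powR_near (x d e : R) : 0 < d -> d / 2 <= x <= 2 * d ->
  2 `^ (- `|e|) * d `^ e <= x `^ e <= 2 `^ `|e| * d `^ e.
Proof.
move=> d0 /andP[x1 x2].
have x0 : 0 < x by apply: lt_le_trans x1; rewrite divr_gt0.
have pos e' : 0 <= e' -> 2 `^ (- e') * d `^ e' <= x `^ e' <= 2 `^ e' * d `^ e'.
  move=> e0; apply/andP; split.
    have -> : 2 `^ (- e') * d `^ e' = (d / 2) `^ e'.
      by rewrite powRM ?invr_ge0 ?(ltW d0)// -powR_inv1// -powRrM mulN1r mulrC.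
    by apply: ge0_ler_powR; rewrite ?nnegrE ?divr_ge0 ?(ltW d0) ?(ltW x0).
  rewrite -powRM ?(ltW d0)//.
  by apply: ge0_ler_powR; rewrite ?nnegrE ?mulr_ge0 ?(ltW d0) ?(ltW x0).
have [e0|e0] := leP 0 e; first by rewrite ger0_norm//; exact: pos.
rewrite ltr0_norm//; have /pos/andP[h1 h2] : 0 <= - e by lra.
have d0' : 0 < d `^ (- e) by rewrite powR_gt0.
have x0' : 0 < x `^ (- e) by rewrite powR_gt0.
have t0' : 0 < 2 `^ (- e) :> R by rewrite powR_gt0.
have -> : d `^ e = (d `^ (- e))^-1 by rewrite -powRN opprK.
have -> : x `^ e = (x `^ (- e))^-1 by rewrite -powRN opprK.
rewrite opprK; move: h1 h2; rewrite opprK.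
have -> : (2 : R) `^ e = (2 `^ (- e))^-1 by rewrite -powRN opprK.
move: (d `^ _) (x `^ _) (2 `^ _) d0' x0' t0' => D X T D0 X0 T0 h1 h2.
apply/andP; split.
  by rewrite -invfM lef_pV2 ?posrE ?mulr_gt0.
rewrite -[leRHS]invrK invfM invrK lef_pV2 ?posrE ?mulr_gt0 ?invr_gt0//.
Qed.

Definition depth (k : nat) : R := box_radius R m k ^+ 2.

Lemma depth_gt0 k : 0 < depth k.
Proof. by rewrite exprn_gt0// box_radius_gt0. Qed.

Lemma depth_le1 k : depth k <= 1.
Proof. by rewrite exprn_ile1 ?box_radius_le1// ltW// box_radius_gt0. Qed.

Lemma depthE k : depth k * 4 ^+ k = depth 0.
Proof.
have e4 : (2^-1 : R) ^+ 2 * 4 = 1 by field.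
rewrite /depth /box_radius add0n exprD exprMn mulrAC.
by rewrite -(exprM _ k) mulnC exprM -exprMn e4 expr1n mul1r.
Qed.

Lemma depth_lt k l : (k < l)%N -> 4 * depth l <= depth k.
Proof.
move=> kl; have := depthE k; rewrite -(depthE l) -(subnKC kl) exprD exprS.
set u := 4 ^+ k; have u0 : 0 < u by rewrite exprn_gt0.
move=> E; have {E} : depth k = 4 * depth (k.+1 + (l - k.+1)) * 4 ^+ (l - k.+1).
  apply: (@mulIf _ u); first by rewrite gt_eqF.
  by rewrite E; ring.
move=> ->; apply: ler_peMr; first by rewrite mulr_ge0 ?(ltW (depth_gt0 _)).
by apply: exprn_ege1; rewrite ler1n.
Qed.

Definition box_idx (N : nat) : finType := {k : 'I_N & box_index m k}.

Definition boxes N (x : box_idx N) : set Cn :=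
  box (box_center R (tagged x)) (box_radius R m (tag x)) ep.

Section one_box.
Variables (N : nat) (x : box_idx N).
Let d := depth (tag x).

Lemma measurable_boxes : measurable (boxes x).
Proof. exact: measurable_box. Qed.

Lemma boxes_near u w : boxes x u -> boxes x w ->
  normc (1 - inner u w - d%:C) <= eta * d.
Proof.
move=> xu xw; apply: (box_near _ _ _ _ _ _ ep_eta xu xw).
- exact: box_radius_gt0.
- exact: box_radius_le1.
- by [].
- have := ler0n R m; have : 0 <= m%:R * ep by rewrite mulr_ge0 ?ler0n// ltW.
  by move: ep_m; lra.
- exact: box_center_normsq.
- exact: box_center_first.
Qed.

(** The upper constant has to be below 2: depths of successive shells have ratio 4, so the next
    shell above starts at 2 d, and a bound 2 d would not separate the two. *)
Lemma boxes_rho w : boxes x w -> d / 2 <= rho w <= 3 / 2 * d.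
Proof.
move=> xw; have := boxes_near xw xw; rewrite inner_self => h.
have := le_trans (normr_Re_le_normc _) h.
rewrite !ReB /= -/(rho w) ler_norml.
have h2 : eta * d <= 2^-1 * d by rewrite ler_pM2r// depth_gt0.
by move=> /andP[]; lra.
Qed.

Lemma boxes_rho2 w : boxes x w -> d / 2 <= rho w <= 2 * d.
Proof.
move=> /boxes_rho /andP[-> h]; apply: (le_trans h); have := depth_gt0 (tag x).
by rewrite -/d; lra.
Qed.

Lemma boxes_ball w : boxes x w -> B w.
Proof.
move=> /boxes_rho /andP[h _]; rewrite /unit_ball/= -subr_gt0.
by apply: lt_le_trans h; rewrite divr_gt0// depth_gt0.
Qed.

Definition box_cst : R := (vol R m.+1)^-1 * (2 * ep) ^+ (2 * m.+1).

Lemma vball_boxes : vball (boxes x) = (box_cst * d ^+ m.+2)%:E.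
Proof.
rewrite vballE setIidl; last by move=> w; exact: boxes_ball.
rewrite lebesgueCn_box ?(ltW ep0) ?(ltW (box_radius_gt0 R m _))//.
rewrite -EFinM /box_cst -[in RHS]mulrA; congr EFin; congr (_ * _).
rewrite /d /depth; set r := box_radius _ _ _.
have -> : (2 * (ep * r)) ^+ 2 = (2 * ep) ^+ 2 * r ^+ 2 by ring.
have -> : (2 * (ep * r ^+ 2)) ^+ 2 = (2 * ep) ^+ 2 * (r ^+ 2) ^+ 2 by ring.
rewrite exprM; move: ((2 * ep) ^+ 2) (r ^+ 2) => E D.
by rewrite exprMn !exprS expr0; ring.
Qed.

Lemma integral_boxes_rho (e : R) :
  ((2 `^ (- `|e|) * d `^ e * (box_cst * d ^+ m.+2))%:E <= \int[vball]_(w in boxes x) (rho w `^ e)%:E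
     <= (2 `^ `|e| * d `^ e * (box_cst * d ^+ m.+2))%:E)%E.
Proof.
have mP := measurable_boxes.
have mr : measurable_fun (boxes x) (fun w : Cn => (rho w `^ e)%:E).
  by apply/measurable_EFinP/measurable_funTS; exact: measurable_rho_powR.
rewrite !(EFinM _ (box_cst * _)) -vball_boxes -!integral_cst//.
apply/andP; split; apply: ge0_le_integral => //.
- by move=> w _; rewrite lee_fin mulr_ge0 ?powR_ge0.
- by move=> w /boxes_rho2/(powR_near e (depth_gt0 _))/andP[].
- by move=> w _; rewrite lee_fin powR_ge0.
- by move=> w /boxes_rho2/(powR_near e (depth_gt0 _))/andP[].
Qed.

End one_box.

Lemma boxes_disjoint N (x y : box_idx N) w : boxes x w -> boxes y w -> x = y.
Proof.
move=> xw yw; have [xy|xy] := eqVneq (tag x) (tag y).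
  case: x y xy xw yw => [k i] [l j] /= kl; subst l => xw yw.
  by congr Tagged; exact: (box_disjoint ep0 ep_m xw yw).
exfalso; have /andP[x1 x2] := boxes_rho xw; have /andP[y1 y2] := boxes_rho yw.
have dx := depth_gt0 (tag x); have dy := depth_gt0 (tag y).
case: (ltngtP (tag x) (tag y)) => [| |e]; last by move/eqP: xy; apply; exact: val_inj.
  by move=> /depth_lt; lra.
by move=> /depth_lt; lra.
Qed.

(** Shell k has 4^(k(m+1)) = (depth 0 / depth k)^(m+1) boxes. Multiplied by the volume factor
    depth^(m+2), this leaves a single power of the depth. *)
Lemma sum_box_idx N (F : nat -> R) :
  \sum_(x : box_idx N) F (tag x) * depth (tag x) ^+ m.+2 =
  depth 0 ^+ m.+1 * \sum_(k < N) F k * depth k.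
Proof.
have := @sig_big_dep R 0 +%R 'I_N (fun k => box_index m k) xpredT (fun _ => xpredT)
  (fun k _ => F k * depth k ^+ m.+2).
move=> /= <-; rewrite mulr_sumr; apply: eq_bigr => k _.
rewrite sumr_const card_box_index -[LHS]mulr_natl natrX (exprM _ k) -(depthE k).
move: (depth k) (4 ^+ k) => d q; rewrite exprMn (exprS d).
by move: (d ^+ m.+1) (q ^+ m.+1) => x y; ring.
Qed.

Definition test_fun N (tau : R) (s : box_idx N -> R) (w : Cn) : C :=
  (\sum_x s x * depth (tag x) `^ (- tau) * \1_(boxes x) w)%:C.

Lemma test_funE N tau (s : box_idx N -> R) x w : boxes x w ->
  test_fun tau s w = (s x * depth (tag x) `^ (- tau))%:C.
Proof.
move=> xw; rewrite /test_fun (bigD1 x)//= indicE mem_set// mulr1 big1 ?addr0// => y yx.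
rewrite indicE memNset ?mulr0// => yw; move/eqP: yx; apply.
exact: boxes_disjoint yw xw.
Qed.

Lemma test_fun0 N tau (s : box_idx N -> R) w : (forall x : box_idx N, ~ boxes x w) ->
  test_fun tau s w = 0.
Proof.
move=> h; rewrite /test_fun big1// => x _.
by rewrite indicE memNset ?mulr0.
Qed.

Lemma measurable_test_fun N tau (s : box_idx N -> R) : measurable_fun setT (test_fun tau s).
Proof.
apply: measurable_complexP => //=.
apply: measurable_sum => x; apply: measurable_funM => //.
by apply: measurable_indic; exact: measurable_boxes.
Qed.

(** Height, weight and total volume of a shell multiply to depth^(-(1+alpha)) depth^alpha depth = 1,
    so each of the N shells contributes the same amount. *)
Lemma test_fun_mass N (alpha p : R) (s : box_idx N -> R) : 0 < p ->
  (forall x, `|s x| <= 1) ->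
  (mass p alpha (test_fun ((1 + alpha) / p) s) <=
    (2 `^ `|alpha| * box_cst * depth 0 ^+ m.+1 * N%:R)%:E)%E.
Proof.
move=> p0 s1; set tau := (1 + alpha) / p.
have mP (x : box_idx N) := measurable_boxes x.
pose l (x : box_idx N) := depth (tag x) `^ (- (1 + alpha)).
apply: (@le_trans _ _ (\int[vball]_(w in B) (\sum_(x : box_idx N) (l x * (rho w `^ alpha * \1_(boxes x) w))%:E))%E).
  apply: ge0_le_integral => //.
  - by move=> w _; rewrite lee_fin mulr_ge0 ?powR_ge0.
  - apply/measurable_EFinP; apply: measurable_mass_fun.
    by apply: measurable_funTS; exact: measurable_test_fun.
  - apply: emeasurable_sum => x; apply/measurable_EFinP/measurable_funTS.
    apply: measurable_funM => //; apply: measurable_funM; first exact: measurable_rho_powR.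
    exact: measurable_indic.
  move=> w _; rewrite sumEFin lee_fin.
  have [[x xw]|h] := pselect (exists x : box_idx N, boxes x w); last first.
    rewrite test_fun0; last by move=> x xw; apply: h; exists x.
    by rewrite normc0 powR0 ?gt_eqF// mul0r sumr_ge0// => x _; rewrite !mulr_ge0 ?powR_ge0.
  rewrite (test_funE _ _ xw) normcR (bigD1 x)//= indicE mem_set// mulr1.
  rewrite -[leLHS]addr0; apply: lerD; last first.
    by apply: sumr_ge0 => y _; rewrite !mulr_ge0 ?powR_ge0.
  rewrite ler_wpM2r ?powR_ge0//; rewrite normrM powRM// (ger0_norm (powR_ge0 _ _)).
  rewrite -[leRHS]mul1r ler_pM ?powR_ge0//.
    apply: (@le_trans _ _ (1 `^ p)); last by rewrite powR1.
    by apply: ge0_ler_powR; rewrite ?nnegrE// ltW.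
  by rewrite -powRrM /tau mulNr divfK ?gt_eqF.
rewrite ge0_integral_sum//; last 2 first.
- move=> x; apply/measurable_EFinP/measurable_funTS.
  apply: measurable_funM => //; apply: measurable_funM; first exact: measurable_rho_powR.
  exact: measurable_indic.
- by move=> x w _; rewrite lee_fin !mulr_ge0 ?powR_ge0.
have cst0 : 0 <= box_cst by rewrite mulr_ge0 ?invr_ge0 ?vol_ge0 ?exprn_ge0// mulr_ge0// ltW.
apply: (@le_trans _ _ (\sum_(x : box_idx N) (2 `^ `|alpha| * box_cst * depth (tag x) `^ (- 1) * depth (tag x) ^+ m.+2)%:E)%E).
  apply: lee_sum => x _; under eq_integral do rewrite EFinM.
  rewrite ge0_integralZl//; last 3 first.
  - apply/measurable_EFinP/measurable_funTS; apply: measurable_funM; first exact: measurable_rho_powR.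
    exact: measurable_indic.
  - by move=> w _; rewrite lee_fin mulr_ge0 ?powR_ge0.
  - by rewrite lee_fin powR_ge0.
  have -> : (\int[vball]_(w in B) (rho w `^ alpha * \1_(boxes x) w)%:E = \int[vball]_(w in boxes x) (rho w `^ alpha)%:E)%E.
    rewrite -[in RHS](_ : B `&` boxes x = boxes x); last by apply: setIidr => w; exact: boxes_ball.
    rewrite [RHS]integral_mkcondr; apply: eq_integral => w wB.
    by rewrite patchE indicE; case: ifP => _; rewrite ?mulr1 ?mulr0.
  have /andP[_ h] := integral_boxes_rho x alpha.
  apply: (le_trans (lee_wpmul2l _ h)); first by rewrite lee_fin powR_ge0.
  rewrite -EFinM lee_fin /l le_eqVlt; apply/orP; left; apply/eqP.
  set d := depth _; have d0 : 0 < d by exact: depth_gt0.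
  have -> : d `^ (-1) = d `^ (- (1 + alpha)) * d `^ alpha.
    by rewrite -powRD ?(gt_eqF d0) ?implybT//; congr (_ `^ _); ring.
  by ring.
rewrite sumEFin lee_fin (sum_box_idx N (fun k => 2 `^ `|alpha| * box_cst * depth k `^ (- 1))).
rewrite le_eqVlt; apply/orP; left; apply/eqP.
rewrite (eq_bigr (fun=> 2 `^ `|alpha| * box_cst)); last first.
  move=> k _; rewrite -[LHS]mulrA powR_inv1 ?(ltW (depth_gt0 _))// mulVf ?mulr1//.
  by rewrite gt_eqF// depth_gt0.
rewrite sumr_const card_ord -[X in _ * X]mulr_natr; move: (2 `^ _) (depth 0 ^+ _) => x y; ring.
Qed.

(** [tau_of] and [theta_of] stand for (1 + alpha)/p and 1/p with the convention 1/oo = 0; they treat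
    finite and infinite p at once. *)
Definition tau_of (p : \bar R) (alpha : R) : R :=
  if p is r%:E then (1 + alpha) / r else 0.

Definition theta_of (p : \bar R) : R := if p is r%:E then r^-1 else 0.

Lemma test_fun_Lp (p : \bar R) (alpha : R) : (0 < p)%E -> -1 < alpha ->
  exists2 A : R, 0 <= A & forall N (s : box_idx N -> R), (forall x, `|s x| <= 1) ->
    in_Lp p alpha (test_fun (tau_of p alpha) s) /\
    (Lpnorm p alpha (test_fun (tau_of p alpha) s) <= (A * N%:R `^ theta_of p)%:E)%E.
Proof.
move=> p0 a1; have mt N tau (s : box_idx N -> R) : measurable_fun B (test_fun tau s).
  by apply: measurable_funTS; exact: measurable_test_fun.
have cst0 : 0 <= box_cst by rewrite mulr_ge0 ?invr_ge0 ?vol_ge0 ?exprn_ge0// mulr_ge0// ltW.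
case: p p0 => [p| |]//= p0.
  have {}p0 : 0 < p by [].
  pose A0 := 2 `^ `|alpha| * box_cst * depth 0 ^+ m.+1.
  have A00 : 0 <= A0.
    by apply: mulr_ge0; [exact: mulr_ge0 (powR_ge0 _ _) cst0|exact: exprn_ge0 (ltW (depth_gt0 0))].
  have W0 := ltW (weight_cst_gt0 m.+1 a1).
  have WA0 : 0 <= weight_cst m.+1 alpha * A0 by exact: mulr_ge0.
  exists ((weight_cst m.+1 alpha * A0) `^ p^-1); first exact: powR_ge0.
  move=> N s s1; have := test_fun_mass alpha p0 s1; rewrite -/A0 => h.
  split.
    by apply/(in_LpP _ p0 a1); split => //; apply: le_lt_trans h (ltry _).
  have mts := mt N ((1 + alpha) / p) s.
  change (Lpnorm p%:E alpha (test_fun ((1 + alpha) / p) s) <=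
    ((weight_cst m.+1 alpha * A0) `^ p^-1 * N%:R `^ p^-1)%:E)%E.
  rewrite (Lpnorm_mass p0 a1 mts) -powRM ?ler0n// -poweR_EFin; apply: lee_poweR.
  - by rewrite invr_ge0 ltW.
  - by apply: mule_ge0; [rewrite lee_fin|exact: mass_ge0].
  - by rewrite -(mulrA (weight_cst m.+1 alpha)) (EFinM (weight_cst m.+1 alpha)); apply: lee_wpmul2l => //; rewrite lee_fin.
exists 1 => // N s s1.
have L : (Lpnorm +oo%E alpha (test_fun 0 s) <= 1%:E)%E.
  apply: Lpnorm_oo_le1 => // w.
  have [[x xw]|h] := pselect (exists x : box_idx N, boxes x w).
    by rewrite (test_funE _ _ xw) oppr0 powRr0 mulr1 normcR.
  by rewrite test_fun0 ?normc0// => x xw; apply: h; exists x.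
rewrite powRr0 mulr1; split => //; split => //.
exact: le_lt_trans L (ltry _).
Qed.

End test_functions.

(** * Finite sums, sublinear growth and averages over signs *)

Section integral_facts.
Context d (T : measurableType d) (R : realType) (mu : {measure set T -> \bar R}).

Lemma Rintegral_sum (D : set T) (I : Type) (s : seq I) (h : I -> T -> R) : measurable D ->
  (forall i, mu.-integrable D (EFin \o h i)) ->
  \int[mu]_(x in D) (\sum_(i <- s) h i x) = \sum_(i <- s) \int[mu]_(x in D) h i x.
Proof.
move=> mD ih; rewrite /Rintegral; under eq_integral do rewrite -sumEFin.
rewrite integral_sum// sum_fine// => i _.
exact: (integrable_fin_num mD (ih i)).
Qed.

Lemma cintegrable_Re (D : set T) (h : T -> R[i]) : measurable D -> cintegrable mu D h ->
  mu.-integrable D (EFin \o (fun x => complex.Re (h x))).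
Proof.
move=> mD [mh hoo]; apply/integrableP; split.
  by apply/measurable_EFinP; exact: measurable_fun_Re.
apply: le_lt_trans hoo; apply: ge0_le_integral => //.
- apply: measurableT_comp => //; apply/measurable_EFinP; exact: measurable_fun_Re.
- by apply/measurable_EFinP; exact: measurable_fun_normc.
- by move=> x _; rewrite /= lee_fin normr_Re_le_normc.
Qed.

End integral_facts.

Lemma sublinear_false (R : realType) (k1 k2 e : R) : 0 < k1 -> e < 1 ->
  (forall N : nat, k1 * N%:R <= k2 * N%:R `^ e) -> False.
Proof.
move=> k0 e1 h; pose X := Num.max (k2 / k1) 0.
have X0 : 0 <= X by rewrite le_max lexx orbT.
pose t := 1 - e; have t0 : 0 < t by rewrite subr_gt0.
have [N NX] : exists N : nat, (X + 1) `^ t^-1 < N%:R.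
  by exists (Num.bound ((X + 1) `^ t^-1)); apply: archi_boundP; exact: powR_ge0.
have N0 : 0 < N%:R :> R by apply: le_lt_trans NX; exact: powR_ge0.
have : X + 1 <= N%:R `^ t.
  have -> : X + 1 = ((X + 1) `^ t^-1) `^ t.
    by rewrite -powRrM mulVf ?(gt_eqF t0)// powRr1 ?addr_ge0.
  by apply: ge0_ler_powR; rewrite ?nnegrE ?powR_ge0 ?(ltW N0) ?(ltW t0) ?(ltW NX).
apply/negP; rewrite -ltNge.
have NE : N%:R = N%:R `^ t * N%:R `^ e :> R.
  by rewrite -powRD ?(gt_eqF N0) ?implybT// /t subrK powRr1// ltW.
have := h N; rewrite [X in k1 * X]NE.
rewrite mulrA ler_pM2r ?powR_gt0// => h1.
have : k2 / k1 <= X by rewrite le_max lexx.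
have : N%:R `^ t <= k2 / k1 by rewrite ler_pdivlMr// mulrC.
lra.
Qed.

(* Flipping the sign of the j-th term pairs up the choices of signs. *)
Lemma sum_signs_ge (R : realType) (I : finType) (a : I -> R) (q : R) (j : I) : 1 <= q ->
  2^-1 * #|{ffun I -> bool}|%:R * `|a j| `^ q <=
  \sum_(s : {ffun I -> bool}) `|\sum_i (-1) ^+ s i * a i| `^ q.
Proof.
move=> q1; have q0 : 0 < q by lra.
pose flip (s : {ffun I -> bool}) : {ffun I -> bool} := [ffun i => if i == j then s i else ~~ s i].
have flipK : involutive flip.
  by move=> s; apply/ffunP => i; rewrite !ffunE; case: eqP => // _; rewrite negbK.
pose S (s : {ffun I -> bool}) := \sum_i (-1) ^+ s i * a i.
have Sflip s : S s + S (flip s) = 2 * ((-1) ^+ s j * a j).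
  rewrite /S -big_split (bigD1 j)//= big1 ?addr0; last first.
    by move=> i ij; rewrite ffunE (negbTE ij); case: (s i); rewrite /= ?expr0 ?expr1; ring.
  by rewrite ffunE eqxx; ring.
have pair s : `|a j| `^ q <= `|S s| `^ q + `|S (flip s)| `^ q.
  have aj : `|a j| <= Num.max `|S s| `|S (flip s)|.
    have : `|a j| = `|S s + S (flip s)| / 2.
      by rewrite Sflip normrM normrM normr_sign mul1r ger0_norm// mulrAC divff// mul1r.
    have := ler_normD (S s) (S (flip s)).
    by have [] := leP `|S s| `|S (flip s)|; lra.
  apply: (@le_trans _ _ (Num.max `|S s| `|S (flip s)| `^ q)).
    by apply: ge0_ler_powR; rewrite ?nnegrE ?(ltW q0)// le_max normr_ge0.
  by have [_|_] := leP `|S s| `|S (flip s)|; rewrite ?lerDl ?lerDr powR_ge0.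
rewrite -mulrA ler_pdivrMl// mulr_natl.
have -> : 2 * (\sum_s `|S s| `^ q) = \sum_s (`|S s| `^ q + `|S (flip s)| `^ q).
  rewrite big_split /= mulrDl mul1r; congr (_ + _).
  by rewrite (reindex_inj (inv_inj flipK)).
rewrite -[leLHS]sumr_const; exact: ler_sum.
Qed.

(** * Necessity *)

Section necessity.
Variables (R : realType) (m : nat) (ep eta : R).
Local Notation C := R[i].
Local Notation Cn := (m.+1.-tuple C).
Local Notation B := (@unit_ball R m.+1).
Hypotheses (ep0 : 0 < ep) (ep_m : 16 * (m%:R + 1) * ep <= 1)
  (ep_eta : (4 + ((4 * m%:R + 2) ^+ 2 + 4 * m%:R)) * ep <= eta)
  (eta0 : 0 < eta) (eta_half : eta <= 2^-1).

Let mB : measurable B := @measurable_unit_ball R m.+1.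
Local Notation depth := (depth R m).
Local Notation bcst := (box_cst m ep).
Let inB N (x : box_idx m N) w : boxes ep x w -> B w := @boxes_ball _ _ _ _ ep0 ep_m ep_eta eta_half N x w.
Let vbox N (x : box_idx m N) := vball_boxes ep0 ep_m ep_eta eta_half x.

Lemma Lpnorm_ge0 (p : \bar R) alpha (f : Cn -> C) : (0 <= Lpnorm p alpha f)%E.
Proof. by case: p => [r| |]; exact: Lnorm_ge0. Qed.

Lemma in_Lp_le1 (p : \bar R) alpha (f : Cn -> C) : (0 < p)%E -> -1 < alpha ->
  measurable_fun B f -> (forall w, normc (f w) <= 1) -> in_Lp p alpha f.
Proof.
case: p => [p| |]//= p0 a1 mf f1; last first.
  by split => //; apply: le_lt_trans (Lpnorm_oo_le1 alpha _ f1) (ltry _).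
have {}p0 : 0 < p by [].
have [M _ MP] := @integral_rho_lty R m.+1 alpha isT a1.
apply/(in_LpP _ p0 a1); split => //; apply: le_lt_trans (ltry M); apply: le_trans MP.
apply: ge0_le_integral => //.
- by move=> w _; rewrite lee_fin mulr_ge0 ?powR_ge0.
- by apply/measurable_EFinP; exact: measurable_mass_fun.
- by apply/measurable_EFinP/measurable_funTS; exact: measurable_rho_powR.
move=> w _; rewrite lee_fin ler_piMl ?powR_ge0//.
apply: (@le_trans _ _ (1 `^ p)); last by rewrite powR1.
by apply: ge0_ler_powR; rewrite ?nnegrE ?normc_ge0 ?(ltW p0).
Qed.

(** A neighbourhood of the origin so small that |<z,w>| <= eta for every z of the ball and every w
    in it; [K_Re] then applies with d = 1. *)
Definition central : set Cn := polysquare (fun _ : 'I_m.+1 => 0 : C) (eta / (4 * m.+1%:R)).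

Let m1 : 1 <= m.+1%:R :> R. Proof. by rewrite ler1n. Qed.

Let central_coord w i : central w -> normc (tnth w i) <= eta / (2 * m.+1%:R).
Proof.
move=> /(_ i)/square_normc; rewrite subr0 => h; apply: (le_trans h).
rewrite le_eqVlt; apply/orP; left; apply/eqP; field.
by rewrite gt_eqF// (lt_le_trans _ m1).
Qed.

Lemma central_inner z w : B z -> central w -> normc (inner z w) <= eta.
Proof.
move=> zB wE; apply: le_trans (normc_sum _ _) _.
apply: (@le_trans _ _ (\sum_(i < m.+1) eta / (2 * m.+1%:R))).
  apply: ler_sum => i _; rewrite normcM normc_conj.
  apply: le_trans (central_coord i wE); apply: ler_piMl; first exact: normc_ge0.
  exact: ltW (normc_coord_lt1 i zB).
rewrite sumr_const card_ord -[leLHS]mulr_natl.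
have -> : m.+1%:R * (eta / (2 * m.+1%:R)) = eta / 2 :> R.
  by field; rewrite gt_eqF// (lt_le_trans _ m1).
by move: eta0 eta_half; lra.
Qed.

Lemma central_rho w : central w -> 1 / 2 <= rho w <= 2 * 1.
Proof.
move=> wE; have := rho_le1 w; suff : normsq w <= 2^-1 by rewrite /rho => ? ?; apply/andP; split; lra.
apply: (@le_trans _ _ (\sum_(i < m.+1) eta / (2 * m.+1%:R))).
  apply: ler_sum => i _; have h0 := normc_ge0 (tnth w i); have h := central_coord i wE.
  have : eta / (2 * m.+1%:R) <= 1.
    by rewrite ler_pdivrMr ?mulr_gt0 ?(lt_le_trans _ m1)//; move: m1 eta_half; lra.
  move=> e1; rewrite expr2; apply: (le_trans _ h); apply: ler_piMl => //.
  exact: (le_trans h e1).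
rewrite sumr_const card_ord -[leLHS]mulr_natl.
have -> : m.+1%:R * (eta / (2 * m.+1%:R)) = eta / 2 :> R.
  by field; rewrite gt_eqF// (lt_le_trans _ m1).
by move: eta0 eta_half; lra.
Qed.

Lemma central_ball w : central w -> B w.
Proof. by move=> /central_rho/andP[h _]; rewrite /unit_ball/= -subr_gt0; move: h; rewrite /rho; lra. Qed.

Lemma measurable_central : measurable central.
Proof. exact: measurable_polysquare. Qed.

Lemma vball_central : exists2 v : R, 0 < v & vball central = v%:E.
Proof.
have r0 : 0 < eta / (4 * m.+1%:R) by rewrite divr_gt0// mulr_gt0// (lt_le_trans _ m1).
exists ((vol R m.+1)^-1 * (2 * (eta / (4 * m.+1%:R))) ^+ 2 ^+ m.+1).
  by rewrite mulr_gt0 ?invr_gt0 ?vol_gt0// !exprn_gt0// mulr_gt0.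
rewrite vballE setIidl; last by move=> w; exact: central_ball.
by rewrite lebesgueCn_polysquare ?(ltW r0)// EFinM.
Qed.

Lemma box_cst_gt0 : 0 < bcst.
Proof.
rewrite /box_cst; apply: mulr_gt0; first by rewrite invr_gt0 vol_gt0.
by apply: exprn_gt0; rewrite mulr_gt0.
Qed.

Lemma integral_boxes_ge N (F : nat -> R) (h : Cn -> R) : measurable_fun B h ->
  (forall w, B w -> 0 <= h w) -> (forall k, 0 <= F k) ->
  (forall (x : box_idx m N) w, boxes ep x w -> F (tag x) <= h w) ->
  ((bcst * depth 0 ^+ m.+1 * \sum_(k < N) F k * depth k)%:E <=
    \int[vball]_(w in B) (h w)%:E)%E.
Proof.
move=> mh h0 F0 Fh.
have mi (x : box_idx m N) : measurable_fun B (fun w : Cn => (F (tag x) * \1_(boxes ep x) w)%:E).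
  apply/measurable_EFinP/measurable_funTS; apply: measurable_funM => //.
  by apply: measurable_indic; exact: measurable_boxes.
apply: (@le_trans _ _ (\int[vball]_(w in B) (\sum_(x : box_idx m N) (F (tag x) * \1_(boxes ep x) w)%:E))%E); last first.
  apply: ge0_le_integral => //.
  - by move=> w _; apply: sume_ge0 => x _; rewrite lee_fin mulr_ge0.
  - by apply: emeasurable_sum => x; exact: mi.
  - exact/measurable_EFinP.
  move=> w wB; rewrite sumEFin lee_fin.
  have [[x xw]|no] := pselect (exists x : box_idx m N, boxes ep x w); last first.
    rewrite big1 ?h0// => x _; rewrite indicE memNset ?mulr0// => xw.
    by apply: no; exists x.
  rewrite (bigD1 x)//= big1 ?addr0; last first.
    move=> y yx; rewrite indicE memNset ?mulr0// => yw; move/eqP: yx; apply.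
    exact: (boxes_disjoint ep0 ep_m ep_eta eta_half yw xw).
  by rewrite indicE mem_set// mulr1; exact: Fh.
rewrite ge0_integral_sum//; last by move=> x w _; rewrite lee_fin mulr_ge0.
rewrite -mulrA -(sum_box_idx m N F) mulr_sumr -sumEFin; apply: lee_sum => x _.
under eq_integral do rewrite EFinM.
rewrite ge0_integralZl//; last 2 first.
- apply/measurable_EFinP/measurable_funTS; apply: measurable_indic; exact: measurable_boxes.
- by rewrite lee_fin.
rewrite integral_indic//; last exact: measurable_boxes.
have -> : (boxes ep x `&` B) = boxes ep x by apply: setIidl => w; exact: inB.
by rewrite vbox -EFinM mulrCA.
Qed.

Variables (K : Cn -> Cn -> C) (a b c kappa alpha beta q : R) (p : \bar R).
Hypothesis mK : measurable_fun setT (fun x : Cn * Cn => K x.1 x.2).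
Hypothesis kappa0 : 0 < kappa.
Hypothesis K_Re : forall d z w, 0 < d -> B z -> B w ->
  normc (1 - inner z w - d%:C) <= eta * d ->
  kappa * rho w `^ b * d `^ (- c) <= complex.Re (K z w).
Hypotheses (a1 : -1 < alpha) (b1 : -1 < beta) (q1 : 1 <= q) (qp : (q%:E < p)%E).
Hypothesis KB : FR_bounded a K p alpha q%:E beta.

Let q0 : 0 < q. Proof. exact: lt_le_trans q1. Qed.
Let p0 : (0 < p)%E. Proof. by apply: lt_trans qp; rewrite lte_fin. Qed.

Local Notation tau := (tau_of p alpha).
Local Notation tf := (test_fun ep tau).

(** This is how q < p enters: the q-th powers of the norms of the images grow at most like N^(q/p),
    which is sublinear in the number of shells. *)
Lemma thetaq_lt1 : theta_of p * q < 1.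
Proof.
by case: p p0 qp => [r| |]//= r0; rewrite ?mul0r ?ltr01// lte_fin => qr;
  rewrite mulrC ltr_pdivrMr ?mul1r//; lra.
Qed.

Lemma image_mass (f : Cn -> C) : in_Lp p alpha f ->
  measurable_fun B (FR_op a K f) /\ (mass q beta (FR_op a K f) < +oo)%E.
Proof. by case: KB => _ [D DP] /DP[/(in_LpP _ q0 b1)]. Qed.

Lemma image_mass_test : exists D : R, forall N (s : box_idx m N -> R),
  (forall x, `|s x| <= 1) ->
  (mass q beta (FR_op a K (tf s)) <= (D * N%:R `^ (theta_of p * q))%:E)%E.
Proof.
case: KB => _ [D DP].
have [A A0 AP] := test_fun_Lp ep0 ep_m ep_eta eta_half p0 a1.
have W0 := weight_cst_gt0 m.+1 b1.
exists ((weight_cst m.+1 beta)^-1 * (Num.max D 0 * A) `^ q) => N s s1.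
have [fL fA] := AP N s s1; have [/(in_LpP _ q0 b1)[mg _]] := DP _ fL.
have X0 : 0 <= Num.max D 0 by rewrite le_max lexx orbT.
have XA : 0 <= Num.max D 0 * A by rewrite mulr_ge0.
rewrite (Lpnorm_mass q0 b1 mg) => h.
have {}h : (((weight_cst m.+1 beta)%:E * mass q beta (FR_op a K (tf s))) `^ q^-1 <=
    (Num.max D 0 * A * N%:R `^ theta_of p)%:E)%E.
  apply: (le_trans h); apply: (@le_trans _ _ ((Num.max D 0)%:E * Lpnorm p alpha (tf s))%E).
    apply: lee_wpmul2r; first exact: Lpnorm_ge0.
    by rewrite lee_fin le_max lexx.
  by rewrite -mulrA (EFinM (Num.max D 0)); apply: lee_wpmul2l => //; rewrite lee_fin.
have {}h : ((weight_cst m.+1 beta)%:E * mass q beta (FR_op a K (tf s)) <=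
    ((Num.max D 0 * A * N%:R `^ theta_of p) `^ q)%:E)%E.
  rewrite -poweR_EFin; apply: le_trans (lee_poweR (ltW q0) _ h); last exact: poweR_ge0.
  rewrite -poweRrM mulVf ?gt_eqF// poweRe1//.
  by apply: mule_ge0; [rewrite lee_fin ltW|exact: mass_ge0].
rewrite powRM ?powR_ge0// -powRrM in h.
rewrite -mulrA (EFinM (_^-1)) lee_pdivlMl//.
Qed.

(** The contribution of one box to the real part of the image, without its sign and the factor
    rho(z)^a. *)
Definition box_integral N (x : box_idx m N) (z : Cn) : R :=
  \int[vball]_(w in B) (complex.Re (K z w) * (depth (tag x) `^ (- tau) * \1_(boxes ep x) w)).

Lemma integrable_box N (x : box_idx m N) z : B z -> vball.-integrable B
  (EFin \o (fun w => complex.Re (K z w) * (depth (tag x) `^ (- tau) * \1_(boxes ep x) w))).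
Proof.
(* The test function reduced to the single box x: integrability is read off from the boundedness of
   the operator, with no upper bound on the kernel. *)
move=> zB; pose s (y : box_idx m N) : R := (y == x)%:R.
have s1 y : `|s y| <= 1 by rewrite /s; case: eqP; rewrite ?normr1 ?normr0.
have [A _ AP] := test_fun_Lp ep0 ep_m ep_eta eta_half p0 a1.
have := cintegrable_Re mB (KB.1 _ (AP N s s1).1 z zB).
apply: eq_integrable => // w _; rewrite /= /test_fun; congr EFin.
rewrite (bigD1 x)//= big1 ?addr0; last by move=> y /negbTE yx; rewrite /s yx !mul0r.
rewrite /s eqxx mul1r.
by case: (K z w) => u v /=; ring.
Qed.

Lemma image_test_ge N (s : box_idx m N -> R) z : B z ->
  rho z `^ a * `|\sum_x s x * box_integral x z| <= normc (FR_op a K (tf s) z).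
Proof.
move=> zB; rewrite /FR_op normcM normcR (ger0_norm (powR_ge0 _ _)).
apply: ler_wpM2l; first exact: powR_ge0.
apply: le_trans (normr_Re_le_normc _); rewrite /cintegral.
have -> : \sum_x s x * box_integral x z = \int[vball]_(w in B)
    \sum_x s x * (complex.Re (K z w) * (depth (tag x) `^ (- tau) * \1_(boxes ep x) w)).
  rewrite Rintegral_sum//; last first.
    by move=> x; have := integrableZl mB (s x) (integrable_box x zB).
  by apply: eq_bigr => x _; rewrite RintegralZl//; exact: integrable_box.
rewrite /= le_eqVlt; apply/orP; left; apply/eqP; congr `|_|; apply: eq_Rintegral => w _.
rewrite /test_fun; case: (K z w) => u v /=.
by rewrite mulr0 subr0 mulr_sumr; apply: eq_bigr => x _; ring.
Qed.

(** Serves with d = 1 for z near the origin, and with d the depth of the box for z in that box. The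
    exponents collect rho^b, the height depth^(-tau) and the volume depth^(m+2). *)
Lemma box_integral_ge N (x : box_idx m N) z d : B z -> 0 < d ->
  (forall w, boxes ep x w -> normc (1 - inner z w - d%:C) <= eta * d) ->
  kappa * 2 `^ (- `|b|) * bcst * d `^ (- c) * depth (tag x) `^ (b - tau) * depth (tag x) ^+ m.+2
  <= box_integral x z.
Proof.
move=> zB d0 near; set D := depth (tag x); have D0 : 0 < D by exact: depth_gt0.
pose k := kappa * 2 `^ (- `|b|) * d `^ (- c) * D `^ (b - tau).
have -> : kappa * 2 `^ (- `|b|) * bcst * d `^ (- c) * D `^ (b - tau) * D ^+ m.+2 =
    k * (bcst * D ^+ m.+2) by rewrite /k; move: (D ^+ _) => ?; ring.
have I1 : vball.-integrable B (EFin \o (\1_(boxes ep x) : Cn -> R)).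
  have mi : measurable_fun B (\1_(boxes ep x) : Cn -> R).
    by apply: measurable_funTS; apply: measurable_indic; exact: measurable_boxes.
  apply/integrableP; split; first exact/measurable_EFinP.
  under eq_integral do rewrite /= ger0_norm//.
  rewrite integral_indic//; last exact: measurable_boxes.
  by apply: vball_lty; apply: measurableI => //; exact: measurable_boxes.
have <- : \int[vball]_(w in B) (k * \1_(boxes ep x) w) = k * (bcst * D ^+ m.+2).
  rewrite RintegralZl//; congr (_ * _).
  rewrite /Rintegral integral_indic//; last exact: measurable_boxes.
  have -> : (boxes ep x `&` B) = boxes ep x by apply: setIidl => w; exact: inB.
  by rewrite vbox.
apply: le_Rintegral => //; last 1 first.
- move=> w wB; have [xw|xw] := pselect (boxes ep x w); last first.
    by rewrite indicE memNset// !mulr0.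
  rewrite indicE mem_set// !mulr1.
  have := K_Re d0 zB wB (near w xw).
  have /andP[h _] := powR_near b D0 (boxes_rho2 ep0 ep_m ep_eta eta_half xw).
  have -> : k = kappa * (2 `^ (- `|b|) * D `^ b) * d `^ (- c) * D `^ (- tau).
    by rewrite /k powRD ?(gt_eqF D0) ?implybT//; ring.
  move=> h2; apply: ler_wpM2r; first exact: powR_ge0.
  apply: le_trans h2; apply: ler_wpM2r; first exact: powR_ge0.
  by apply: ler_wpM2l => //; exact: ltW.
- exact: (integrableZl mB k I1).
- exact: integrable_box.
Qed.

Lemma depth_powR_ge1 k e : e <= 0 -> 1 <= depth k `^ e.
Proof.
move=> e0; rewrite -(powRr0 (depth k)); apply: ger_powR => //.
by rewrite depth_gt0 depth_le1.
Qed.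

(** A failed inequality of (iii) enters here as e + 1 <= 0: as depths are at most 1, no shell
    contributes less than k, even in the equality case. *)
Lemma sum_depth_ge (N : nat) (k e : R) : 0 <= k -> e + 1 <= 0 ->
  k * N%:R <= \sum_(j < N) k * depth j `^ e * depth j.
Proof.
move=> k0 e0; have -> : k * N%:R = \sum_(j < N) k by rewrite sumr_const card_ord mulr_natr.
apply: ler_sum => j _; rewrite -mulrA; apply: ler_peMr => //.
rewrite -[X in _ * X](@powRr1 R) ?(ltW (depth_gt0 _ _ _))// -powRD.
  exact: depth_powR_ge1.
by rewrite (gt_eqF (depth_gt0 _ _ _)) implybT.
Qed.

Lemma near_central z w : B z -> B w -> central z \/ central w ->
  normc (1 - inner z w - 1%:C) <= eta * 1.
Proof.
move=> zB wB zw; rewrite mulr1.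
have -> : 1 - inner z w - 1%:C = - inner z w by rewrite addrAC subrr sub0r.
rewrite normcN; case: zw => h; last exact: central_inner.
by rewrite inner_conj normc_conj; exact: central_inner.
Qed.

(** The image of the indicator of [central] is at least a multiple of rho^a on the whole ball. Its
    mass is finite, yet if q a + beta <= -1 every shell would add a fixed amount to it. *)
Lemma necessary_output : - q * a < beta + 1.
Proof.
rewrite ltNge; apply/negP => bq; pose e := q * a + beta.
have e0 : e + 1 <= 0 by rewrite /e; move: bq; rewrite mulNr; lra.
pose f (w : Cn) : C := (\1_central w)%:C.
have mf : measurable_fun B f.
  apply: measurable_complexP => //=; apply: measurable_funTS.
  by apply: measurable_indic; exact: measurable_central.
have fL : in_Lp p alpha f.
  apply: in_Lp_le1 => // w; rewrite /f normcR indicE ger0_norm ?ler0n//.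
  by case: (_ \in _).
have [mg goo] := image_mass fL.
have [v v0 vE] := vball_central.
pose k := kappa * 2 `^ (- `|b|) * v.
have k0 : 0 < k by rewrite !mulr_gt0// powR_gt0.
have gk z : B z -> rho z `^ a * k <= normc (FR_op a K f z).
  move=> zB; rewrite /FR_op normcM normcR (ger0_norm (powR_ge0 _ _)).
  apply: ler_wpM2l; first exact: powR_ge0.
  apply: le_trans (Re_le_normc _); rewrite /cintegral.
  have I1 : vball.-integrable B (EFin \o (\1_central : Cn -> R)).
    have mi : measurable_fun B (\1_central : Cn -> R).
      by apply: measurable_funTS; apply: measurable_indic; exact: measurable_central.
    apply/integrableP; split; first exact/measurable_EFinP.
    under eq_integral do rewrite /= ger0_norm//.
    rewrite integral_indic//; last exact: measurable_central.
    by apply: vball_lty; apply: measurableI => //; exact: measurable_central.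
  have -> : k = \int[vball]_(w in B) (kappa * 2 `^ (- `|b|) * \1_central w).
    rewrite RintegralZl// /Rintegral integral_indic//; last exact: measurable_central.
    by rewrite setIidl ?vE// => w; exact: central_ball.
  rewrite [leRHS]/=; apply: le_Rintegral => //; last 1 first.
  - move=> w wB; have [wE|wE] := pselect (central w); last first.
      by rewrite /f indicE memNset// (mulr0 (K z w)) mulr0.
    have := K_Re ltr01 zB wB (near_central zB wB (or_intror wE)).
    have /andP[h _] := powR_near b ltr01 (central_rho wE).
    rewrite powR1 mulr1 in h; rewrite powR1 mulr1 => h2.
    have -> : complex.Re (K z w * f w) = complex.Re (K z w).
      rewrite /f indicE mem_set//; by case: (K z w) => x y /=; rewrite mulr1 mulr0 subr0.
    rewrite indicE mem_set// mulr1; apply: le_trans h2.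
    by apply: ler_wpM2l => //; exact: ltW.
  - exact: (integrableZl mB _ I1).
  - exact: (cintegrable_Re mB (KB.1 _ fL z zB)).
have Moo : mass q beta (FR_op a K f) \is a fin_num by rewrite ge0_fin_numE ?mass_ge0.
have c0 : 0 < bcst * depth 0 ^+ m.+1 * (k `^ q * 2 `^ (- `|e|)).
  apply: mulr_gt0; first by apply: mulr_gt0; [exact: box_cst_gt0|apply: exprn_gt0; exact: depth_gt0].
  by apply: mulr_gt0; exact: powR_gt0.
apply: (@sublinear_false R _ (fine (mass q beta (FR_op a K f))) 0 c0 ltr01) => N.
rewrite powRr0 mulr1 -lee_fin fineK//.
apply: le_trans (integral_boxes_ge (N := N) (F := fun j => k `^ q * 2 `^ (- `|e|) * depth j `^ e) _ _ _ _).
- rewrite lee_fin -(mulrA (bcst * _)); apply: ler_wpM2l; last first.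
    by apply: sum_depth_ge => //; rewrite mulr_ge0 ?powR_ge0.
  by apply: mulr_ge0; [exact: ltW box_cst_gt0|apply: exprn_ge0; exact: ltW (depth_gt0 _ _ _)].
- exact: measurable_mass_fun.
- by move=> w _; rewrite mulr_ge0 ?powR_ge0.
- by move=> j; rewrite !mulr_ge0 ?powR_ge0.
move=> x w xw; have wB := inB xw.
have /andP[h _] := powR_near e (depth_gt0 R m (tag x)) (boxes_rho2 ep0 ep_m ep_eta eta_half xw).
rewrite -(mulrA (k `^ q)); apply: (@le_trans _ _ (k `^ q * rho w `^ e)).
  by apply: ler_wpM2l => //; exact: powR_ge0.
rewrite /e powRD ?(gt_eqF (rho_gt0 wB)) ?implybT// mulrA; apply: ler_wpM2r; first exact: powR_ge0.
rewrite [q * a]mulrC powRrM mulrC -powRM ?powR_ge0 ?(ltW k0)//.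
apply: ge0_ler_powR; rewrite ?nnegrE ?normc_ge0 ?(ltW q0)//; last exact: gk.
by apply: mulr_ge0; [exact: powR_ge0|exact: ltW].
Qed.

(** With all signs positive and z in [central], no cancellation occurs in the real part: if b - tau
    <= -1 each shell adds a fixed amount to the image at z, so its q-th power is of order at least
    N^q >= N on a set of fixed volume. *)
Lemma necessary_input : tau < b + 1.
Proof.
rewrite ltNge; apply/negP => bt; have bt0 : b - tau + 1 <= 0 by lra.
have [D DP] := image_mass_test.
have [v v0 vE] := vball_central.
have c0 := box_cst_gt0.
pose k := kappa * 2 `^ (- `|b|) * bcst; pose k' := 2 `^ (- `|a|) * (k * depth 0 ^+ m.+1).
have k0 : 0 < k by apply: mulr_gt0 => //; apply: mulr_gt0 => //; exact: powR_gt0.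
have k'0 : 0 < k'.
  by apply: mulr_gt0; [exact: powR_gt0|apply: mulr_gt0 => //; apply: exprn_gt0; exact: depth_gt0].
have C0 : 0 < k' `^ q * 2 `^ (- `|beta|) * v.
  by apply: mulr_gt0 => //; apply: mulr_gt0; exact: powR_gt0.
apply: (@sublinear_false R _ D (theta_of p * q) C0 thetaq_lt1) => N.
pose s (x : box_idx m N) : R := 1.
have s1 x : `|s x| <= 1 by rewrite normr1.
have mg : measurable_fun B (FR_op a K (tf s)).
  by apply: measurable_FR_op => //; apply: measurable_funTS; exact: measurable_test_fun.
rewrite -lee_fin; apply: le_trans (DP N s s1).
have gk z : central z -> k' * N%:R <= normc (FR_op a K (tf s) z).
  move=> zE; have zB := central_ball zE; apply: le_trans (image_test_ge s zB).
  rewrite -mulrA; apply: ler_pM; rewrite ?powR_ge0//.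
  - by apply: mulr_ge0; rewrite ?ler0n// mulr_ge0 ?(ltW k0)// exprn_ge0 ?(ltW (depth_gt0 _ _ _)).
  - by have /andP[] := powR_near a ltr01 (central_rho zE); rewrite powR1 mulr1.
  apply: le_trans (ler_norm _).
  apply: (@le_trans _ _ (\sum_(x : box_idx m N) k * depth (tag x) `^ (b - tau) * depth (tag x) ^+ m.+2)).
    rewrite (sum_box_idx m N (fun j => k * depth j `^ (b - tau))) (mulrC k) -mulrA.
    apply: ler_wpM2l; first by apply: exprn_ge0; exact: ltW (depth_gt0 _ _ _).
    by apply: sum_depth_ge => //; exact: ltW.
  apply: ler_sum => x _; rewrite mul1r.
  apply: le_trans (box_integral_ge (x := x) zB ltr01 _); last first.
    by move=> w xw; apply: near_central => //; [exact: inB xw|left].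
  by rewrite powR1 mulr1.
have NN : N%:R <= N%:R `^ q :> R.
  case: N {s s1 mg gk} => [|N]; first by rewrite powR_ge0.
  by apply: le1r_powR => //; rewrite ler1n.
apply: (@le_trans _ _ (\int[vball]_(w in B) ((k' `^ q * N%:R * 2 `^ (- `|beta|)) * \1_central w)%:E)%E).
  under eq_integral do rewrite EFinM.
  rewrite ge0_integralZl//; last 2 first.
  - apply/measurable_EFinP/measurable_funTS; apply: measurable_indic; exact: measurable_central.
  - by rewrite lee_fin !mulr_ge0 ?powR_ge0.
  rewrite integral_indic//; last exact: measurable_central.
  rewrite setIidl; last by move=> w; exact: central_ball.
  by rewrite vE -EFinM lee_fin le_eqVlt; apply/orP; left; apply/eqP; ring.
apply: ge0_le_integral => //.
- by move=> w _; rewrite lee_fin !mulr_ge0 ?powR_ge0.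
- apply/measurable_EFinP/measurable_funTS; apply: measurable_funM => //.
  by apply: measurable_indic; exact: measurable_central.
- by apply/measurable_EFinP; exact: measurable_mass_fun.
move=> w wB; rewrite lee_fin; have [wE|wE] := pselect (central w); last first.
  by rewrite indicE memNset// mulr0 mulr_ge0 ?powR_ge0.
rewrite indicE mem_set// mulr1; apply: ler_pM.
- by rewrite mulr_ge0 ?powR_ge0.
- exact: powR_ge0.
- apply: (@le_trans _ _ ((k' * N%:R) `^ q)).
    by rewrite powRM ?ler0n ?(ltW k'0)//; apply: ler_wpM2l => //; exact: powR_ge0.
  apply: ge0_ler_powR; rewrite ?nnegrE ?normc_ge0 ?(ltW q0)//; last exact: gk.
  by apply: mulr_ge0 => //; exact: ltW.
- by have /andP[] := powR_near beta ltr01 (central_rho wE); rewrite powR1 mulr1.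
Qed.

Lemma necessary_singularity :
  c < m.+1%:R + 1 + a + b + (1 + beta) / q - tau.
Proof.
rewrite ltNge; apply/negP => hc.
(* [e2] is the order in the depth of the diagonal term [box_integral x w] for w in the box x, and
   [e1] that of the weight of its q-th power. The failed inequality is e1 + q e2 <= -1. *)
pose e1 := q * a + beta; pose e2 := b - c - tau + m.+2%:R.
have e0 : e1 + q * e2 + 1 <= 0.
  have -> : e1 + q * e2 + 1 = q * (m.+1%:R + 1 + a + b + (1 + beta) / q - tau - c).
    by rewrite /e1 /e2 -[m.+2%:R]natr1; field; rewrite gt_eqF.
  by rewrite pmulr_rle0// subr_le0.
have [D DP] := image_mass_test.
have c0 := box_cst_gt0.
pose k := kappa * 2 `^ (- `|b|) * bcst.
have k0 : 0 < k by apply: mulr_gt0 => //; apply: mulr_gt0 => //; exact: powR_gt0.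
pose k1 := 2 `^ (- `|e1|) * (2^-1 * k `^ q).
have k10 : 0 < k1.
  by apply: mulr_gt0; [exact: powR_gt0|apply: mulr_gt0; rewrite ?invr_gt0//; exact: powR_gt0].
have C0 : 0 < bcst * depth 0 ^+ m.+1 * k1.
  by apply: mulr_gt0 => //; apply: mulr_gt0 => //; apply: exprn_gt0; exact: depth_gt0.
apply: (@sublinear_false R _ D (theta_of p * q) C0 thetaq_lt1) => N.
pose I := {ffun box_idx m N -> bool}.
pose n : R := #|I|%:R.
have n0 : 0 < n by rewrite ltr0n card_ffun expn_gt0 card_bool.
pose s (u : I) (x : box_idx m N) : R := (-1) ^+ u x.
have s1 u x : `|s u x| <= 1 by rewrite normr_sign.
have mg u : measurable_fun B (FR_op a K (tf (s u))).
  by apply: measurable_FR_op => //; apply: measurable_funTS; exact: measurable_test_fun.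
(* Summing over all [n] choices of signs keeps at least half of the q-th power of the diagonal term
   for each choice on average, so the terms of the other boxes may have any sign; the upper bound
   [DP] is uniform in the signs. *)
pose h (w : Cn) := \sum_(u : I) normc (FR_op a K (tf (s u)) w) `^ q * rho w `^ beta.
rewrite -(ler_pM2l n0) -lee_fin.
apply: (@le_trans _ _ (\int[vball]_(w in B) (h w)%:E)%E); last first.
  under eq_integral do rewrite -sumEFin.
  rewrite ge0_integral_sum//; last 2 first.
  - by move=> u; apply/measurable_EFinP; exact: measurable_mass_fun.
  - by move=> u w _; rewrite lee_fin mulr_ge0 ?powR_ge0.
  apply: (@le_trans _ _ (\sum_(u : I) (D * N%:R `^ (theta_of p * q))%:E)%E).
    by apply: lee_sum => u _; exact: DP.
  by rewrite sumEFin sumr_const lee_fin -[leLHS]mulr_natl.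
apply: le_trans (integral_boxes_ge (N := N) (F := fun j => (n * k1) * depth j `^ (e1 + q * e2)) _ _ _ _).
- rewrite lee_fin [leLHS](_ : _ = bcst * depth 0 ^+ m.+1 * (n * k1 * N%:R)); last first.
    by move: (box_cst m ep) (depth 0 ^+ _) (n) (k1) (N%:R) => ? ? ? ? ?; ring.
  apply: ler_wpM2l.
    by apply: mulr_ge0; [exact: ltW|apply: exprn_ge0; exact: ltW (depth_gt0 _ _ _)].
  by apply: sum_depth_ge => //; apply: mulr_ge0; exact: ltW.
- apply: measurable_sum => u; exact: measurable_mass_fun.
- by move=> w _; apply: sumr_ge0 => u _; rewrite mulr_ge0 ?powR_ge0.
- by move=> j; apply: mulr_ge0; [apply: mulr_ge0; exact: ltW|exact: powR_ge0].
move=> x w xw; have wB := inB xw.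
set d := depth (tag x); have d0 : 0 < d by exact: depth_gt0.
have /andP[hr _] := powR_near e1 d0 (boxes_rho2 ep0 ep_m ep_eta eta_half xw).
have Jx : k * d `^ e2 <= box_integral x w.
  apply: le_trans (box_integral_ge (x := x) wB d0 _); last first.
    by move=> u xu; exact: (boxes_near ep0 ep_m ep_eta xw xu).
  rewrite -/d -/k -(powR_mulrn m.+2 (ltW d0)) -!mulrA; apply: ler_wpM2l; first exact: ltW.
  rewrite -!powRD ?(gt_eqF d0) ?implybT//.
  by have -> : - c + (b - tau + m.+2%:R) = e2 by rewrite /e2; ring.
have S := sum_signs_ge (fun y => box_integral y w) x q1.
apply: (@le_trans _ _ (rho w `^ e1 * \sum_(u : I) `|\sum_y s u y * box_integral y w| `^ q)).
  have -> : n * k1 * d `^ (e1 + q * e2) = 2 `^ (- `|e1|) * d `^ e1 * (2^-1 * n * (k * d `^ e2) `^ q).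
    rewrite /k1 powRM ?powR_ge0 ?(ltW k0)// -powRrM (mulrC e2) powRD; last by rewrite (gt_eqF d0) implybT.
    by ring.
  apply: ler_pM => //.
  - by rewrite mulr_ge0 ?powR_ge0.
  - by rewrite !mulr_ge0 ?powR_ge0 ?(ltW n0).
  apply: le_trans S; apply: ler_wpM2l; first by rewrite mulr_ge0 ?(ltW n0).
  apply: ge0_ler_powR; rewrite ?nnegrE ?normr_ge0 ?(ltW q0)//.
    by apply: mulr_ge0; [exact: ltW|exact: powR_ge0].
  exact: le_trans Jx (ler_norm _).
rewrite mulr_sumr; apply: ler_sum => u _.
rewrite /e1 powRD ?(gt_eqF (rho_gt0 wB)) ?implybT// mulrAC; apply: ler_wpM2r; first exact: powR_ge0.
rewrite [q * a]mulrC powRrM -powRM ?powR_ge0//.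
apply: ge0_ler_powR; rewrite ?nnegrE ?normc_ge0 ?(ltW q0)//; last exact: image_test_ge.
by apply: mulr_ge0; first exact: powR_ge0.
Qed.

Lemma FR_bounded_condition : FR_condition m.+1 a b c alpha beta p q.
Proof.
have := necessary_output; have := necessary_input; have := necessary_singularity.
rewrite /FR_condition; move: p0; case: p => [r| |]//= r0 h3 h2 h1.
  have {}r0 : 0 < r by [].
  split; [exact: h1| |exact: h3].
  by rewrite mulrC -ltr_pdivrMr// [alpha + 1]addrC.
split => //; first by lra.
by rewrite [beta + 1]addrC; move: h3; rewrite subr0.
Qed.

End necessity.

(** * The two kernels *)

Section argument.
Variable R : realType.
Local Notation C := R[i].
Implicit Types (z : C) (c : R).

Lemma Re_div_normc z : -1 <= complex.Re z / normc z <= 1.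
Proof.
have [->|z0] := eqVneq (normc z) 0; first by rewrite invr0 mulr0 lerN10 ler01.
have n0 : 0 < normc z by rewrite lt_neqAle eq_sym z0 normc_ge0.
by rewrite ler_pdivlMr// ler_pdivrMr// mulN1r mul1r -ler_norml normr_Re_le_normc.
Qed.

Lemma measurable_carg : measurable_fun setT (@carg R).
Proof.
have mu : measurable_fun setT (fun z : C => complex.Re z / normc z).
  apply: measurable_funM; first exact: measurable_Re.
  under eq_fun do rewrite -powR_inv1 ?normc_ge0//.
  exact: (measurableT_comp (measurable_powR _) (@measurable_normc R)).
have ma : measurable_fun setT (fun z : C => acos (complex.Re z / normc z)).
  (* Continuity of [acos] is used on the open interval and the endpoints are added; the quotient Re
     z / |z| never leaves [-1, 1], being 0 at z = 0 by the convention on inverses. *)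
  have mac : measurable_fun (`[-1, 1]%classic : set R) (@acos R).
    apply: (@measurable_fun_itv_cc R _ _ false true).
    apply: open_continuous_measurable_fun => // x.
    by rewrite inE /= in_itv/=; exact: continuous_acos.
  apply: (measurable_comp (f := @acos R) _ _ mac mu); first exact: measurable_itv.
  by move=> _ [z _ <-]; rewrite /= in_itv/=; exact: Re_div_normc.
apply: measurable_fun_ifT => //.
- by apply: measurable_fun_ler => //; exact: measurable_Im.
- exact: measurable_funN.
Qed.

Lemma normc_cpow z c : normc (cpow z c) = normc z `^ c.
Proof.
rewrite /cpow normcM normcR ger0_norm ?powR_ge0//=.
by rewrite cos2Dsin2 sqrtr1 mulr1.
Qed.

Lemma cpowV z c : (cpow z c)^-1 =
  (normc z `^ (- c))%:C * (cos (c * carg z) +i* - sin (c * carg z)).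
Proof.
rewrite /cpow invfM; congr (_ * _); first by rewrite powRN -[LHS]fmorphV.
apply: (@mulIf _ (cos (c * carg z) +i* sin (c * carg z))).
  apply/eqP => -[c0 s0]; have := cos2Dsin2 (c * carg z).
  by rewrite c0 s0 !expr0n addr0 => /esym/eqP; rewrite oner_eq0.
rewrite mulVf; last first.
  apply/eqP => -[c0 s0]; have := cos2Dsin2 (c * carg z).
  by rewrite c0 s0 !expr0n addr0 => /esym/eqP; rewrite oner_eq0.
by simpc; have := cos2Dsin2 (c * carg z); rewrite !expr2 => ->; congr Complex; ring.
Qed.

(** In a narrow disc about d > 0 the argument is at most t = 1/(|c| + 1) in modulus, so |c arg z| <=
    1 whatever the size of c. *)
Lemma cos_carg_gt c : exists eta : R, [/\ 0 < eta, eta <= 2^-1 &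
  forall z d, 0 < d -> normc (z - d%:C) <= eta * d -> cos 1 <= cos (c * carg z)].
Proof.
pose t : R := (`|c| + 1)^-1.
have c1 : 0 < `|c| + 1 by rewrite ltr_wpDl.
have t0 : 0 < t by rewrite invr_gt0.
have t1 : t <= 1 by rewrite invf_le1// lerDr.
have pi1 : 1 <= pi :> R by have := pihalf_ge1 R; lra.
have I0 : (0 : R) \in `[0, pi] by rewrite in_itv/= lexx pi_ge0.
have I1 : (1 : R) \in `[0, pi] by rewrite in_itv/= ler01.
have It : t \in `[0, pi] by rewrite in_itv/= (ltW t0) (le_trans t1).
have ler_cos (x y : R) : x \in `[0, pi] -> y \in `[0, pi] -> (cos x <= cos y) = (y <= x).
  by move=> xI yI; rewrite !leNgt ltr_cos.
have ct : cos t < 1 by rewrite -[ltRHS]cos0 ltr_cos.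
have ct0 : 0 < cos t by apply: lt_le_trans (cos1_gt0 R) _; rewrite ler_cos.
(* On the disc Re z / |z| >= (1 - eta)/(1 + eta), and this is at least cos t as soon as 2 eta <= 1 -
   cos t. *)
exists (Num.min 2^-1 ((1 - cos t) / 2)); split.
- by rewrite lt_min invr_gt0 ltr0n divr_gt0// subr_gt0.
- by rewrite ge_min lexx.
move=> z d d0; set eta := Num.min _ _ => zd.
have e0 : 0 < eta by rewrite lt_min invr_gt0 ltr0n divr_gt0// subr_gt0.
have e1 : eta <= 2^-1 by rewrite ge_min lexx.
have e2 : eta <= (1 - cos t) / 2 by rewrite ge_min lexx orbT.
have Rz : (1 - eta) * d <= complex.Re z.
  have := le_trans (normr_Re_le_normc _) zd.
  by rewrite ReB /= ler_norml => /andP[]; lra.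
have nz : normc z <= (1 + eta) * d.
  have -> : z = (z - d%:C) + d%:C by rewrite subrK.
  by apply: le_trans (le_normcD _ _) _; rewrite normcR (gtr0_norm d0); lra.
have n0 : 0 < normc z by apply: lt_le_trans (Re_le_normc z); apply: lt_le_trans Rz; rewrite mulr_gt0//; lra.
set u := complex.Re z / normc z; have u1 : -1 <= u <= 1 by exact: Re_div_normc.
have tu : cos t <= u.
  rewrite /u ler_pdivlMr//; apply: le_trans Rz.
  apply: (@le_trans _ _ (cos t * ((1 + eta) * d))); first by rewrite ler_pM2l.
  rewrite mulrA ler_pM2r//; have : cos t * eta <= eta by apply: ler_piMl; exact: ltW.
  by move: (eta) e1 e2 => e; lra.
have ua : acos u <= t.
  have : acos u \in `[0, pi] by rewrite in_itv/= acos_ge0// acos_lepi.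
  by move=> Iu; rewrite -ler_cos// acosK// in_itv/=.
have -> : cos (c * carg z) = cos (`|c| * acos u).
  rewrite /carg -/u; have -> : cos (`|c| * acos u) = cos (c * acos u).
    by have [c0|c0] := ler0P c; rewrite // mulNr cosN.
  by case: ifP => _ //; rewrite mulrN cosN.
have a0 := acos_ge0 u1.
have ca : `|c| * acos u <= 1.
  apply: (@le_trans _ _ (`|c| * t)); first by rewrite ler_wpM2l.
  by rewrite /t ler_pdivrMr// mul1r lerDl.
rewrite ler_cos// in_itv/= mulr_ge0//=; exact: le_trans ca pi1.
Qed.

End argument.

Section kernels.
Variables (R : realType) (n : nat) (b c : R).
Local Notation C := R[i].
Local Notation Cn := (n.-tuple C).
Local Notation B := (@unit_ball R n).

Lemma measurable_pair_inner : measurable_fun setT (fun x : Cn * Cn => 1 - inner x.1 x.2).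
Proof.
by apply: measurable_csub => //; apply: measurable_inner.
Qed.

Lemma normc_T_kernel (z w : Cn) : normc (T_kernel b c z w) = rho w `^ b * normc (1 - inner z w) `^ (- c).
Proof.
by rewrite /T_kernel normcM normcR (ger0_norm (powR_ge0 _ _)) normcV normc_cpow powRN.
Qed.

Lemma normc_S_kernel (z w : Cn) : normc (S_kernel b c z w) = rho w `^ b * normc (1 - inner z w) `^ (- c).
Proof. by rewrite /S_kernel normcR ger0_norm ?divr_ge0 ?powR_ge0// powRN. Qed.

Let measurable_kernel_norm e e' : measurable_fun setT
  (fun x : Cn * Cn => rho x.2 `^ e * normc (1 - inner x.1 x.2) `^ e').
Proof.
apply: measurable_funM; first exact: (measurable_snd_comp (measurable_rho_powR e)).
exact: (measurableT_comp (measurable_powR _) (measurable_fun_normc measurable_pair_inner)).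
Qed.

Lemma Re_T_kernel (z w : Cn) : complex.Re (T_kernel b c z w) =
  rho w `^ b * normc (1 - inner z w) `^ (- c) * cos (c * carg (1 - inner z w)).
Proof. by rewrite /T_kernel cpowV /=; ring. Qed.

Lemma Im_T_kernel (z w : Cn) : complex.Im (T_kernel b c z w) =
  rho w `^ b * normc (1 - inner z w) `^ (- c) * - sin (c * carg (1 - inner z w)).
Proof. by rewrite /T_kernel cpowV /=; ring. Qed.

Lemma measurable_T_kernel : measurable_fun setT (fun x : Cn * Cn => T_kernel b c x.1 x.2).
Proof.
have ma : measurable_fun setT (fun x : Cn * Cn => c * carg (1 - inner x.1 x.2)).
  by apply: measurable_funM => //; exact: (measurableT_comp (@measurable_carg R) measurable_pair_inner).
apply: measurable_complexP => //.
- under eq_fun do rewrite Re_T_kernel; apply: measurable_funM => //.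
  apply: (measurableT_comp _ ma); apply: continuous_measurable_fun.
  exact: continuous_cos.
- under eq_fun do rewrite Im_T_kernel; apply: measurable_funM => //.
  apply: measurable_funN; apply: (measurableT_comp _ ma); apply: continuous_measurable_fun.
  exact: continuous_sin.
Qed.

Lemma measurable_S_kernel : measurable_fun setT (fun x : Cn * Cn => S_kernel b c x.1 x.2).
Proof.
apply: measurable_complexP => //.
have -> : (fun x : Cn * Cn => complex.Re (S_kernel b c x.1 x.2)) =
    (fun x : Cn * Cn => rho x.2 `^ b * normc (1 - inner x.1 x.2) `^ (- c)).
  by apply/funext => x; rewrite powRN.
exact: measurable_kernel_norm.
Qed.

(** All that the necessity part asks of the size of the kernel. For [S] the modulus gives it with
    eta = 1/2; for [T] the cosine of c arg (1 - <z,w>) has to stay positive, which shrinks eta. *)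
Definition kernel_Re_bound (eta kappa : R) (K : Cn -> Cn -> C) := forall d z w,
  0 < d -> B z -> B w -> normc (1 - inner z w - d%:C) <= eta * d ->
  kappa * rho w `^ b * d `^ (- c) <= complex.Re (K z w).

Lemma normc_near_powR (eta d : R) (x : C) : eta <= 2^-1 -> 0 < d ->
  normc (x - d%:C) <= eta * d -> 2 `^ (- `|c|) * d `^ (- c) <= normc x `^ (- c).
Proof.
move=> e1 d0 h; rewrite -(normrN c).
have ed : eta * d <= 2^-1 * d by rewrite ler_pM2r.
suff /(powR_near (- c) d0)/andP[] : d / 2 <= normc x <= 2 * d by [].
have h1 := le_normcD (x - d%:C) d%:C; have h2 := le_normcD (d%:C - x) x.
rewrite subrK normcR (gtr0_norm d0) in h1; rewrite subrK normcR (gtr0_norm d0) (normcB (d%:C)) in h2.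
by apply/andP; split; move: (normc x) (normc _) h h1 h2 => u v; lra.
Qed.

Lemma S_kernel_Re_bound : kernel_Re_bound 2^-1 (2 `^ (- `|c|)) (S_kernel b c).
Proof.
move=> d z w d0 zB wB h; rewrite /S_kernel /= -powRN mulrAC mulrC.
by apply: ler_wpM2l (normc_near_powR _ d0 h); rewrite ?powR_ge0.
Qed.

Lemma T_kernel_Re_bound : exists eta : R, [/\ 0 < eta, eta <= 2^-1 &
  kernel_Re_bound eta (2 `^ (- `|c|) * cos 1) (T_kernel b c)].
Proof.
have [eta [e0 e1 H]] := cos_carg_gt c; exists eta; split => // d z w d0 zB wB h.
rewrite Re_T_kernel.
have -> : 2 `^ (- `|c|) * cos 1 * rho w `^ b * d `^ (- c) =
  rho w `^ b * (2 `^ (- `|c|) * d `^ (- c)) * cos 1 by ring.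
apply: ler_pM.
- by rewrite !mulr_ge0 ?powR_ge0.
- exact: ltW (cos1_gt0 R).
- by apply: ler_wpM2l (normc_near_powR e1 d0 h); exact: powR_ge0.
- exact: H d0 h.
Qed.

End kernels.

Lemma FR_boundedP (R : realType) (n : nat) (a b c alpha beta eta kappa q : R) (p : \bar R)
    (K : n.-tuple R[i] -> n.-tuple R[i] -> R[i]) : (0 < n)%N ->
  -1 < alpha -> -1 < beta -> 1 <= q -> (q%:E < p)%E ->
  measurable_fun setT (fun x : n.-tuple R[i] * n.-tuple R[i] => K x.1 x.2) ->
  (forall z w, unit_ball z -> unit_ball w ->
    normc (K z w) = rho w `^ b * normc (1 - inner z w) `^ (- c)) ->
  0 < eta -> eta <= 2^-1 -> 0 < kappa -> kernel_Re_bound b c eta kappa K ->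
  FR_bounded a K p alpha q%:E beta <-> FR_condition n a b c alpha beta p q.
Proof.
case: n K => // m K _ a1 b1 q1 qp mK nK e0 e1 k0 KRe; split; last exact: FR_condition_bounded.
have m0 : 0 <= m%:R :> R by [].
pose M : R := 4 + ((4 * m%:R + 2) ^+ 2 + 4 * m%:R).
have M0 : 0 < M by rewrite ltr_wpDr// addr_ge0 ?sqr_ge0// mulr_ge0.
have m16 : 0 < 16 * (m%:R + 1) :> R by rewrite mulr_gt0// ltr_wpDl.
(* The first bound keeps 1 - <u,w> within eta d of d on a box of depth d, the second makes the boxes
   disjoint. *)
pose ep := Num.min (eta / M) (16 * (m%:R + 1))^-1.
have ep0 : 0 < ep by rewrite lt_min divr_gt0// invr_gt0.
have ep_m : 16 * (m%:R + 1) * ep <= 1 by rewrite -ler_pdivlMl// mulr1 ge_min lexx orbT.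
have ep_eta : M * ep <= eta by rewrite -ler_pdivlMl// [_ * eta]mulrC ge_min lexx.
exact: (FR_bounded_condition ep0 ep_m ep_eta e0 e1 mK k0 KRe a1 b1 q1 qp).
Qed.

Lemma S_boundedP (R : realType) (n : nat) (a b c alpha beta q : R) (p : \bar R) : (0 < n)%N ->
  -1 < alpha -> -1 < beta -> 1 <= q -> (q%:E < p)%E ->
  S_bounded n a b c p alpha q%:E beta <-> FR_condition n a b c alpha beta p q.
Proof.
move=> n0 a1 b1 q1 qp; apply: FR_boundedP (@S_kernel_Re_bound R n b c) => //.
- exact: measurable_S_kernel.
- by move=> z w _ _; exact: normc_S_kernel.
Qed.

Lemma T_boundedP (R : realType) (n : nat) (a b c alpha beta q : R) (p : \bar R) : (0 < n)%N ->
  -1 < alpha -> -1 < beta -> 1 <= q -> (q%:E < p)%E ->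
  T_bounded n a b c p alpha q%:E beta <-> FR_condition n a b c alpha beta p q.
Proof.
move=> n0 a1 b1 q1 qp; have [eta [e0 e1 H]] := @T_kernel_Re_bound R n b c.
apply: FR_boundedP H => //.
- exact: measurable_T_kernel.
- by move=> z w _ _; exact: normc_T_kernel.
- by rewrite mulr_gt0 ?powR_gt0// cos1_gt0.
Qed.

Theorem theorem1p1 (R : realType) (n : nat) (hn : (1 <= n)%N)
    (a b c alpha beta : R) (halpha : -1 < alpha) (hbeta : -1 < beta)
    (p : \bar R) (q : R) (hq : 1 <= q) (hqp : (q%:E < p)%E) :
  (S_bounded n a b c p alpha q%:E beta <-> T_bounded n a b c p alpha q%:E beta)
  /\
  (T_bounded n a b c p alpha q%:E beta
     <-> FR_condition n a b c alpha beta p q).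
Proof.
have TP := @T_boundedP R n a b c alpha beta q p hn halpha hbeta hq hqp.
have SP := @S_boundedP R n a b c alpha beta q p hn halpha hbeta hq hqp.
exact: conj (iff_trans SP (iff_sym TP)) TP.
Qed.
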